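(* For $\beta\in(-1,1)$ consider the fictitious play dynamics $$\frac{dp^A}{dt}\in BR_A(p^B)-p^A,\qquad \frac{dp^B}{dt}\in BR_B(p^A)-p^B \qquad(\ast)$$ for the $3\times 3$ game with matrices $$A=\begin{pmatrix}1&0&\beta\\ \beta&1&0\\ 0&\beta&1\end{pmatrix},\qquad B=\begin{pmatrix}-\beta&1&0\\0&-\beta&1\\1&0&-\beta\end{pmatrix}.$$ When $\beta\in(0,1)$ the unique flow on the complement of the indifference set $Z$ extends to a flow on $Z$ which is everywhere continuous and unique except at $E=(E^A,E^B)$. When $\beta\in(-1,0]$, the unique flow on the complement of $Z$ does not extend continuously to some codimension two surfaces in $Z^*$. In more detail: (i) If $\beta\in(-1,0)$, then the transversality condition holds for all codimension one indifference points in $Z$. All the codimension two points in $Z^*$ are in cases (1) or (3), and the flow off $Z$ extends continuously to those points that are in case (1). The differential inclusion $(\ast)$ defines a flow that is unique except at the remaining points of $Z^*$ (those not in case (1)), where the flow is discontinuous. (ii) If $\beta=0$, then the transversality condition fails to hold in several codimension-one sets (for example, the set $Z^B_{1,2}\times\{p^B\in\Sigma_B: BR_A(p^B)=P^A_2\}$). (iii) If $\beta\in(0,1)$, then the transversality condition holds on all codimension one indifference sets, and all the codimension two points in $Z^*$ are in case (1) or (2). In particular, the flow off $Z$ extends continuously to all points except $E=(E^A,E^B)$, and so the differential inclusion $(\ast)$ defines a unique and continuous flow everywhere except at the interior equilibrium $E$.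
   Context: $\Sigma_A,\Sigma_B\subset\mathbb{R}^3$ denote the simplex of probability vectors; $p^A\in\Sigma_A$ is a row vector and $p^B\in\Sigma_B$ a column vector. $P^A_i\in\Sigma_A$, $P^B_j\in\Sigma_B$ are the pure strategies (unit vectors). Put $v^A=Ap^B$, $v^B=p^AB$. $BR_A(p^B)\subset\Sigma_A$ is the set of convex combinations of those $P^A_i$ for which $v^A_i$ is a maximal coordinate of $v^A$; $BR_B(p^A)\subset\Sigma_B$ is defined similarly from $v^B$. The interior equilibrium is $E=(E^A,E^B)$ with $E^A=(E^B)^T=(1/3,1/3,1/3)$, where all coordinates of $v^A$ are equal and all coordinates of $v^B$ are equal. $Z^A_{i,j}\subset\Sigma_B$ ($i\neq j$) is the set of $p^B$ where both $P^A_i$ and $P^A_j$ are best responses of player A; $Z^B_{k,l}\subset\Sigma_A$ is the analogous set for player B. $Z^A=\bigcup Z^A_{i,j}$, $Z^B=\bigcup Z^B_{k,l}$; $Z=(\Sigma_A\times Z^A)\cup(Z^B\times\Sigma_B)$ is the set where at least one player is indifferent, and $Z^*=Z^B\times Z^A$ the set where both are. Codimension one points of $Z$ are the points outside $Z^*$; codimension two points of $Z^*$ are those where each player is indifferent between exactly two best responses. Transversality condition (at points outside $Z^*$): if $p^A\in Z^B$, $p^B\notin Z^A$ and $P^A_k$ is strictly preferred by A at $p^B$, then $P^A_k$ is not parallel to $Z^B$ at $p^A$, i.e. if $p^A\in Z^B_{l,l'}$ then $P^A_k\notin\{x:(xB)_l=(xB)_{l'}\}$, equivalently $b_{kl}\ne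 b_{kl'}$; and similarly, if $p^B\in Z^A_{i,i'}$, $p^A\notin Z^B$ and $P^B_l$ is strictly preferred by B, then $a_{il}\neq a_{i'l}$. Cases at a codimension two point where A is indifferent between $i,j$ and B between $k,l$: consider the $2\times2$ fictitious play game with payoffs $a_{rs},b_{rs}$, $r\in\{i,j\}$, $s\in\{k,l\}$; near the point, the flow is the product of the flow of this $2\times2$ game and a constant flow. Case (1): the $2\times2$ game has no interior equilibrium, and trajectories cross $Z^B_{k,l}$ or $Z^A_{i,j}$ transversally. Case (2): the $2\times 2$ game has an interior equilibrium which is stable, with orbits spiralling towards it and the flow extending continuously to it. Case (3): the $2\times2$ game has an interior equilibrium which is a saddle, to which the flow cannot be extended continuously (genuine non-uniqueness). *)

(* Defs.v *)
From HB Require Import structures.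
From mathcomp Require Export all_boot all_order all_algebra.
From mathcomp Require Export all_classical all_reals all_analysis.
Export Order.TTheory GRing.Theory Num.Theory.
Export numFieldNormedType.Exports.

#[export] Set Implicit Arguments.
#[export] Unset Strict Implicit.
#[export] Unset Printing Implicit Defensive.

Global Open Scope classical_set_scope.
Global Open Scope ring_scope.

(* The game-theoretic notions are stated for an arbitrary m x n bimatrix game
   (A, B), so that they apply both to the 3 x 3 family and to its 2 x 2
   subgames.  A mixed strategy profile is a pair (p^A, p^B) of a row and a
   column vector, with payoffs v^A = A p^B and v^B = p^A B. *)
Section Game.
Context {R : realType} {m n : nat}.
Notation profile := ('rV[R]_m * 'cV[R]_n)%type.
Implicit Types (A B : 'M[R]_(m, n)) (z : profile).

Definition simplexA : set 'rV[R]_m :=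
  [set p | (forall i, 0 <= p 0 i) /\ \sum_i p 0 i = 1].
Definition simplexB : set 'cV[R]_n :=
  [set p | (forall j, 0 <= p j 0) /\ \sum_j p j 0 = 1].
Definition simplexAB : set profile := simplexA `*` simplexB.

Definition pureA (i : 'I_m) : 'rV[R]_m := delta_mx 0 i.
Definition pureB (j : 'I_n) : 'cV[R]_n := delta_mx j 0.

Definition bestA A (pB : 'cV[R]_n) (i : 'I_m) : Prop :=
  forall r, (A *m pB) r 0 <= (A *m pB) i 0.
Definition bestB B (pA : 'rV[R]_m) (j : 'I_n) : Prop :=
  forall s, (pA *m B) 0 s <= (pA *m B) 0 j.

(* The coordinates of a mixed strategy are its weights as a convex combination
   of the pure strategies. *)
Definition BRA A (pB : 'cV[R]_n) : set 'rV[R]_m :=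
  [set x | simplexA x /\ forall i, x 0 i != 0 -> bestA A pB i].
Definition BRB B (pA : 'rV[R]_m) : set 'cV[R]_n :=
  [set y | simplexB y /\ forall j, y j 0 != 0 -> bestB B pA j].

Definition ZAij A (i j : 'I_m) : set 'cV[R]_n :=
  [set pB | [/\ simplexB pB, bestA A pB i & bestA A pB j]].
Definition ZBkl B (k l : 'I_n) : set 'rV[R]_m :=
  [set pA | [/\ simplexA pA, bestB B pA k & bestB B pA l]].
Definition ZA A : set 'cV[R]_n :=
  [set pB | exists i j, i != j /\ ZAij A i j pB].
Definition ZB B : set 'rV[R]_m :=
  [set pA | exists k l, k != l /\ ZBkl B k l pA].
Definition Z A B : set profile := simplexA `*` ZA A `|` ZB B `*` simplexB.
Definition Zstar A B : set profile := ZB B `*` ZA A.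

Definition interior_equilibrium A B : set profile :=
  [set e | [/\ simplexAB e,
    (forall i, 0 < e.1 0 i) /\ (forall j, 0 < e.2 j 0),
    forall i i', (A *m e.2) i 0 = (A *m e.2) i' 0 &
    forall j j', (e.1 *m B) 0 j = (e.1 *m B) 0 j']].

Definition abs_continuous (a b : R) (f : R -> profile) : Prop :=
  forall eps, 0 < eps -> exists2 delta, 0 < delta &
    forall (N : nat) (s t : 'I_N -> R),
      (forall i, a <= s i /\ s i <= t i /\ t i <= b) ->
      (forall i j, i != j -> t i <= s j \/ t j <= s i) ->
      \sum_i (t i - s i) < delta ->
      \sum_i `|f (t i) - f (s i)| < eps.

Definition fp_rhs A B z : set profile :=
  [set b - z | b in BRA A z.2 `*` BRB B z.1].

(* Caratheodory solutions of the differential inclusion on [0, T]; the values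
   of p outside [0, T] are irrelevant. *)
Definition fp_solution A B (T : R) (p : R -> profile) : Prop :=
  [/\ forall t, 0 <= t <= T -> simplexAB (p t),
      abs_continuous 0 T p &
      {ae (@lebesgue_measure R), forall t, 0 < t < T ->
         derivable p t 1 /\ fp_rhs A B (p t) ('D_1 p t)}].

Definition fp_solution_forever A B (p : R -> profile) : Prop :=
  forall T, fp_solution A B T p.

Definition flow_unique_off_Z A B : Prop :=
  forall x, simplexAB x -> ~ Z A B x ->
    (exists T p, [/\ 0 < T, fp_solution A B T p, p 0 = x &
       forall t, 0 <= t <= T -> ~ Z A B (p t)]) /\
    (forall T p q, fp_solution A B T p -> fp_solution A B T q ->
       p 0 = x -> q 0 = x -> (forall t, 0 <= t < T -> ~ Z A B (p t)) ->
       forall t, 0 <= t <= T -> p t = q t).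

Definition unique_at A B z : Prop :=
  exists2 T, 0 < T & forall S p q, S <= T ->
    fp_solution A B S p -> fp_solution A B S q -> p 0 = z -> q 0 = z ->
    forall t, 0 <= t <= S -> p t = q t.

(* Weak, pointwise form: the orbits issued from points of the complement of Z
   converge to a common curve as the initial point tends to z. *)
Definition offZ_flow_converges A B z : Prop :=
  exists T (gamma : R -> profile), 0 < T /\
    forall eps, 0 < eps -> exists2 delta, 0 < delta &
      forall S p, S <= T -> fp_solution A B S p -> ~ Z A B (p 0) ->
        `|p 0 - z| < delta ->
        forall t, 0 <= t <= S -> `|p t - gamma t| < eps.

(* Strong form: near z, the flow on the complement of Z is the restriction of
   a continuous local flow defined on a full neighbourhood of z. *)
Definition offZ_flow_extends A B z : Prop :=
  exists T delta (Phi : profile * R -> profile), [/\ 0 < T, 0 < delta,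
    {within [set y | [/\ simplexAB y.1, `|y.1 - z| < delta & 0 <= y.2 <= T]],
      continuous Phi} &
    forall S p, S <= T -> fp_solution A B S p -> ~ Z A B (p 0) ->
      `|p 0 - z| < delta -> forall t, 0 <= t <= S -> p t = Phi (p 0, t)].

Definition is_flow A B (phi : profile -> R -> profile) : Prop :=
  forall x, simplexAB x ->
    [/\ phi x 0 = x, fp_solution_forever A B (phi x) &
        forall s t, 0 <= s -> 0 <= t -> phi x (s + t) = phi (phi x s) t].

(* An orbit that meets S may lose uniqueness afterwards, so uniqueness and
   continuity are asserted along orbits up to their first entry into S. *)
Definition defines_flow_off A B (S : set profile) : Prop :=
  exists phi, [/\ is_flow A B phi,
    forall T p, fp_solution A B T p -> (forall t, 0 <= t < T -> ~ S (p t)) ->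
      forall t, 0 <= t <= T -> p t = phi (p 0) t &
    forall x t, simplexAB x -> 0 <= t ->
      (forall s, 0 <= s < t -> ~ S (phi x s)) ->
      (fun y : profile * R => phi y.1 y.2)
        @ within [set y | simplexAB y.1 /\ 0 <= y.2] (nbhs (x, t))
        --> phi x t].

Definition strictA A (pB : 'cV[R]_n) (k : 'I_m) : Prop :=
  forall r, r != k -> (A *m pB) r 0 < (A *m pB) k 0.
Definition strictB B (pA : 'rV[R]_m) (l : 'I_n) : Prop :=
  forall s, s != l -> (pA *m B) 0 s < (pA *m B) 0 l.

Definition transversal_at A B z : Prop :=
  (forall k l l', l != l' -> ZBkl B l l' z.1 -> strictA A z.2 k ->
     (pureA k *m B) 0 l != (pureA k *m B) 0 l') /\
  (forall l i i', i != i' -> ZAij A i i' z.2 -> strictB B z.1 l ->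
     (A *m pureB l) i 0 != (A *m pureB l) i' 0).

Definition codim2_at A B (i j : 'I_m) (k l : 'I_n) : set profile :=
  [set z | [/\ simplexAB z, i != j, k != l,
     forall r, bestA A z.2 r <-> (r = i \/ r = j) &
     forall s, bestB B z.1 s <-> (s = k \/ s = l)]].

Definition subgame (C : 'M[R]_(m, n)) (i j : 'I_m) (k l : 'I_n) : 'M[R]_2 :=
  mxsub (fun r : 'I_2 => if r == 0 then i else j)
        (fun s : 'I_2 => if s == 0 then k else l) C.

End Game.

(* 2 x 2 games.  The first coordinates of the two strategies, relative to a
   base point e, are coordinates on the two-dimensional space of profiles. *)
Section Game2.
Context {R : realType}.
Notation profile := ('rV[R]_2 * 'cV[R]_2)%type.
Implicit Types (A B : 'M[R]_2) (e z : profile).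

Definition xcoord e z : R := z.1 0 0 - e.1 0 0.
Definition ycoord e z : R := z.2 0 0 - e.2 0 0.

Definition stable A B e : Prop :=
  forall eps, 0 < eps -> exists2 delta, 0 < delta &
    forall T p, fp_solution A B T p -> `|p 0 - e| < delta ->
      forall t, 0 <= t <= T -> `|p t - e| < eps.

(* In polar coordinates (rho, theta) centred at e, rho tends to 0 while the
   angle tends to infinity. *)
Definition spirals_to A B e : Prop :=
  forall p, fp_solution_forever A B p -> p 0 <> e ->
    exists rho theta : R -> R, [/\ {within `[0, +oo[, continuous theta},
      forall t, 0 <= t -> [/\ 0 < rho t,
        xcoord e (p t) = rho t * cos (theta t) &
        ycoord e (p t) = rho t * sin (theta t)],
      rho t @[t --> +oo] --> (0 : R) &
      `|theta t| @[t --> +oo] --> +oo].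

(* Two opposite quadrants at e contain an orbit entering e, the other two an
   orbit leaving e, and every other orbit near e leaves a neighbourhood of e.
   Fictitious play orbits have non-vanishing speed, so that the incoming
   separatrices reach the saddle in finite time. *)
Definition saddle A B e : Prop :=
  (exists2 sg : R, sg = 1 \/ sg = -1 &
    forall tau : R, tau = 1 \/ tau = -1 ->
    (exists T p, [/\ 0 < T, fp_solution A B T p, p T = e &
       forall t, 0 <= t < T -> 0 < tau * xcoord e (p t) /\
                               0 < - (sg * tau) * ycoord e (p t)]) /\
    (exists T p, [/\ 0 < T, fp_solution A B T p, p 0 = e &
       forall t, 0 < t <= T -> 0 < tau * xcoord e (p t) /\
                               0 < sg * tau * ycoord e (p t)])) /\
  (exists2 delta, 0 < delta &
    forall p, fp_solution_forever A B p -> `|p 0 - e| < delta ->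
      (forall t, 0 <= t -> p t <> e) ->
      exists2 t, 0 <= t & delta <= `|p t - e|).

End Game2.

Section Cases.
Context {R : realType} {m n : nat}.
Implicit Types (A B : 'M[R]_(m, n)) (z : 'rV[R]_m * 'cV[R]_n).

(* Crossing transversally: no velocity allowed by the differential inclusion
   at z is tangent to the indifference set in question. *)
Definition case1 A B i j k l z : Prop :=
  ~ (exists e, interior_equilibrium (subgame A i j k l) (subgame B i j k l) e)
  /\ ((forall w, fp_rhs A B z w -> (w.1 *m B) 0 k != (w.1 *m B) 0 l) \/
      (forall w, fp_rhs A B z w -> (A *m w.2) i 0 != (A *m w.2) j 0)).

Definition case2 A B (i j : 'I_m) (k l : 'I_n) : Prop :=
  let A2 := subgame A i j k l in let B2 := subgame B i j k l in
  exists e, [/\ interior_equilibrium A2 B2 e, stable A2 B2 e,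
    spirals_to A2 B2 e & offZ_flow_extends A2 B2 e].

Definition case3 A B (i j : 'I_m) (k l : 'I_n) : Prop :=
  let A2 := subgame A i j k l in let B2 := subgame B i j k l in
  exists e, [/\ interior_equilibrium A2 B2 e, saddle A2 B2 e,
    ~ offZ_flow_converges A2 B2 e & ~ unique_at A2 B2 e].

Definition in_case1 A B : set ('rV[R]_m * 'cV[R]_n) :=
  [set z | exists i j k l, codim2_at A B i j k l z /\ case1 A B i j k l z].

End Cases.

Section Family.
Context {R : realType}.

Definition mx3 (rows : seq (seq R)) : 'M[R]_3 :=
  \matrix_(i, j) nth 0 (nth [::] rows i) j.

Definition Abeta (beta : R) : 'M[R]_3 :=
  mx3 [:: [:: 1; 0; beta]; [:: beta; 1; 0]; [:: 0; beta; 1]].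
Definition Bbeta (beta : R) : 'M[R]_3 :=
  mx3 [:: [:: - beta; 1; 0]; [:: 0; - beta; 1]; [:: 1; 0; - beta]].

Definition E : 'rV[R]_3 * 'cV[R]_3 := (const_mx 3^-1, const_mx 3^-1).

End Family.

(* Main.v *)
(* A solution p satisfies d(exp t * p)/dt = exp t * b with b a best response, so
   any linear functional whose sign is known on the available best responses is
   controlled explicitly.  Where the sets I, J of best responses reduce, by
   iterated elimination of strictly dominated strategies, to a single pure profile
   or to a cyclic 2 x 2 game, two solutions starting d-close stay O(d)-close: after
   a time O(d) the dominated strategies are no longer best responses, and in the
   cyclic game exp t * L is constant, where L is the sum of the kinks
   max(-d0 u, -d1 u) + max(c0 w, c1 w) in the payoff differences u and w.  This
   yields uniqueness and continuity; orbits are built as straight motions towards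
   an equilibrium of the game restricted to the current best responses.

   In the 2 x 2 games the angle of an orbit around the equilibrium grows linearly
   in exp t in the cyclic case, while at a saddle orbits leave along straight
   rays.  Near a saddle point of Z* there are rays off Z towards two different pure
   profiles, whence discontinuity and non-uniqueness.  For the family itself, with
   a_ij depending only on i - j and b_ij on j - i, every 2 x 2 subgame has a
   dominated strategy or is cyclic if beta > 0, and has a dominated strategy or is
   a saddle if beta < 0. *)

(* Velocities are discontinuous in the state, so no Gronwall estimate compares two solutions, and
   the inclusion holds only almost everywhere. Both difficulties are met by testing solutions
   against finitely many scalar functionals: each is absolutely continuous, and monotonicity follows
   from one-sided difference quotients off a null set, which also covers the kinks. The distance [d]
   of the initial points to a base point is the only small parameter. Every transient lasts O(d) and
   unit speed costs O(d) during it, so bounds stay linear in [d], and uniqueness is their limit as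
   [d] tends to 0.

   Where uniqueness fails a semigroup of solutions must still be selected, and switches of an orbit
   may accumulate. The selection prescribes only the motion just after each time, towards a target
   that persists along the motion; limits at accumulation points exist because orbits are
   1-Lipschitz.

   Points where a player has three best responses are not codimension two points; for negative
   [beta] they inherit discontinuity from saddles accumulating at them. *)
Require Import Defs.
From mathcomp Require Import measurable_realfun ring lra.

(** * Absolutely continuous functions *)

Lemma eps_ler (R : realType) (x y : R) :
  (forall e, 0 < e -> x <= y + e) -> x <= y.
Proof. by move=> h; apply/ler_addgt0Pr => e /h. Qed.

Section AbsoluteContinuity.
Context {R : realType}.
Implicit Types (a b c s t x : R) (g f : R -> R).

(** Let [c] be the infimum of the points from which [g] stays above [g b]. Semicontinuity from the
    right at [c] keeps [c] in this set, and the local hypothesis at [c] then moves it further left.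
    Semicontinuity is the right assumption because the applications subtract a monotone function
    that may jump. *)
Lemma left_local_nonincreasing a b g : a <= b ->
  (forall t, a < t <= b -> exists2 eta : R, 0 < eta &
     forall s, a <= s -> t - eta < s < t -> g t <= g s) ->
  (forall c, a <= c < b -> forall eps : R, 0 < eps -> exists2 eta : R, 0 < eta &
     forall x, c < x < c + eta -> x <= b -> g x - eps <= g c) ->
  g b <= g a.
Proof.
move=> ab hl hc.
pose S := [set x | a <= x <= b /\ forall y, x <= y <= b -> g b <= g y].
have Sb : S b.
  split; first by rewrite ab lexx.
  by move=> y /le_anti ->.
have lbS : lbound S a by move=> x [/andP[]].
have infS : has_inf S by split; [exists b|exists a].
set c := inf S.
have ac : a <= c by apply: lb_le_inf => //; exists b.
have cb : c <= b by apply: ge_inf => //; exists a.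
have above y : c < y -> y <= b -> g b <= g y.
  move=> cy yb; have [x [xab hx] xy] := inf_lt (proj1 infS) cy.
  by apply: hx; rewrite (ltW xy) yb.
have gc : g b <= g c.
  have [->//|cnb] := eqVneq c b.
  have cltb : c < b by rewrite lt_neqAle cnb cb.
  apply: eps_ler => e e0.
  have [eta eta0 h] := hc c (introT andP (conj ac cltb)) e e0.
  pose x := Num.min b (c + eta / 2).
  have xb : x <= b by rewrite ge_min lexx.
  have cx : c < x by rewrite lt_min cltb/=; lra.
  have xe : x < c + eta by rewrite /x gt_min; apply/orP; right; lra.
  have := h x; rewrite cx xe => /(_ isT xb).
  have := above x cx xb; lra.
have Sc : S c.
  split; first by rewrite ac cb.
  move=> y /andP[]; rewrite le_eqVlt => /orP[/eqP<- //|cy yb]; exact: above.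
have [ca|cna] := eqVneq c a; first by rewrite -ca.
have altc : a < c by rewrite lt_neqAle eq_sym cna ac.
have [eta eta0 h] := hl c (introT andP (conj altc cb)).
pose x := Num.max a (c - eta / 2).
have ax : a <= x by rewrite le_max lexx.
have xc : x < c by rewrite gt_max altc/=; lra.
have ex : c - eta < x by rewrite lt_max; apply/orP; right; lra.
suff Sx : S x by have := ge_inf (ex_intro _ a lbS) Sx; rewrite leNgt xc.
split; first by rewrite ax (le_trans (ltW xc) cb).
move=> y /andP[xy yb]; have [cy|yc] := leP c y.
  by apply: (proj2 Sc); rewrite cy yb.
apply: le_trans gc (h y (le_trans ax xy) _).
by rewrite (lt_le_trans ex xy) yc.
Qed.

Lemma real_induction (P : R -> Prop) (T : R) : 0 <= T -> P 0 ->
  (forall c, 0 <= c < T -> P c -> exists2 eps : R, 0 < eps &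
     forall s, c < s < c + eps -> s <= T -> P s) ->
  (forall c, 0 < c <= T -> (forall s, 0 <= s < c -> P s) -> P c) -> P T.
Proof.
move=> T0 P0 step clos.
pose S := [set x | 0 <= x <= T /\ forall y, 0 <= y <= x -> P y].
have S0 : S 0.
  by split; [rewrite lexx|move=> y y0; have -> : y = 0 by apply/le_anti; rewrite andbC].
have supS : has_sup S by split; [exists 0|exists T => x [/andP[]]].
set c := sup S.
have c0 : 0 <= c by apply: ub_le_sup => //; case: supS.
have cT : c <= T by apply: ge_sup; [exists 0|move=> x [/andP[]]].
have below s : 0 <= s < c -> P s.
  move=> /andP[s0 sc]; have [x [_ hx] sx] := sup_gt supS.1 sc.
  by apply: hx; rewrite s0 ltW.
have Pc : P c.
  have [cpos|] := ltP 0 c; first by apply: clos => //; rewrite cpos.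
  by move=> cn; have -> : c = 0 by apply/le_anti; rewrite cn.
have [cltT|Tc] := ltP c T; last first.
  by have <- : c = T by apply/le_anti; rewrite cT Tc.
have [eps e0 he] := step c (introT andP (conj c0 cltT)) Pc.
pose x := Num.min T (c + eps / 2).
have cx : c < x by rewrite lt_min cltT; lra.
have xe : x < c + eps by rewrite gt_min; apply/orP; right; lra.
have xT : x <= T by rewrite ge_min lexx.
suff /(ub_le_sup supS.2) : S x by rewrite -/c leNgt cx.
split; first by rewrite xT andbT; lra.
move=> y /andP[y0 yx]; have [yc|] := ltP y c; first by apply: below; rewrite y0.
rewrite le_eqVlt => /orP[/eqP<- //|cy]; apply: he; last exact: le_trans xT.
by rewrite cy (le_lt_trans yx).
Qed.

(** Scalar form of [abs_continuous] on [a, b], meant for functionals evaluated along a solution. *)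
Definition ac a b f : Prop :=
  forall eps : R, 0 < eps -> exists2 delta : R, 0 < delta &
    forall (N : nat) (s t : 'I_N -> R),
      (forall i, a <= s i /\ s i <= t i /\ t i <= b) ->
      (forall i j, i != j -> t i <= s j \/ t j <= s i) ->
      \sum_i (t i - s i) < delta ->
      \sum_i `|f (t i) - f (s i)| < eps.

Lemma ac_continuous a b f : ac a b f -> forall eps : R, 0 < eps ->
  exists2 delta : R, 0 < delta & forall s t, a <= s -> s <= t -> t <= b ->
    t - s < delta -> `|f t - f s| < eps.
Proof.
move=> acf eps eps0; have [d d0 h] := acf _ eps0; exists d => // s t sa st tb ts.
have := h 1%N (fun=> s) (fun=> t); rewrite !big_ord1; apply => //.
by move=> i j; rewrite !ord1.
Qed.

Lemma sum_disjoint_le (U : set R) (m : R) (N : nat) (s t : 'I_N -> R) :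
  open U -> (lebesgue_measure U < m%:E)%E ->
  (forall i, s i <= t i) ->
  (forall i j, i != j -> t i <= s j \/ t j <= s i) ->
  (forall i x, s i <= x <= t i -> U x) ->
  \sum_i (t i - s i) < m.
Proof.
move=> oU muU st dis sub.
(* Open intervals are disjoint even when the closed ones share an end point, and they have the same
   measure. *)
pose F (i : 'I_N) : set R := `]s i, t i[%classic.
have mF i : measurable (F i) by exact: measurable_itv.
have mB : measurable (\big[setU/set0]_(i < N) F i).
  by apply: bigsetU_measurable.
have tF : trivIset setT F.
  apply/trivIsetP => i j _ _ ij; rewrite -subset0 => x /= [].
  rewrite /F /= !in_itv /= => /andP[a1 a2] /andP[a3 a4].
  by have [] := dis i j ij; lra.
rewrite -lte_fin; apply: le_lt_trans muU.
rewrite -sumEFin.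
have -> : (\sum_(i < N) (t i - s i)%:E = \sum_(i < N) lebesgue_measure (F i))%E.
  apply: eq_bigr => i _; rewrite /F lebesgue_measure_itv /= lte_fin.
  have := st i; rewrite le_eqVlt => /orP[/eqP ->|->]; last by rewrite EFinB.
  by rewrite ltxx subrr.
rewrite -measure_semi_additive_ord //.
apply: le_measure; rewrite ?inE //; first exact: open_measurable.
elim/big_ind: _ => //; first by move=> A B hA hB; rewrite subUset.
by move=> i _ x; rewrite /F /= in_itv /= => /andP[a1 a2]; apply: (sub i);
  rewrite !ltW.
Qed.

(* The variation of f carried by an open set U of small measure containing the
   exceptional null set compensates the increments of f there. *)
Section VariationOn.
Variables (f : R -> R) (a b e : R) (U : set R).
Hypothesis bound : forall (N : nat) (s t : 'I_N -> R),
  (forall i, a <= s i /\ s i <= t i /\ t i <= b) ->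
  (forall i j, i != j -> t i <= s j \/ t j <= s i) ->
  (forall i x, s i <= x <= t i -> U x) ->
  \sum_i `|f (t i) - f (s i)| <= e.

Definition variation_sums x : set R :=
  [set v | exists (N : nat) (s t : 'I_N -> R),
    [/\ forall i, a <= s i /\ s i <= t i /\ t i <= x,
        forall i j, i != j -> t i <= s j \/ t j <= s i,
        forall i y, s i <= y <= t i -> U y &
        v = \sum_i `|f (t i) - f (s i)|]].

Definition variation_on x : R := sup (variation_sums x).

Lemma variation_sums0 x : variation_sums x 0.
Proof.
exists 0%N, (fun=> 0), (fun=> 0); split; try by case.
by rewrite big_ord0.
Qed.

Lemma variation_sums_has_sup x : x <= b -> has_sup (variation_sums x).
Proof.
move=> xb; split; first by exists 0; apply: variation_sums0.
exists e => _ [N [s [t [st dis sub ->]]]]; apply: bound => // i.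
by have [h1 [h2 h3]] := st i; do 2!split => //; apply: le_trans h3 xb.
Qed.

Lemma variation_on_ge0 x : x <= b -> 0 <= variation_on x.
Proof.
move=> xb; apply: ub_le_sup; last exact: variation_sums0.
by case: (variation_sums_has_sup xb).
Qed.

Lemma variation_on_le x : x <= b -> variation_on x <= e.
Proof.
move=> xb; apply: ge_sup; first by exists 0; apply: variation_sums0.
move=> _ [N [s [t [st dis sub ->]]]]; apply: bound => // i.
by have [h1 [h2 h3]] := st i; do 2!split => //; apply: le_trans h3 xb.
Qed.

(** Any family of intervals ending before [x] can be completed by [x, y], so the supremum is
    superadditive. *)
Lemma variation_on_increment x y : a <= x -> x <= y -> y <= b ->
  (forall z, x <= z <= y -> U z) ->
  variation_on x + `|f y - f x| <= variation_on y.
Proof.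
move=> ax xy yb sub; rewrite -lerBrDr.
apply: ge_sup; first by exists 0; apply: variation_sums0.
move=> _ [N [s [t [st dis subs ->]]]]; rewrite lerBrDr.
apply: ub_le_sup; first by case: (variation_sums_has_sup yb).
pose s' (i : 'I_N.+1) := oapp s x (unlift ord_max i).
pose t' (i : 'I_N.+1) := oapp t y (unlift ord_max i).
exists N.+1, s', t'; split.
- move=> i; rewrite /s' /t'; case: unliftP => [j _|_] /=.
    by have [? [? h]] := st j; do 2!split => //; apply: le_trans h xy.
  by [].
- move=> i j; rewrite /s' /t'.
  case: (unliftP ord_max i) => [i' ->|->];
  case: (unliftP ord_max j) => [j' ->|->] /=; rewrite ?liftK ?unlift_none /=.
  + by rewrite (inj_eq (@lift_inj _ _)); apply: dis.
  + by left; have [_ [_ ]] := st i'.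
  + by right; have [_ [_ ]] := st j'.
  + by rewrite eqxx.
- move=> i z; rewrite /s' /t'; case: unliftP => [j _|_] /=; first exact: subs.
  exact: sub.
- rewrite big_ord_recr /= /s' /t' unlift_none /=; congr (_ + _).
  apply: eq_bigr => i _.
  have -> : widen_ord (leqnSn N) i = lift ord_max i.
    by apply/val_inj; rewrite /= /bump leqNgt ltn_ord.
  by rewrite liftK.
Qed.

End VariationOn.

(** An open set covering [N] can be taken so thin that absolute continuity bounds the variation of
    [f] inside it by [e]. This variation, as a function of the right end, is [W]: small intervals
    around a point of [N] lie in the open set, so [W] grows there at least as much as [f] moves. *)
Lemma null_set_compensator a b f (N : set R) (e : R) : ac a b f ->
  (@lebesgue_measure R).-negligible N -> 0 < e ->
  exists W : R -> R, [/\ forall x y, a <= x -> x <= y -> y <= b -> W x <= W y,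
    forall x, x <= b -> 0 <= W x <= e &
    forall t, N t -> exists2 r : R, 0 < r & forall x y,
      a <= x -> x <= y -> y <= b -> t - r < x -> y < t + r ->
      W x + `|f y - f x| <= W y].
Proof.
move=> acf [M [mM M0 NM]] e0.
have [d d0 hd] := acf e e0.
have Moo : (lebesgue_measure M < +oo)%E by rewrite M0 ltry.
have [U [oU MU muU]] := lebesgue_regularity_outer mM Moo d0.
have {}muU : (lebesgue_measure U < d%:E)%E.
  apply: le_lt_trans muU; rewrite -[X in lebesgue_measure X](setDUK MU).
  apply: le_trans (measureU2 _ _ _) _ => //.
    by apply: measurableD => //; apply: open_measurable.
  by rewrite [X in (X + _)%E](M0 : _ = _) add0e.
have bound (n : nat) (s t : 'I_n -> R) :
  (forall i, a <= s i /\ s i <= t i /\ t i <= b) ->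
  (forall i j, i != j -> t i <= s j \/ t j <= s i) ->
  (forall i x, s i <= x <= t i -> U x) ->
  \sum_i `|f (t i) - f (s i)| <= e.
  move=> st dis sub; apply/ltW/hd => //; apply: sum_disjoint_le oU muU _ dis sub.
  by move=> i; have [_ []] := st i.
exists (variation_on f a U); split.
- move=> x y ax xy yb; apply: ge_sup; first by exists 0; apply: variation_sums0.
  move=> _ [n [s [t [st dis subs ->]]]].
  apply: ub_le_sup; first by case: (variation_sums_has_sup bound yb).
  exists n, s, t; split => // i.
  by have [? [? h]] := st i; do 2!split => //; apply: le_trans h xy.
- by move=> x xb; rewrite (variation_on_ge0 bound xb) (variation_on_le bound xb).
- move=> t Nt; have Ut : U t by exact/MU/NM.
  have /nbhs_ballP[r r0 hr] : nbhs t U by apply: open_nbhs_nbhs.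
  exists r => // x y ax xy yb tx yt.
  apply: (variation_on_increment bound) => // z /andP[z1 z2].
  by apply: hr; rewrite /ball /= ltr_norml; apply/andP; split; lra.
Qed.

Lemma ac_nonincreasing_left a b f (N : set R) : a <= b -> ac a b f ->
  (@lebesgue_measure R).-negligible N ->
  (forall t, a < t <= b -> ~ N t -> forall eps : R, 0 < eps ->
     exists2 eta : R, 0 < eta &
     forall s, a <= s -> t - eta < s < t -> f t - f s <= eps * (t - s)) ->
  f b <= f a.
Proof.
move=> ab acf N0 hN; apply: eps_ler => e e0.
(* Slope allowed off [N]: over [a, b] it costs at most e / 2, the other half being the oscillation
   of [W]. *)
pose e1 := e / 2 / (b - a + 1).
have ba : 0 < b - a + 1 by lra.
have e10 : 0 < e1 by rewrite !divr_gt0.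
have e1b : e1 * (b - a) <= e / 2.
  rewrite /e1 -mulrA ler_piMr //; first lra.
  by rewrite mulrC ler_pdivrMr //; lra.
have [W [Wmono Wb hW]] := null_set_compensator acf N0 (ltac:(lra) : 0 < e / 2).
pose g x := f x - e1 * (x - a) - W x.
suff : g b <= g a.
  by have := Wb a ab; have := Wb b (lexx b); rewrite /g; lra.
apply: left_local_nonincreasing ab _ _.
- move=> t /andP[lat tb]; have [Nt|nNt] := pselect (N t).
    have [r r0 hr] := hW t Nt; exists r => // s sa /andP[s1 s2].
    have := hr s t sa (ltW s2) tb s1 ltac:(lra).
    have := ler_norm (f t - f s).
    have : 0 <= e1 * (t - s) by rewrite mulr_ge0 ?ltW // subr_gt0.
    by rewrite /g; lra.
  have [eta eta0 h] := hN t (introT andP (conj lat tb)) nNt e1 e10.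
  exists eta => // s sa st; have := h s sa st.
  have := Wmono s t sa ltac:(lra) tb; rewrite /g; lra.
- move=> c /andP[ca cb] eps eps0.
  have [eta eta0 h] := ac_continuous acf eps0.
  exists eta => // x /andP[cx xc] xb.
  have := h c x ca (ltW cx) xb ltac:(lra); rewrite ltr_norml => /andP[_].
  have := Wmono c x ca (ltW cx) xb.
  have : 0 <= e1 * (x - c) by rewrite mulr_ge0 ?ltW // subr_gt0.
  rewrite /g; lra.
Qed.

(** Reflection of the left-hand version. The two serve a function known through minorants touching
    it: such a minorant bounds the increments of the function to the left of the contact point, and
    those of its opposite to the right. *)
Lemma ac_nonincreasing_right a b f (N : set R) : a <= b -> ac a b f ->
  (@lebesgue_measure R).-negligible N ->
  (forall t, a <= t < b -> ~ N t -> forall eps : R, 0 < eps ->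
     exists2 eta : R, 0 < eta &
     forall s, s <= b -> t < s < t + eta -> f s - f t <= eps * (s - t)) ->
  f b <= f a.
Proof.
move=> ab acf N0 hN; apply: eps_ler => e e0.
pose e1 := e / 2 / (b - a + 1).
have ba : 0 < b - a + 1 by lra.
have e10 : 0 < e1 by rewrite !divr_gt0.
have e1b : e1 * (b - a) <= e / 2.
  rewrite /e1 -mulrA ler_piMr //; first lra.
  by rewrite mulrC ler_pdivrMr //; lra.
have [W [Wmono Wb hW]] := null_set_compensator acf N0 (ltac:(lra) : 0 < e / 2).
pose g x := - (f (- x) - e1 * (- x - a) - W (- x)).
suff : g (- a) <= g (- b).
  by have := Wb a ab; have := Wb b (lexx b); rewrite /g !opprK; lra.
apply: left_local_nonincreasing; first lra.
- move=> t /andP[lat tb]; have [Nt|nNt] := pselect (N (- t)).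
    have [r r0 hr] := hW (- t) Nt; exists r => // s sa /andP[s1 s2].
    have := hr (- t) (- s) ltac:(lra) ltac:(lra) ltac:(lra) ltac:(lra) ltac:(lra).
    have := ler_norm (f (- s) - f (- t)).
    have : 0 <= e1 * (t - s) by rewrite mulr_ge0 ?ltW // subr_gt0.
    by rewrite /g; lra.
  have [eta eta0 h] := hN (- t) ltac:(lra) nNt e1 e10.
  exists eta => // s sa st; have := h (- s) ltac:(lra) ltac:(lra).
  have := Wmono (- t) (- s) ltac:(lra) ltac:(lra) ltac:(lra); rewrite /g; lra.
- move=> c /andP[ca cb] eps eps0.
  have [eta eta0 h] := ac_continuous acf eps0.
  exists eta => // x /andP[cx xc] xb.
  have := h (- x) (- c) ltac:(lra) ltac:(lra) ltac:(lra) ltac:(lra).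
  rewrite ltr_norml => /andP[_].
  have := Wmono (- x) (- c) ltac:(lra) ltac:(lra) ltac:(lra).
  have : 0 <= e1 * (x - c) by rewrite mulr_ge0 ?ltW // subr_gt0.
  rewrite /g; lra.
Qed.

Lemma ac_lipschitz a b f K :
  (forall s t, a <= s -> s <= t -> t <= b -> `|f t - f s| <= K * (t - s)) ->
  ac a b f.
Proof.
move=> fK eps eps0; have K0 : 0 < `|K| + 1 by rewrite ltr_wpDl.
exists (eps / (`|K| + 1)); first exact: divr_gt0.
move=> N s t st _; rewrite ltr_pdivlMr // => h.
apply: le_lt_trans h; rewrite mulr_suml; apply: ler_sum => i _.
have [si [ti tb]] := st i; apply: le_trans (fK _ _ si ti tb) _.
rewrite mulrC ler_wpM2l ?subr_ge0 // (le_trans (ler_norm K)) //; lra.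
Qed.

Lemma ac_add a b f g : ac a b f -> ac a b g -> ac a b (fun t => f t + g t).
Proof.
move=> acf acg e e0.
have [d d0 hd] := acf (e / 2) ltac:(lra).
have [d' d'0 hd'] := acg (e / 2) ltac:(lra).
exists (Num.min d d'); first by rewrite lt_min d0.
move=> N s t st dis; rewrite lt_min => /andP[h h'].
have := hd N s t st dis h; have := hd' N s t st dis h'.
have : \sum_i `|f (t i) + g (t i) - (f (s i) + g (s i))| <=
  \sum_i `|f (t i) - f (s i)| + \sum_i `|g (t i) - g (s i)|.
  rewrite -big_split /=; apply: ler_sum => i _.
  by rewrite opprD addrACA ler_normD.
lra.
Qed.

Lemma ac_opp a b f : ac a b f -> ac a b (fun t => - f t).
Proof.
move=> acf e /acf[d d0 hd]; exists d => // N s t st dis sum.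
have := hd N s t st dis sum; congr (_ < _); apply: eq_bigr => i _.
by rewrite -opprD normrN.
Qed.

Lemma ac_comp a b f g K : (forall x y, `|g x - g y| <= K * `|x - y|) ->
  ac a b f -> ac a b (fun t => g (f t)).
Proof.
move=> gK acf e e0; have K0 : 0 < `|K| + 1 by rewrite ltr_wpDl.
have [d d0 hd] := acf _ (divr_gt0 e0 K0); exists d => // N s t st dis sum.
have := hd N s t st dis sum; rewrite ltr_pdivlMr //; apply: le_lt_trans.
rewrite mulr_suml; apply: ler_sum => i _; apply: le_trans (gK _ _) _.
by rewrite mulrC ler_wpM2l // (le_trans (ler_norm K)) //; lra.
Qed.

(** A rational chosen in the gap to the right of a point of [D] determines that point. *)
Lemma countable_right_isolated (D : set R) :
  (forall t, D t -> exists2 eta : R, 0 < eta & forall s, t < s < t + eta -> ~ D s) ->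
  countable D.
Proof.
move=> h.
have hq t : exists q : rat, D t -> t < ratr q /\ forall s, t < s <= ratr q -> ~ D s.
  have [Dt|nDt] := pselect (D t); last by exists 0.
  have [eta eta0 he] := h t Dt.
  have [q] := rat_in_itvoo (ltac:(lra) : t < t + eta).
  rewrite in_itv /= => /andP[tq qe]; exists q => _; split => // s /andP[ts sq].
  by apply: he; rewrite ts (le_lt_trans sq).
have [q hq'] := choice hq.
apply/countable_injP; exists (fun t => choice.pickle (q t)).
move=> s t; rewrite !inE => Ds Dt /(pcan_inj choice.pickleK_inv) qst.
have [sq hs] := hq' s Ds; have [tq ht] := hq' t Dt.
have [st|ts|//] := ltgtP s t.
- by exfalso; apply: (hs t) => //; rewrite st qst ltW.
- by exfalso; apply: (ht s) => //; rewrite ts -qst ltW.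
Qed.

End AbsoluteContinuity.

(** The image of Lebesgue measure under a translation agrees with it on half-open intervals, and
    only one measure does. *)
Lemma lebesgue_negligible_shift (R : realType) (N : set R) (c : R) :
  (@lebesgue_measure R).-negligible N ->
  (@lebesgue_measure R).-negligible ((fun t => c + t) @^-1` N).
Proof.
move=> [M [mM M0 NM]].
have mf : measurable_fun [set: measurableTypeR R] ((fun t : measurableTypeR R => c + t) : _ -> measurableTypeR R).
  by apply: continuous_measurable_fun => x; apply: cvgD; [exact: cvg_cst|exact: cvg_id].
exists ((fun t => c + t) @^-1` M); split; last by move=> t /NM.
  by rewrite -[X in measurable X]setTI; apply: mf.
rewrite -[LHS]/(pushforward lebesgue_measure (fun t : measurableTypeR R => c + t) M).
rewrite -(@lebesgue_measure_unique R (pushforward lebesgue_measure (fun t : measurableTypeR R => c + t : measurableTypeR R))) //.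
move=> X [[a b] /= ab <-].
rewrite /pushforward.
have -> : [eta +%R c] @^-1` `]a, b]%classic = `]a - c, b - c]%classic.
  by apply/seteqP; split => x /=; rewrite !in_itv /=; lra.
rewrite !lebesgue_measure_itv /= !lte_fin ltrD2r.
by case: ifP => // _; rewrite -!EFinB; congr (_ %:E); ring.
Qed.

Lemma countable_negligible (R : realType) (N : set R) : countable N ->
  (@lebesgue_measure R).-negligible N.
Proof.
move=> cN; exists N; split => //; first exact: countable_measurable.
exact: countable_lebesgue_measure0.
Qed.

(** * Derivatives of curves and one-sided difference quotients *)

Section Derivatives.
Context {R : realType}.

Lemma is_derive_epsP (V : normedModType R) (p : R -> V) (t : R) (D : V) :
  is_derive t 1 p D <->
  forall e : R, 0 < e -> exists2 d : R, 0 < d &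
    forall h, `|h| < d -> `|p (t + h) - p t - h *: D| <= e * `|h|.
Proof.
have key (h : R) : h != 0 ->
  `|D - h^-1 *: (p (h *: (1 : R) + t) - p t)| =
  `|p (t + h) - p t - h *: D| / `|h|.
  move=> h0; rewrite [h *: (1 : R)]mulr1 [h + t]addrC.
  have -> : D - h^-1 *: (p (t + h) - p t) = h^-1 *: (h *: D - (p (t + h) - p t)).
    by rewrite [RHS]scalerBr scalerA mulVf // scale1r.
  by rewrite normrZ distrC normfV mulrC.
split.
  move=> [dp dD] e e0; move: dp; rewrite /derivable.
  move=> /cvg_ex[l pl]; have Dl : l = D.
    by rewrite -dD /derive; apply/esym/cvg_lim.
  rewrite {}Dl in pl.
  move/cvgrPdist_le: pl => /(_ e e0).
  rewrite near_withinE => /nbhs_ballP[d /= d0 hd]; exists d => // h hd'.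
  have [->|h0] := eqVneq h 0.
    by rewrite addr0 subrr scale0r subrr !normr0 mulr0.
  have := hd h; rewrite /ball /= sub0r normrN => /(_ hd' h0).
  by rewrite key // ler_pdivrMr // normr_gt0.
move=> H.
have pl : h^-1 *: (p (h *: (1 : R) + t) - p t) @[h --> 0^'] --> D.
  apply/cvgrPdist_le => e e0; have [d d0 hd] := H e e0.
  rewrite near_withinE; apply/nbhs_ballP; exists d => // h.
  rewrite /ball /= sub0r normrN => hh h0.
  by rewrite key // ler_pdivrMr ?normr_gt0 //; apply: hd.
split; first by apply/cvg_ex; exists D.
by rewrite /derive; apply/cvg_lim.
Qed.

Lemma is_derive_left_dini (g : R -> R) (t D : R) : is_derive t 1 g D ->
  D <= 0 -> forall e : R, 0 < e -> exists2 eta : R, 0 < eta &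
    forall s, t - eta < s < t -> g t - g s <= e * (t - s).
Proof.
move=> /is_derive_epsP H D0 e e0; have [d d0 hd] := H e e0; exists d => // s st.
have := hd (s - t); rewrite ltr_norml.
have -> : t + (s - t) = s by lra.
move=> /(_ ltac:(lra)); rewrite ler_norml (ler0_norm (_ : s - t <= 0)); last lra.
by move=> /andP[h _]; move: h; rewrite /GRing.scale /=; nra.
Qed.

Lemma is_derive_right_dini (g : R -> R) (t D : R) : is_derive t 1 g D ->
  D <= 0 -> forall e : R, 0 < e -> exists2 eta : R, 0 < eta &
    forall s, t < s < t + eta -> g s - g t <= e * (s - t).
Proof.
move=> /is_derive_epsP H D0 e e0; have [d d0 hd] := H e e0; exists d => // s st.
have := hd (s - t); rewrite ltr_norml.
have -> : t + (s - t) = s by lra.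
move=> /(_ ltac:(lra)); rewrite ler_norml (ger0_norm (_ : 0 <= s - t)); last lra.
by move=> /andP[_ h]; move: h; rewrite /GRing.scale /=; nra.
Qed.

(* The exceptional set N absorbs both the null set where the differential
   inclusion fails and the end point. *)
Lemma ac_derive_nonincreasing (a b : R) (f : R -> R) (N : set R) : a <= b ->
  ac a b f -> (@lebesgue_measure R).-negligible N ->
  (forall t, a < t < b -> ~ N t -> exists2 D, D <= 0 & is_derive t 1 f D) ->
  f b <= f a.
Proof.
move=> ab acf N0 hN.
have N1 : (@lebesgue_measure R).-negligible (N `|` [set b]).
  apply: negligibleU => //; exists [set b]; split => //.
  exact: lebesgue_measure_set1.
apply: ac_nonincreasing_left ab acf N1 _ => t /andP[lat tb] Nt e e0.
have tnb : t != b by apply: contra_notN Nt => /eqP ->; right.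
have [||D D0 fD] := hN t.
- by rewrite lat lt_neqAle tnb.
- by move=> ?; apply: Nt; left.
have [eta eta0 h] := is_derive_left_dini fD D0 e0.
by exists eta => // s _; apply: h.
Qed.

End Derivatives.

(** * Linear functionals of profiles *)

Section Functionals.
Context {R : realType} {V : lmodType R}.

(** A predicate on plain functions, since the functionals in use are lambda terms and partial
    applications such as payoff differences. *)
Definition linear_functional (f : V -> R) :=
  forall a x y, f (a *: x + y) = a * f x + f y.

Section Theory.
Variables (f : V -> R) (fl : linear_functional f).

Lemma lf0 : f 0 = 0.
Proof. by have := fl 1 0 0; rewrite scale1r addr0 mul1r; lra. Qed.

Lemma lfD x y : f (x + y) = f x + f y.
Proof. by have := fl 1 x y; rewrite scale1r mul1r. Qed.

Lemma lfZ a x : f (a *: x) = a * f x.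
Proof. by have := fl a x 0; rewrite !addr0 lf0 addr0. Qed.

Lemma lfN x : f (- x) = - f x.
Proof. by rewrite -scaleN1r lfZ mulN1r. Qed.

Lemma lfB x y : f (x - y) = f x - f y.
Proof. by rewrite lfD lfN. Qed.

Lemma lf_sum (I : finType) (F : I -> V) : f (\sum_i F i) = \sum_i f (F i).
Proof. exact: (big_morph f lfD lf0). Qed.

End Theory.

Lemma linear_functionalB f g : linear_functional f -> linear_functional g ->
  linear_functional (fun x => f x - g x).
Proof. by move=> fl gl a x y; rewrite fl gl; lra. Qed.

End Functionals.

Section ProfileFunctionals.
Context {R : realType} {m n : nat}.
Notation profile := ('rV[R]_m * 'cV[R]_n)%type.
Implicit Types (z : profile) (f : profile -> R).

Lemma linear_functional_row f z : linear_functional f ->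
  f z = \sum_i z.1 0 i * f (delta_mx 0 i, 0) + \sum_j z.2 j 0 * f (0, delta_mx j 0).
Proof.
case: z => x y fl /=.
have gl : linear_functional (fun x : 'rV[R]_m => f (x, 0)).
  by move=> a u v; rewrite -fl; congr f; apply: injective_projections; rewrite //= scaler0 addr0.
have hl : linear_functional (fun y : 'cV[R]_n => f (0, y)).
  by move=> a u v; rewrite -fl; congr f; apply: injective_projections; rewrite //= scaler0 addr0.
have -> : f (x, y) = f (x, 0) + f (0, y).
  by rewrite -(lfD fl); congr f; apply: injective_projections; rewrite /= ?add0r ?addr0.
congr (_ + _).
  rewrite {1}[x]matrix_sum_delta big_ord1 (lf_sum gl).
  by apply: eq_bigr => i _; rewrite (lfZ gl).
rewrite {1}[y]matrix_sum_delta (eq_bigr (fun j => y j 0 *: delta_mx j 0)).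
  rewrite (lf_sum hl).
  by apply: eq_bigr => i _; rewrite (lfZ hl).
by move=> j _; rewrite big_ord1.
Qed.

Lemma row_coord_norm z i : `|z.1 0 i| <= `|z|.
Proof.
apply: (@le_trans _ _ `|z.1|); last by rewrite prod_normE le_max lexx.
rewrite {2}/Num.norm /= mx_normrE.
exact: (le_bigmax _ (fun ij : 'I_1 * 'I_m => `|z.1 ij.1 ij.2|) (0, i)).
Qed.

Lemma col_coord_norm z j : `|z.2 j 0| <= `|z|.
Proof.
apply: (@le_trans _ _ `|z.2|); last by rewrite prod_normE le_max lexx orbT.
rewrite {2}/Num.norm /= mx_normrE.
exact: (le_bigmax _ (fun ij : 'I_n * 'I_1 => `|z.2 ij.1 ij.2|) (j, 0)).
Qed.

Lemma profile_norm_le z c : 0 <= c -> (forall i, `|z.1 0 i| <= c) ->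
  (forall j, `|z.2 j 0| <= c) -> `|z| <= c.
Proof.
move=> c0 h1 h2; rewrite prod_normE ge_max; apply/andP; split.
  rewrite /Num.norm /= mx_normrE; apply: bigmax_le => // -[i j] _ /=.
  by rewrite ord1.
rewrite /Num.norm /= mx_normrE; apply: bigmax_le => // -[i j] _ /=.
by rewrite ord1.
Qed.

Lemma linear_functional_bounded f : linear_functional f ->
  exists2 K, 0 < K & forall z, `|f z| <= K * `|z|.
Proof.
move=> fl.
exists (\sum_i `|f (delta_mx 0 i, 0)| + \sum_j `|f (0, delta_mx j 0)| + 1).
  by rewrite ltr_wpDl // addr_ge0 ?sumr_ge0.
move=> z; rewrite (linear_functional_row z fl).
apply: (@le_trans _ _ ((\sum_i `|f (delta_mx 0 i, 0)| +
  \sum_j `|f (0, delta_mx j 0)|) * `|z|)); last first.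
  by rewrite ler_wpM2r // lerDl.
apply: le_trans (ler_normD _ _) _; rewrite mulrDl; apply: lerD.
  apply: le_trans (ler_norm_sum _ _ _) _; rewrite mulr_suml.
  apply: ler_sum => i _; rewrite normrM mulrC ler_wpM2l //.
  exact: row_coord_norm.
apply: le_trans (ler_norm_sum _ _ _) _; rewrite mulr_suml.
apply: ler_sum => i _; rewrite normrM mulrC ler_wpM2l //.
exact: col_coord_norm.
Qed.

Lemma linear_functional_derive f (p : R -> profile) (t : R) (D : profile) : linear_functional f ->
  is_derive t 1 p D -> is_derive t 1 (f \o p) (f D).
Proof.
move=> fl /is_derive_epsP H; apply/is_derive_epsP => e e0.
have [K K0 hK] := linear_functional_bounded fl.
have [d d0 hd] := H (e / K) (divr_gt0 e0 K0); exists d => // h hh.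
rewrite /= [h *: f D](_ : _ = h * f D) // -(lfB fl) -(lfZ fl) -(lfB fl).
apply: le_trans (hK _) _.
apply: (@le_trans _ _ (K * (e / K * `|h|))).
  by rewrite ler_pM2l //; apply: hd.
by rewrite mulrA mulrCA divff ?mulr1 // gt_eqF.
Qed.

Lemma rowcoord_lf i : linear_functional (fun z => z.1 0 i).
Proof. by move=> a x y; rewrite /= !mxE. Qed.

Lemma colcoord_lf j : linear_functional (fun z => z.2 j 0).
Proof. by move=> a x y; rewrite /= !mxE. Qed.

End ProfileFunctionals.

(** * Solutions of fictitious play *)

Section Simplex.
Context {R : realType} {m n : nat}.
Notation profile := ('rV[R]_m * 'cV[R]_n)%type.
Implicit Types (A B : 'M[R]_(m, n)) (z x b : profile) (f : profile -> R).

Lemma simplexA_le1 (q : 'rV[R]_m) i : simplexA q -> 0 <= q 0 i <= 1.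
Proof.
move=> [q0 q1]; rewrite q0 -q1 (bigD1 i) //= lerDl; exact: sumr_ge0.
Qed.

Lemma simplexB_le1 (q : 'cV[R]_n) i : simplexB q -> 0 <= q i 0 <= 1.
Proof.
move=> [q0 q1]; rewrite q0 -q1 (bigD1 i) //= lerDl; exact: sumr_ge0.
Qed.

Lemma simplexAB_dist z x : simplexAB z -> simplexAB x -> `|z - x| <= 1.
Proof.
move=> [z1 z2] [x1 x2]; apply: profile_norm_le => // i; rewrite !mxE ler_norml.
  by have := simplexA_le1 i z1; have := simplexA_le1 i x1; lra.
by have := simplexB_le1 i z2; have := simplexB_le1 i x2; lra.
Qed.

Lemma simplexAB_convex (a : R) z x : 0 <= a <= 1 -> simplexAB z -> simplexAB x ->
  simplexAB (x + a *: (z - x)).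
Proof.
move=> a01 [[z1 z1s] [z2 z2s]] [[x1 x1s] [x2 x2s]]; split; split => /=.
- by move=> i; rewrite !mxE; have := z1 i; have := x1 i; nra.
- under eq_bigr do rewrite !mxE.
  by rewrite big_split /= -mulr_sumr sumrB x1s z1s subrr mulr0 addr0.
- by move=> i; rewrite !mxE; have := z2 i; have := x2 i; nra.
- under eq_bigr do rewrite !mxE.
  by rewrite big_split /= -mulr_sumr sumrB x2s z2s subrr mulr0 addr0.
Qed.

Definition payA A z i := (A *m z.2) i 0.
Definition payB B z j := (z.1 *m B) 0 j.

Lemma payA_lf A i : linear_functional (payA A ^~ i).
Proof. by move=> a x y; rewrite /payA /= mulmxDr -scalemxAr !mxE. Qed.

Lemma payB_lf B j : linear_functional (payB B ^~ j).
Proof. by move=> a x y; rewrite /payB /= mulmxDl -scalemxAl !mxE. Qed.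

Lemma payAE A z i : payA A z i = \sum_k A i k * z.2 k 0.
Proof. by rewrite /payA mxE. Qed.

Lemma payBE B z k : payB B z k = \sum_i z.1 0 i * B i k.
Proof. by rewrite /payB mxE. Qed.

Definition BRAB A B z : set profile := BRA A z.2 `*` BRB B z.1.

Lemma BRAB_simplex A B z b : BRAB A B z b -> simplexAB b.
Proof. by case=> [[? _] [? _]]. Qed.

End Simplex.

Section Rays.
Context {R : realType} {m n : nat}.
Notation profile := ('rV[R]_m * 'cV[R]_n)%type.
Implicit Types (A B : 'M[R]_(m, n)) (z x b P : profile) (f : profile -> R).
Implicit Types (s t : R).

(** Motion with the constant target [P]: the solution of [p' = P - p] starting at [x]. *)
Definition ray x P (t : R) : profile := P + expR (- t) *: (x - P).

Lemma ray0 x P : ray x P 0 = x.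
Proof. by rewrite /ray oppr0 expR0 scale1r addrC subrK. Qed.

Lemma rayD x P s t : ray x P (s + t) = ray (ray x P s) P t.
Proof.
rewrite /ray [P + _ - P]addrC addKr scalerA -expRD.
by congr (_ + expR _ *: _); lra.
Qed.

Lemma ray_lf f x P t : linear_functional f ->
  f (ray x P t) = f P + expR (- t) * (f x - f P).
Proof. by move=> fl; rewrite (lfD fl) (lfZ fl) (lfB fl). Qed.

Lemma ray_simplex x P t : simplexAB x -> simplexAB P -> 0 <= t ->
  simplexAB (ray x P t).
Proof.
move=> sx sP t0; apply: simplexAB_convex => //.
by rewrite expR_ge0 -expR0 ler_expR; lra.
Qed.

Lemma rayB x P s t : ray x P t - ray x P s = (expR (- t) - expR (- s)) *: (x - P).
Proof.
by apply: injective_projections; apply/matrixP => i j; rewrite !mxE /=; ring.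
Qed.

Lemma ray_id x t : ray x x t = x.
Proof. by rewrite /ray subrr scaler0 addr0. Qed.

(** The product of the simplices has diameter 1 in the sup norm, and [1 - expR (- h) <= h]. *)
Lemma ray_lipschitz x P s t : simplexAB x -> simplexAB P -> 0 <= s -> s <= t ->
  `|ray x P t - ray x P s| <= t - s.
Proof.
move=> sx sP s0 st.
have h1 : expR (- s) - expR (- t) <= t - s.
  have h := expR_ge1Dx (s - t).
  have -> : expR (- t) = expR (- s) * expR (s - t).
    by rewrite -expRD; congr expR; ring.
  have e1 : expR (- s) <= 1 by rewrite -expR0 ler_expR; lra.
  have k1 : expR (- s) * (1 + (s - t)) <= expR (- s) * expR (s - t).
    by rewrite ler_wpM2l // expR_ge0.
  have k2 : 0 <= (1 - expR (- s)) * (t - s) by rewrite mulr_ge0 ?subr_ge0.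
  lra.
have h2 : expR (- t) <= expR (- s) by rewrite ler_expR; lra.
rewrite rayB normrZ ler0_norm ?subr_le0 //.
have := simplexAB_dist sx sP; have := normr_ge0 (x - P); nra.
Qed.

Lemma ray_derive x P (t : R) : is_derive t 1 (ray x P) (P - ray x P t).
Proof.
have De : is_derive t 1 (fun s : R => expR (- s)) (- expR (- t)).
  have := @is_derive1_comp R expR -%R t (expR (- t)) (-1) _ _.
  by rewrite mulrN1; apply.
apply/is_derive_epsP => e e0.
have [d d0 hd] := (proj1 (is_derive_epsP _ _ _) De) (e / (`|x - P| + 1))
   ltac:(by rewrite divr_gt0 // ltr_wpDl).
exists d => // h /hd {}hd.
have -> : ray x P (t + h) - ray x P t - h *: (P - ray x P t) =
  (expR (- (t + h)) - expR (- t) - h * - expR (- t)) *: (x - P).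
  by apply: injective_projections; apply/matrixP => i j; rewrite !mxE /=; ring.
rewrite normrZ; apply: le_trans (ler_wpM2r (normr_ge0 _) hd) _.
have xP : 0 < `|x - P| + 1 by rewrite ltr_wpDl.
rewrite mulrAC ler_wpM2r // mulrAC ler_pdivrMr // ler_pM2l //; lra.
Qed.

End Rays.

Section Solutions.
Context {R : realType} {m n : nat}.
Notation profile := ('rV[R]_m * 'cV[R]_n)%type.
Variables (A B : 'M[R]_(m, n)).
Implicit Types (z x b P : profile) (f : profile -> R) (p q : R -> profile) (s t u v a c T M K e : R) (N : set R).

Definition good_time p (t : R) :=
  exists2 b, BRAB A B (p t) b & is_derive t 1 p (b - p t).

Lemma solution_good_time T p : fp_solution A B T p ->
  exists2 N, (@lebesgue_measure R).-negligible N &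
    forall t, 0 < t < T -> ~ N t -> good_time p t.
Proof.
move=> [_ _ h]; exists (~` [set t | 0 < t < T ->
   derivable p t 1 /\ fp_rhs A B (p t) ('D_1 p t)]) => //.
move=> t t0T /contrapT /(_ t0T) [dp [b hb e]].
by exists b => //; split.
Qed.

Lemma good_time_solution T p :
  (forall t, 0 <= t <= T -> simplexAB (p t)) ->
  (forall s t, 0 <= s -> s <= t -> t <= T -> `|p t - p s| <= t - s) ->
  (exists2 N, (@lebesgue_measure R).-negligible N &
     forall t, 0 < t < T -> ~ N t -> good_time p t) ->
  fp_solution A B T p.
Proof.
move=> sp lp [N N0 hN]; split => //.
  move=> e e0; exists e => // k s t st _; apply: le_lt_trans.
  by apply: ler_sum => i _; have [? [? ?]] := st i; apply: lp.
apply: negligibleS N0 => t; apply: contra_notP => nNt t0T.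
have [b hb dp] := hN t t0T nNt; split; first by case: dp.
by exists b => //; rewrite derive_val.
Qed.

Lemma solution_simplex T p t : fp_solution A B T p -> 0 <= t <= T ->
  simplexAB (p t).
Proof. by case=> h _ _; apply: h. Qed.

Lemma solution_lf_ac T p f : linear_functional f -> fp_solution A B T p ->
  forall a c, 0 <= a -> c <= T -> ac a c (f \o p).
Proof.
move=> fl [_ acp _] a c a0 cT e e0.
have [K K0 hK] := linear_functional_bounded fl.
have [d d0 hd] := acp _ (divr_gt0 e0 K0); exists d => // N s t st dis sum.
apply: (@le_lt_trans _ _ (K * \sum_i `|p (t i) - p (s i)|)).
  rewrite mulr_sumr; apply: ler_sum => i _.
  by rewrite /= -(lfB fl); apply: hK.
rewrite mulrC -ltr_pdivlMr //; apply: hd => // i.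
have [h1 [h2 h3]] := st i; split; [exact: le_trans h1|split => //].
exact: le_trans cT.
Qed.

(** The velocity is almost everywhere a difference of two profiles, so [M] bounds the derivative of
    [f] along the solution. *)
Lemma solution_speed T p f M : linear_functional f -> fp_solution A B T p ->
  (forall x z, simplexAB x -> simplexAB z -> f (x - z) <= M) ->
  forall s t, 0 <= s -> s <= t -> t <= T -> f (p t) - f (p s) <= M * (t - s).
Proof.
move=> fl sp fM s t s0 st tT.
have [N N0 hN] := solution_good_time sp.
suff : (f (p t) - M * t) <= f (p s) - M * s by lra.
apply: (@ac_derive_nonincreasing _ s t (fun u => f (p u) - M * u) N) => //.
  apply: ac_add; first exact: (solution_lf_ac fl sp s0 tT).
  apply: (@ac_lipschitz _ _ _ _ `|M|) => u v _ uv _.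
  have -> : - (M * v) - - (M * u) = M * (u - v) by ring.
  by rewrite normrM distrC (ger0_norm (_ : 0 <= v - u)) // subr_ge0.
move=> u ust Nu; have [|b hb dp] := hN u _ Nu; first lra.
exists (f (b - p u) - M).
  rewrite subr_le0; apply: fM; first exact: BRAB_simplex hb.
  by apply: (solution_simplex sp); lra.
have d1 := linear_functional_derive fl dp.
have d2 : is_derive u (1 : R) (M \*: (@id R)) M.
  by rewrite -[X in is_derive _ _ _ X]mulr1; apply: (is_deriveZ M (is_derive_id u (1 : R))).
exact: (is_deriveB d1 d2).
Qed.

Lemma solution_lipschitz T p : fp_solution A B T p ->
  forall s t, 0 <= s -> s <= t -> t <= T -> `|p t - p s| <= t - s.
Proof.
move=> sp s t s0 st tT.
have ts : 0 <= t - s by rewrite subr_ge0.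
have coord f : linear_functional f -> (forall z, `|f z| <= `|z|) ->
    `|f (p t) - f (p s)| <= t - s.
  move=> fl fM.
  have h x z : simplexAB x -> simplexAB z -> `|f (x - z)| <= 1.
    by move=> sx sz; apply: le_trans (fM _) (simplexAB_dist sx sz).
  have nl : linear_functional (fun z => - f z).
    by move=> a x y; rewrite fl; ring.
  rewrite ler_norml; apply/andP; split.
    have := @solution_speed T p (fun z => - f z) 1 nl sp _ s t s0 st tT.
    have hn x z : simplexAB x -> simplexAB z -> - f (x - z) <= 1.
      by move=> sx sz; have := h _ _ sx sz; rewrite ler_norml; lra.
    by move=> /(_ hn); lra.
  have := @solution_speed T p f 1 fl sp _ s t s0 st tT.
  have hn x z : simplexAB x -> simplexAB z -> f (x - z) <= 1.
    by move=> sx sz; have := h _ _ sx sz; rewrite ler_norml; lra.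
  by move=> /(_ hn); lra.
apply: profile_norm_le => // i; rewrite !mxE.
- by apply: coord (rowcoord_lf i) _ => z; apply: row_coord_norm.
- by apply: coord (colcoord_lf i) _ => z; apply: col_coord_norm.
Qed.

Lemma expR_lipschitz T s t : s <= t -> t <= T ->
  expR t - expR s <= expR T * (t - s).
Proof.
move=> st tT; have : expR t - expR s <= expR t * (t - s).
  have := expR_ge1Dx (s - t); rewrite expRD expRN => h.
  have := expR_gt0 t => h0; move: h; rewrite ler_pdivlMr //; nra.
move=> h; apply: le_trans h _; rewrite ler_wpM2r ?subr_ge0 // ler_expR //.
Qed.

Lemma exp_lf_ac T p f : linear_functional f -> fp_solution A B T p ->
  forall a c, 0 <= a -> c <= T -> ac a c (fun t => expR t * f (p t)).
Proof.
move=> fl sp a c a0 cT.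
have [K K0 hK] := linear_functional_bounded fl.
have b1 t : 0 <= t <= T -> `|f (p t)| <= K.
  move=> tT; apply: le_trans (hK _) _; suff : `|p t| <= 1 by nra.
  have [s1 s2] := solution_simplex sp tT.
  apply: profile_norm_le => // i; rewrite ger0_norm.
  - by have := simplexA_le1 i s1; lra.
  - by have := simplexA_le1 i s1; lra.
  - by have := simplexB_le1 i s2; lra.
  - by have := simplexB_le1 i s2; lra.
(* Each of the two terms in the splitting below contributes [expR T * K]. *)
apply: (@ac_lipschitz _ _ _ _ (2 * (expR T * K))) => s t as_ st tc.
have -> : expR t * f (p t) - expR s * f (p s) =
  (expR t - expR s) * f (p t) + expR s * (f (p t) - f (p s)) by ring.
apply: le_trans (ler_normD _ _) _; rewrite !normrM.
have h1 := expR_lipschitz st (le_trans tc cT).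
have h2 : `|f (p t)| <= K by apply: b1; lra.
have h3 : `|f (p t) - f (p s)| <= K * (t - s).
  rewrite -(lfB fl); apply: le_trans (hK _) _; rewrite ler_pM2l //.
  by apply: (solution_lipschitz sp); lra.
have h4 : expR s <= expR T by rewrite ler_expR; lra.
have h5 : 0 <= expR t - expR s by rewrite subr_ge0 ler_expR.
have h6 := expR_gt0 s; have h7 := expR_gt0 T.
rewrite (ger0_norm h5) (ger0_norm (ltW h6)).
have ts : 0 <= t - s by lra.
have k1 : (expR t - expR s) * `|f (p t)| <= expR T * (t - s) * K.
  by apply: ler_pM.
have k2 : expR s * `|f (p t) - f (p s)| <= expR T * (K * (t - s)).
  by apply: ler_pM => //; apply: ltW.
lra.
Qed.

Lemma exp_lf_derive p f t b : linear_functional f -> is_derive t 1 p (b - p t) ->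
  is_derive t 1 (fun t => expR t * f (p t)) (expR t * f b).
Proof.
move=> fl dp; have d1 := linear_functional_derive fl dp.
have -> : expR t * f b = expR t *: f (b - p t) + f (p t) *: expR t.
  by rewrite /GRing.scale /= (lfB fl); ring.
exact: (is_deriveM (is_derive_expR t) d1).
Qed.

(** At a good time [exp t * f (p t)] has derivative [exp t * f b], so [exp t * (f (p t) - M)] is
    nonincreasing as long as best responses satisfy [f b <= M]. *)
Lemma solution_upper T p f M a c : linear_functional f -> fp_solution A B T p ->
  0 <= a -> a <= c -> c <= T ->
  (forall t b, a < t < c -> BRAB A B (p t) b -> f b <= M) ->
  f (p c) - M <= expR (a - c) * (f (p a) - M).
Proof.
move=> fl sp a0 ac_ cT fM.
have [N N0 hN] := solution_good_time sp.
have : expR c * f (p c) - M * expR c <= expR a * f (p a) - M * expR a.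
  apply: (@ac_derive_nonincreasing _ a c (fun u => expR u * f (p u) - M * expR u) N) => //.
    apply: ac_add; first exact: (exp_lf_ac fl sp).
    apply: (@ac_lipschitz _ _ _ _ (`|M| * expR T)) => u v _ uv vc.
    have -> : - (M * expR v) - - (M * expR u) = M * (expR u - expR v) by ring.
    have uv' : 0 <= expR v - expR u by rewrite subr_ge0 ler_expR.
    rewrite normrM distrC (ger0_norm uv') -mulrA ler_wpM2l //.
    by apply: expR_lipschitz => //; lra.
  move=> u ust Nu; have [|b hb dp] := hN u _ Nu; first lra.
  exists (expR u * f b - M *: expR u).
    have := fM u b ust hb; have := expR_gt0 u; rewrite /GRing.scale /=; nra.
  exact: (is_deriveB (exp_lf_derive fl dp) (is_deriveZ M (is_derive_expR u))).
rewrite expRD expRN mulrAC ler_pdivlMr ?expR_gt0 //; lra.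
Qed.

Lemma solution_lower T p f M a c : linear_functional f -> fp_solution A B T p ->
  0 <= a -> a <= c -> c <= T ->
  (forall t b, a < t < c -> BRAB A B (p t) b -> M <= f b) ->
  expR (a - c) * (f (p a) - M) <= f (p c) - M.
Proof.
move=> fl sp a0 ac_ cT fM.
have nl : linear_functional (fun z => - f z) by move=> x y z; rewrite fl; ring.
have := @solution_upper T p (fun z => - f z) (- M) a c nl sp a0 ac_ cT.
have h t b : a < t < c -> BRAB A B (p t) b -> - f b <= - M.
  by move=> h1 h2; rewrite lerN2; apply: fM h1 h2.
by move=> /(_ h); lra.
Qed.

Lemma solution_const T p f M a c : linear_functional f -> fp_solution A B T p ->
  0 <= a -> a <= c -> c <= T ->
  (forall t b, a < t < c -> BRAB A B (p t) b -> f b = M) ->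
  f (p c) - M = expR (a - c) * (f (p a) - M).
Proof.
move=> fl sp a0 ac_ cT fM; apply/eqP; rewrite eq_le; apply/andP; split.
  by apply: (solution_upper fl sp) => // t b h1 h2; rewrite (fM _ _ h1 h2).
by apply: (solution_lower fl sp) => // t b h1 h2; rewrite (fM _ _ h1 h2).
Qed.

Lemma ray_solution x P T : simplexAB x -> simplexAB P ->
  (forall t, 0 < t < T -> BRAB A B (ray x P t) P) -> fp_solution A B T (ray x P).
Proof.
move=> sx sP h; apply: good_time_solution.
- by move=> t /andP[t0 _]; apply: ray_simplex.
- by move=> s t s0 st _; apply: ray_lipschitz.
- exists set0; first exact: negligible_set0.
  move=> t tT _; exists P; [exact: h|exact: ray_derive].
Qed.

End Solutions.

(** * Iterated dominance and cyclic 2 x 2 games *)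

Section Kink.
Context {R : realType}.
Implicit Types (a b x y l : R).

Definition kink a b x : R := Num.max (a * x) (b * x).

(** Slopes between [a] and [b] are subgradients of this convex function at 0, where it vanishes. *)
Lemma kink_ge a b l x : 0 <= l <= 1 -> (l * a + (1 - l) * b) * x <= kink a b x.
Proof.
move=> l01; rewrite /kink; have h1 : a * x <= kink a b x by rewrite le_max lexx.
have h2 : b * x <= kink a b x by rewrite le_max lexx orbT.
have -> : (l * a + (1 - l) * b) * x = l * (a * x) + (1 - l) * (b * x) by ring.
rewrite /kink in h1 h2; nra.
Qed.

Lemma kink_lipschitz a b x y : `|kink a b x - kink a b y| <= (`|a| + `|b|) * `|x - y|.
Proof.
have ha := ler_norm (a * (x - y)); have ha' := ler_norm (- (a * (x - y))).
have hb := ler_norm (b * (x - y)); have hb' := ler_norm (- (b * (x - y))).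
move: ha ha' hb hb'; rewrite !normrN !normrM mulrDl => ha ha' hb hb'.
have na : 0 <= `|a| * `|x - y| by rewrite mulr_ge0.
have nb : 0 <= `|b| * `|x - y| by rewrite mulr_ge0.
by rewrite ler_norml /kink; case: (leP (a * x) (b * x)); case: (leP (a * y) (b * y)); lra.
Qed.

Lemma kinkZ a b c x : 0 <= c -> kink a b (c * x) = c * kink a b x.
Proof. by move=> c0; rewrite /kink maxr_pMr // !mulrA ![c * _]mulrC. Qed.

Lemma kink_pos a b x : 0 < a -> b < 0 -> 0 <= x -> kink a b x = a * x.
Proof. by move=> a0 b0 x0; rewrite /kink max_l //; nra. Qed.

Lemma kink_neg a b x : 0 < a -> b < 0 -> x <= 0 -> kink a b x = b * x.
Proof. by move=> a0 b0 x0; rewrite /kink max_r //; nra. Qed.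

Lemma kink_norm_ge a b x : 0 < a -> b < 0 -> Num.min a (- b) * `|x| <= kink a b x.
Proof.
move=> a0 b0; case: (lerP 0 x) => x0.
  rewrite kink_pos // ger0_norm // ler_wpM2r // ge_min lexx //.
have h : Num.min a (- b) <= - b by rewrite ge_min lexx orbT.
rewrite (kink_neg a0 b0 (ltW x0)) ltr0_norm //.
move: (Num.min a (- b)) h => M h; have : 0 <= (- b - M) * (- x) by apply: mulr_ge0; lra.
lra.
Qed.

End Kink.

Section Reducible.
Context {R : realType} {m n : nat}.
Notation profile := ('rV[R]_m * 'cV[R]_n)%type.
Variables (A B : 'M[R]_(m, n)).
Implicit Types (z x y b P : profile) (f g : profile -> R) (p q : R -> profile).
Implicit Types (s t u v a c T S M K e d : R).
Implicit Types (I : {set 'I_m}) (J : {set 'I_n}).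

Definition gapA (i j : 'I_m) z := payA A z i - payA A z j.
Definition gapB (k l : 'I_n) z := payB B z k - payB B z l.

Lemma gapA_lf i j : linear_functional (gapA i j).
Proof. exact: linear_functionalB (payA_lf A i) (payA_lf A j). Qed.

Lemma gapB_lf k l : linear_functional (gapB k l).
Proof. exact: linear_functionalB (payB_lf B k) (payB_lf B l). Qed.

Lemma gapAE i j z : gapA i j z = \sum_k z.2 k 0 * (A i k - A j k).
Proof.
by rewrite /gapA !payAE -sumrB; apply: eq_bigr => k _; rewrite mulrBr ![z.2 _ _ * _]mulrC.
Qed.

Lemma gapBE k l z : gapB k l z = \sum_i z.1 0 i * (B i k - B i l).
Proof. by rewrite /gapB !payBE -sumrB; apply: eq_bigr => i _; rewrite mulrBr. Qed.

Definition confined I J z :=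
  (forall i, bestA A z.2 i -> i \in I) /\ (forall k, bestB B z.1 k -> k \in J).

Definition supported I J b :=
  [/\ simplexAB b, forall i, b.1 0 i != 0 -> i \in I &
      forall k, b.2 k 0 != 0 -> k \in J].

Lemma confined_supported I J z b : confined I J z -> BRAB A B z b ->
  supported I J b.
Proof.
move=> [cA cB] [[s1 h1] [s2 h2]]; split => //.
- by move=> i /h1 /cA.
- by move=> k /h2 /cB.
Qed.

Lemma weighted_sum_ge (N : nat) (w g : 'I_N -> R) M : (forall i, 0 <= w i) ->
  \sum_i w i = 1 -> (forall i, w i != 0 -> M <= g i) -> M <= \sum_i w i * g i.
Proof.
move=> w0 w1 h; rewrite -[M]mul1r -w1 mulr_suml; apply: ler_sum => i _.
have [->|wi] := eqVneq (w i) 0; first by rewrite !mul0r.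
by rewrite ler_wpM2l // h.
Qed.

Lemma exists_min_pos (N : nat) (J : {set 'I_N}) (g : 'I_N -> R) :
  (forall k, k \in J -> 0 < g k) ->
  exists2 M, 0 < M & forall k, k \in J -> M <= g k.
Proof.
move=> h; exists (\big[Num.min/1]_(k in J) g k).
  by apply: lt_bigmin.
by move=> k kJ; apply: bigmin_le_cond.
Qed.

(** Best replies run around the cycle (i, k), (i, l), (j, l), (j, k), (i, k), the players changing
    strategy in turn. *)
Definition spiral_signs (i j : 'I_m) (k l : 'I_n) :=
  [/\ A j k < A i k, A i l < A j l, B i k < B i l & B j l < B j k].

(* Iterated elimination of strictly dominated strategies ends in a single
   profile or in a cyclic 2 x 2 game. *)
Inductive reducible : {set 'I_m} -> {set 'I_n} -> Prop :=
| reducible_pure i k : reducible [set i]%SET [set k]%SET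
| reducible_spiral i j k l : i != j -> k != l -> spiral_signs i j k l ->
    reducible [set i; j]%SET [set k; l]%SET
| reducible_row I J i j : i \in I -> i != j ->
    (forall k, k \in J -> A j k < A i k) ->
    reducible (I :\ j)%SET J -> reducible I J
| reducible_col I J k l : k \in J -> k != l ->
    (forall i, i \in I -> B i l < B i k) ->
    reducible I (J :\ l)%SET -> reducible I J.

Lemma sum_supp2 (N : nat) (w g : 'I_N -> R) i j : i != j ->
  (forall r, w r != 0 -> r \in [set i; j]%SET) ->
  \sum_r w r * g r = w i * g i + w j * g j.
Proof.
move=> ij h; rewrite (bigD1 i) //= (bigD1 j) /=; last by rewrite eq_sym.
rewrite big1 ?addr0 // => r /andP[ri rj].
have [->|/h] := eqVneq (w r) 0; first by rewrite mul0r.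
by rewrite !inE (negbTE ri) (negbTE rj).
Qed.

Lemma supp2_weights (N : nat) (w : 'I_N -> R) i j : i != j ->
  (forall r, w r != 0 -> r \in [set i; j]%SET) -> \sum_r w r = 1 ->
  w i + w j = 1.
Proof.
move=> ij h w1; rewrite -[RHS]w1 (eq_bigr (fun r => w r * 1)).
  by rewrite (sum_supp2 (fun=> 1) ij h) !mulr1.
by move=> r _; rewrite mulr1.
Qed.

Section SpiralLaw.
Variables (i j : 'I_m) (k l : 'I_n) (ij : i != j) (kl : k != l).
Hypothesis sg : spiral_signs i j k l.

Let c0 := A i k - A j k.
Let c1 := A i l - A j l.
Let d0 := B i k - B i l.
Let d1 := B j k - B j l.

Let c0_gt0 : 0 < c0. Proof. by case: sg => h _ _ _; rewrite subr_gt0. Qed.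
Let c1_lt0 : c1 < 0. Proof. by case: sg => _ h _ _; rewrite subr_lt0. Qed.
Let d0_lt0 : d0 < 0. Proof. by case: sg => _ _ h _; rewrite subr_lt0. Qed.
Let d1_gt0 : 0 < d1. Proof. by case: sg => _ _ _ h; rewrite subr_gt0. Qed.

(** The slopes in one gap are, up to sign, the extreme velocities of the other gap rescaled by
    [exp t]. In the plane of the two gaps the level sets are quadrilaterals around the
    equilibrium. *)
Definition spiral_level z : R :=
  kink (- d0) (- d1) (gapA i j z) + kink c0 c1 (gapB k l z).

Lemma supported_gapA b : supported [set i; j]%SET [set k; l]%SET b ->
  gapA i j b = b.2 k 0 * c0 + (1 - b.2 k 0) * c1.
Proof.
move=> [[_ [_ b2]] _ h2]; rewrite gapAE (sum_supp2 _ kl) //.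
by have := supp2_weights kl h2 b2 => e2; have -> : b.2 l 0 = 1 - b.2 k 0 by lra.
Qed.

Lemma supported_gapB b : supported [set i; j]%SET [set k; l]%SET b ->
  gapB k l b = b.1 0 i * d0 + (1 - b.1 0 i) * d1.
Proof.
move=> [[[_ b1] _] h1 _]; rewrite gapBE (sum_supp2 _ ij) //.
by have := supp2_weights ij h1 b1 => e1; have -> : b.1 0 j = 1 - b.1 0 i by lra.
Qed.

Lemma spiral_level_ge0 z : 0 <= spiral_level z.
Proof.
rewrite addr_ge0 // (le_trans _ (kink_norm_ge _ _ _)) ?oppr_gt0 ?oppr_lt0 //.
  by rewrite mulr_ge0 // le_min ?opprK !ltW ?oppr_gt0.
by rewrite mulr_ge0 // le_min !ltW ?oppr_gt0.
Qed.

(* Both kinks are convex and the velocity at [t] selects subgradients [xi] and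
   [eta] of them, with velocities [eta] and [- xi]: the contributions cancel. *)
Lemma spiral_level_exp T p a c : fp_solution A B T p ->
  0 <= a -> a <= c -> c <= T ->
  (forall t, a < t < c -> confined [set i; j]%SET [set k; l]%SET (p t)) ->
  expR c * spiral_level (p c) = expR a * spiral_level (p a).
Proof.
move=> sp a0 ac_ cT conf.
have [N N0 hN] := solution_good_time sp.
pose U t := expR t * gapA i j (p t); pose W t := expR t * gapB k l (p t).
pose g t := kink (- d0) (- d1) (U t) + kink c0 c1 (W t).
have gE t : expR t * spiral_level (p t) = g t.
  by rewrite /g /U /W !kinkZ ?expR_ge0 // -mulrDr.
rewrite !gE.
have acg : ac a c g.
  apply: ac_add.
    by apply: ac_comp (kink_lipschitz _ _) _; apply: (exp_lf_ac (gapA_lf i j) sp).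
  by apply: ac_comp (kink_lipschitz _ _) _; apply: (exp_lf_ac (gapB_lf k l) sp).
have key t : a < t < c -> ~ N t -> exists H : R -> R,
    is_derive t 1 H 0 /\ H t = g t /\ forall s, H s <= g s.
  move=> tac Nt; have [|b hb dp] := hN t _ Nt; first lra.
  have sb := confined_supported (conf t tac) hb.
  have dU := exp_lf_derive (gapA_lf i j) dp.
  have dW := exp_lf_derive (gapB_lf k l) dp.
  rewrite (supported_gapA sb) in dU; rewrite (supported_gapB sb) in dW.
  have b1 := simplexA_le1 i (proj1 hb).1.
  have b2 := simplexB_le1 k (proj2 hb).1.
  set lam := b.1 0 i in dW b1 *; set mu := b.2 k 0 in dU b2 *.
  pose xi := lam * (- d0) + (1 - lam) * (- d1).
  pose eta := mu * c0 + (1 - mu) * c1.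
  exists (fun s => xi * U s + eta * W s); split; last split.
  - have -> : (0 : R) = xi *: (expR t * (mu * c0 + (1 - mu) * c1)) +
       eta *: (expR t * (lam * d0 + (1 - lam) * d1)).
      by rewrite /GRing.scale /= /xi /eta; ring.
    exact: is_deriveD (is_deriveZ xi dU) (is_deriveZ eta dW).
  - rewrite /g; congr (_ + _).
      (* A nonzero gap leaves a single best reply, which makes [xi] the active slope of the kink; at
         a zero gap every slope touches. *)
      have [u0|u0|u0] := ltgtP 0 (gapA i j (p t)).
      + have bj : b.1 0 j = 0.
          apply/eqP/negPn/negP => /(proj1 hb).2 /(_ i); rewrite leNgt => /negP; apply.
          by move: u0; rewrite subr_gt0.
        have lam1 : lam = 1.
          have [[[_ b1s] _] h1 _] := sb.
          by have := supp2_weights ij h1 b1s; rewrite bj addr0.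
        rewrite /xi lam1 kink_pos ?oppr_gt0 ?oppr_lt0 //; first by ring.
        by rewrite mulr_ge0 ?expR_ge0 ?ltW.
      + have bi : b.1 0 i = 0.
          apply/eqP/negPn/negP => /(proj1 hb).2 /(_ j); rewrite leNgt => /negP; apply.
          by move: u0; rewrite subr_lt0.
        rewrite /xi /lam bi kink_neg ?oppr_gt0 ?oppr_lt0 //; first by ring.
        by rewrite mulr_ge0_le0 ?expR_ge0 ?ltW.
      + by rewrite /U -u0 /kink !mulr0 maxxx.
    have [u0|u0|u0] := ltgtP 0 (gapB k l (p t)).
    + have bj : b.2 l 0 = 0.
        apply/eqP/negPn/negP => /(proj2 hb).2 /(_ k); rewrite leNgt => /negP; apply.
        by move: u0; rewrite subr_gt0.
      have mu1 : mu = 1.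
        have [[_ [_ b1s]] _ h1] := sb.
        by have := supp2_weights kl h1 b1s; rewrite bj addr0.
      rewrite /eta mu1 kink_pos //; first by ring.
      by rewrite mulr_ge0 ?expR_ge0 ?ltW.
    + have bi : b.2 k 0 = 0.
        apply/eqP/negPn/negP => /(proj2 hb).2 /(_ l); rewrite leNgt => /negP; apply.
        by move: u0; rewrite subr_lt0.
      rewrite /eta /mu bi kink_neg //; first by ring.
      by rewrite mulr_ge0_le0 ?expR_ge0 ?ltW.
    + by rewrite /W -u0 /kink !mulr0 maxxx.
  - by move=> s; apply: lerD; apply: kink_ge.
have N1 : (@lebesgue_measure R).-negligible (N `|` ([set a] `|` [set c])).
  apply: negligibleU => //; apply: negligibleU.
    by exists [set a]; split => //; apply: lebesgue_measure_set1.
  by exists [set c]; split => //; apply: lebesgue_measure_set1.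
(* Equality is split into two monotonicity statements: left quotients of [g], then right quotients
   of [- g], both controlled by the touching minorant [H]. *)
apply/eqP; rewrite eq_le; apply/andP; split.
  apply: ac_nonincreasing_left ac_ acg N1 _ => t /andP[t1 t2] Nt e e0.
  have tc : t != c by apply: contra_notN Nt => /eqP ->; right; right.
  have [||H [dH [Ht Hg]]] := key t; first by rewrite t1 lt_neqAle tc.
    by move=> ?; apply: Nt; left.
  have [r r0 hr] := is_derive_left_dini dH (lexx 0) e0.
  exists r => // s _ /hr; have := Hg s; rewrite Ht; lra.
rewrite -lerN2.
apply: (ac_nonincreasing_right ac_ (ac_opp acg) N1) => t /andP[t1 t2] Nt e e0.
have ta : t != a by apply: contra_notN Nt => /eqP ->; right; left.
have [||H [dH [Ht Hg]]] := key t; first by rewrite t2 lt_neqAle eq_sym ta t1.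
  by move=> ?; apply: Nt; left.
have dH' := is_deriveN dH; rewrite oppr0 in dH'.
have [r r0 hr] := is_derive_right_dini dH' (lexx 0) e0.
exists r => // s _ /hr hs; have {}hs : - H s - - H t <= e * (s - t) := hs.
by have := Hg s; rewrite -Ht; lra.
Qed.

End SpiralLaw.

End Reducible.

(** * Local uniqueness *)

Section Closeness.
Context {R : realType} {m n : nat}.
Notation profile := ('rV[R]_m * 'cV[R]_n)%type.
Variables (A B : 'M[R]_(m, n)).
Implicit Types (z x b P : profile) (f g : profile -> R) (p q : R -> profile).
Implicit Types (s t u v a c T S M K e d : R) (i j : 'I_m) (k l : 'I_n).

Section Paired.
Variables (y : profile) (C0 : R) (I : {set 'I_m}) (J : {set 'I_n}).
Hypothesis C00 : 0 <= C0.

(** Nothing is required of the best responses in the initial layer up to time [C0 * d]: getting rid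
    of dominated strategies takes a time proportional to [d], and unit speed keeps both solutions
    within [(1 + C0) * d] of [y] meanwhile. *)
Definition paired S p q d :=
  [/\ 0 < d, fp_solution A B S p, fp_solution A B S q,
      `|p 0 - y| <= d /\ `|q 0 - y| <= d &
      forall t, C0 * d <= t <= S ->
        confined A B I J (p t) /\ confined A B I J (q t)].

(** Closeness is proved one functional at a time, with a constant uniform in the two solutions and
    in [d]. *)
Definition tame f := exists2 C, 0 <= C & forall S p q d, paired S p q d ->
  forall t, C0 * d <= t <= S -> `|f (p t) - f (q t)| <= C * d.

Lemma solution_near T p d : fp_solution A B T p -> `|p 0 - y| <= d ->
  forall t, 0 <= t <= T -> `|p t - y| <= d + t.
Proof.
move=> sp pd t /andP[t0 tT].
have := solution_lipschitz sp (lexx 0) t0 tT; rewrite subr0 => h.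
have -> : p t - y = (p 0 - y) + (p t - p 0) by rewrite [RHS]addrC addrA subrK.
by apply: le_trans (ler_normD _ _) _; apply: lerD.
Qed.

(** As [f] takes a single value on the available best responses, [f (p t) - f (q t)] contracts
    exponentially from its value at the end of the layer, where both solutions are within
    [(1 + C0) * d] of [y]. *)
Lemma tame_decay f M : linear_functional f ->
  (forall b, supported I J b -> f b = M) -> tame f.
Proof.
move: (C00) => c00 fl fM; have [K K0 hK] := linear_functional_bounded fl.
exists (K * (2 * (1 + C0))); first by rewrite !mulr_ge0 ?addr_ge0 // ltW.
move=> S p q d [d0 sp sq [pd qd] conf] t /andP[at_ tS].
pose a := C0 * d; have a0 : 0 <= a by rewrite mulr_ge0 // ltW.
have aS : a <= S by apply: le_trans tS.
have hp : f (p t) - M = expR (a - t) * (f (p a) - M).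
  apply: (solution_const fl sp) => // u b au hb; apply: fM.
  have [h _] := conf u ltac:(rewrite /a in au; lra).
  exact: confined_supported h hb.
have hq : f (q t) - M = expR (a - t) * (f (q a) - M).
  apply: (solution_const fl sq) => // u b au hb; apply: fM.
  have [_ h] := conf u ltac:(rewrite /a in au; lra).
  exact: confined_supported h hb.
have -> : f (p t) - f (q t) = expR (a - t) * (f (p a) - f (q a)) by lra.
rewrite -(lfB fl) normrM ger0_norm ?expR_ge0 //.
have e1 : expR (a - t) <= 1 by rewrite -expR0 ler_expR; rewrite /a; lra.
have h1 := solution_near sp pd (ltac:(lra) : 0 <= a <= S).
have h2 := solution_near sq qd (ltac:(lra) : 0 <= a <= S).
have h3 : `|p a - q a| <= 2 * (1 + C0) * d.
  have -> : p a - q a = (p a - y) - (q a - y) by rewrite opprB addrA subrK.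
  by apply: le_trans (ler_normB _ _) _; move: h1 h2; rewrite /a; lra.
apply: (@le_trans _ _ `|f (p a - q a)|).
  by rewrite ler_piMl.
apply: le_trans (hK _) _; rewrite -!mulrA ler_pM2l //; lra.
Qed.

Lemma tame_comb f g h (a b c : R) : tame f -> tame g ->
  (forall z, simplexAB z -> h z = a * f z + b * g z + c) -> tame h.
Proof.
move=> [Cf Cf0 hf] [Cg Cg0 hg] E.
exists (`|a| * Cf + `|b| * Cg); first by rewrite addr_ge0 // mulr_ge0.
move=> S p q d pq t ht; have [d0 sp sq _ _] := pq.
have t0 : 0 <= t <= S.
  case/andP: ht => h1 ->; rewrite andbT; apply: le_trans h1.
  by rewrite mulr_ge0 // ltW.
rewrite (E _ (solution_simplex sp t0)) (E _ (solution_simplex sq t0)).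
have -> : a * f (p t) + b * g (p t) + c - (a * f (q t) + b * g (q t) + c) =
  a * (f (p t) - f (q t)) + b * (g (p t) - g (q t)) by ring.
apply: le_trans (ler_normD _ _) _; rewrite !normrM mulrDl -!mulrA.
by apply: lerD; rewrite ler_wpM2l // ?(hf _ _ _ _ pq) ?(hg _ _ _ _ pq).
Qed.

Definition close := exists2 C, 0 <= C & forall S p q d, paired S p q d ->
  forall t, 0 <= t <= S -> `|p t - q t| <= C * d.

(** After the layer the sup norm is read off coordinate by coordinate; within it, unit speed alone
    gives the bound [2 * (1 + C0) * d]. *)
Lemma tame_coords_close :
  (forall i, tame (fun z => z.1 0 i)) -> (forall k, tame (fun z => z.2 k 0)) ->
  close.
Proof.
move: (C00) => c00 h1 h2.
have /choice[C1 hC1] (i : 'I_m) : exists C : R, 0 <= C /\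
    forall S p q d, paired S p q d -> forall t, C0 * d <= t <= S ->
      `|(p t).1 0 i - (q t).1 0 i| <= C * d.
  by have [C ? ?] := h1 i; exists C.
have /choice[C2 hC2] (i : 'I_n) : exists C : R, 0 <= C /\
    forall S p q d, paired S p q d -> forall t, C0 * d <= t <= S ->
      `|(p t).2 i 0 - (q t).2 i 0| <= C * d.
  by have [C ? ?] := h2 i; exists C.
have s1 : 0 <= \sum_i C1 i by apply: sumr_ge0 => i _; case: (hC1 i).
have s2 : 0 <= \sum_i C2 i by apply: sumr_ge0 => i _; case: (hC2 i).
have hC1' i : C1 i <= \sum_i C1 i.
  by rewrite (bigD1 i) //= lerDl; apply: sumr_ge0 => r _; case: (hC1 r).
have hC2' (i : 'I_n) : C2 i <= \sum_i C2 i.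
  by rewrite (bigD1 i) //= lerDl; apply: sumr_ge0 => r _; case: (hC2 r).
move: (\sum_i C1 i) (\sum_i C2 i) s1 s2 hC1' hC2' => S1 S2 s1 s2 hC1' hC2'.
exists (S1 + S2 + 2 * (1 + C0)); first by rewrite !addr_ge0 // mulr_ge0 // addr_ge0.
move=> S p q d pq t /andP[t0 tS]; have [d0 sp sq [pd qd] _] := pq.
have Cd : 0 <= (S1 + S2) * d by rewrite mulr_ge0 ?addr_ge0 // ltW.
have [ta|ta] := leP (C0 * d) t.
  have C0d : 0 <= 2 * (1 + C0) * d by rewrite !mulr_ge0 ?addr_ge0 // ltW.
  apply: profile_norm_le => [|i|i]; first by rewrite mulrDl addr_ge0.
  - rewrite !mxE; apply: le_trans (proj2 (hC1 i) S p q d pq t _) _; first by rewrite ta.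
    by rewrite ler_pM2r //; have := hC1' i; lra.
  - rewrite !mxE; apply: le_trans (proj2 (hC2 i) S p q d pq t _) _; first by rewrite ta.
    by rewrite ler_pM2r //; have := hC2' i; lra.
have h1' := solution_near sp pd (ltac:(lra) : 0 <= t <= S).
have h2' := solution_near sq qd (ltac:(lra) : 0 <= t <= S).
have -> : p t - q t = (p t - y) - (q t - y) by rewrite opprB addrA subrK.
by apply: le_trans (ler_normB _ _) _; lra.
Qed.

End Paired.

(** The two solutions are not compared with each other. The level vanishes at [y], is O(d) at the
    end of the layer and cannot grow afterwards; since it dominates a multiple of each gap, both
    gaps of each solution stay O(d). *)
Lemma tame_spiral y (C0 : R) i j k l : 0 <= C0 -> i != j -> k != l ->
  spiral_signs A B i j k l -> gapA A i j y = 0 -> gapB B k l y = 0 ->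
  tame y C0 [set i; j]%SET [set k; l]%SET (gapA A i j) /\
  tame y C0 [set i; j]%SET [set k; l]%SET (gapB B k l).
Proof.
move=> C00 ij kl sg gA gB; have [s1 s2 s3 s4] := sg.
set L := spiral_level A B i j k l.
have [K K0 hK] : exists2 K, 0 < K & forall z, L z <= K * `|z - y|.
  have [K1 K10 h1] := linear_functional_bounded (gapA_lf A i j).
  have [K2 K20 h2] := linear_functional_bounded (gapB_lf B k l).
  set c1 := `|- (B i k - B i l)| + `|- (B j k - B j l)|.
  set c2 := `|A i k - A j k| + `|A i l - A j l|.
  exists (c1 * K1 + c2 * K2 + 1).
    by rewrite ltr_wpDl // addr_ge0 // mulr_ge0 ?addr_ge0 // ltW.
  move=> z; rewrite /L /spiral_level.
  have k1 := kink_lipschitz (- (B i k - B i l)) (- (B j k - B j l)) (gapA A i j z) 0.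
  have k2 := kink_lipschitz (A i k - A j k) (A i l - A j l) (gapB B k l z) 0.
  have kink0 (a b : R) : kink a b 0 = 0 by rewrite /kink !mulr0 maxxx.
  move: k1 k2; rewrite !kink0 !subr0 -/c1 -/c2 => k1 k2.
  have {}h1 := h1 (z - y); rewrite (lfB (gapA_lf A i j)) gA subr0 in h1.
  have {}h2 := h2 (z - y); rewrite (lfB (gapB_lf B k l)) gB subr0 in h2.
  have m1 : c1 * `|gapA A i j z| <= c1 * (K1 * `|z - y|).
    by rewrite ler_wpM2l // addr_ge0.
  have m2 : c2 * `|gapB B k l z| <= c2 * (K2 * `|z - y|).
    by rewrite ler_wpM2l // addr_ge0.
  have := ler_norm (kink (- (B i k - B i l)) (- (B j k - B j l)) (gapA A i j z)).
  have := ler_norm (kink (A i k - A j k) (A i l - A j l) (gapB B k l z)).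
  have := normr_ge0 (z - y); lra.
have small S p q d : paired y C0 [set i; j]%SET [set k; l]%SET S p q d ->
    forall t, C0 * d <= t <= S ->
    L (p t) <= K * ((1 + C0) * d) /\ L (q t) <= K * ((1 + C0) * d).
  move=> [d0 sp sq [pd qd] conf] t /andP[at_ tS].
  pose a := C0 * d; have a0 : 0 <= a by rewrite mulr_ge0 // ltW.
  have aS : a <= S by apply: le_trans tS.
  have main r : fp_solution A B S r -> `|r 0 - y| <= d ->
     (forall t, C0 * d <= t <= S -> confined A B [set i; j]%SET [set k; l]%SET (r t)) ->
     L (r t) <= K * ((1 + C0) * d).
    move=> sr rd cr.
    have E := @spiral_level_exp _ _ _ A B i j k l ij kl sg S r a t sr a0 at_ tS.
    have {}E := E ltac:(move=> u au; apply: cr; rewrite /a in au; lra).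
    have L0 : 0 <= L (r a) by apply: spiral_level_ge0.
    have h : L (r t) <= L (r a).
      have e0 := expR_gt0 t; rewrite -(ler_pM2l e0) E ler_wpM2r // ler_expR //.
    apply: le_trans h _; apply: le_trans (hK _) _; rewrite ler_pM2l //.
    have := solution_near sr rd (ltac:(lra) : 0 <= a <= S); rewrite /a; lra.
  by split; apply: main => // u hu; case: (conf u hu).
have pos : 0 < A i k - A j k /\ A i l - A j l < 0 by split; lra.
have pos' : 0 < - (B i k - B i l) /\ - (B j k - B j l) < 0 by split; lra.
have b1 := @kink_norm_ge R _ _ _ (proj1 pos') (proj2 pos').
have b2 := @kink_norm_ge R _ _ _ (proj1 pos) (proj2 pos).
move: b1 b2; set m1 := Num.min _ _; set m2 := Num.min _ _ => b1 b2.
have m10 : 0 < m1 by rewrite lt_min; lra.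
have m20 : 0 < m2 by rewrite lt_min; lra.
have bA z : `|gapA A i j z| <= m1^-1 * L z.
  rewrite mulrC ler_pdivlMr // mulrC; apply: le_trans (b1 _) _.
  rewrite lerDl; apply: le_trans (b2 _); exact: mulr_ge0 (ltW m20) _.
have bB z : `|gapB B k l z| <= m2^-1 * L z.
  rewrite mulrC ler_pdivlMr // mulrC; apply: le_trans (b2 _) _.
  rewrite lerDr; apply: le_trans (b1 _); exact: mulr_ge0 (ltW m10) _.
split.
  exists (2 * (m1^-1 * (K * (1 + C0)))).
    by rewrite !mulr_ge0 ?invr_ge0 ?addr_ge0 // ltW.
  move=> S p q d pq t ht; have [h1 h2] := small S p q d pq t ht.
  apply: le_trans (ler_normB _ _) _.
  have i0 : 0 <= m1^-1 by rewrite invr_ge0 ltW.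
  have w1 := le_trans (bA (p t)) (ler_wpM2l i0 h1).
  have w2 := le_trans (bA (q t)) (ler_wpM2l i0 h2).
  lra.
exists (2 * (m2^-1 * (K * (1 + C0)))).
  by rewrite !mulr_ge0 ?invr_ge0 ?addr_ge0 // ltW.
move=> S p q d pq t ht; have [h1 h2] := small S p q d pq t ht.
apply: le_trans (ler_normB _ _) _.
have i0 : 0 <= m2^-1 by rewrite invr_ge0 ltW.
have w1 := le_trans (bB (p t)) (ler_wpM2l i0 h1).
have w2 := le_trans (bB (q t)) (ler_wpM2l i0 h2).
lra.
Qed.

Lemma row_mass_lf : linear_functional (fun z : profile => \sum_i z.1 0 i).
Proof.
move=> a x z /=; under eq_bigr do rewrite !mxE.
by rewrite big_split /= mulr_sumr.
Qed.

Lemma col_mass_lf : linear_functional (fun z : profile => \sum_i z.2 i 0).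
Proof.
move=> a x z /=; under eq_bigr do rewrite !mxE.
by rewrite big_split /= mulr_sumr.
Qed.

(* Exploits that [gapB k l - d * (total mass) - d' * (weight of i)] vanishes on
   strategies supported by {i, j} when [d] is the value of [gapB k l] at [j]. *)
Lemma tame_spiral_row y (C0 : R) i j k l : 0 <= C0 -> i != j -> k != l ->
  B i k - B i l != B j k - B j l ->
  tame y C0 [set i; j]%SET [set k; l]%SET (gapB B k l) ->
  tame y C0 [set i; j]%SET [set k; l]%SET (fun z => z.1 0 i).
Proof.
move=> C00 ij kl dne tB.
set d0 := B i k - B i l in dne *; set d1 := B j k - B j l in dne *.
pose h z := gapB B k l z - d1 * \sum_r z.1 0 r - (d0 - d1) * z.1 0 i.
have hl : linear_functional h.
  move=> a x z; rewrite /h (gapB_lf B k l) (row_mass_lf a x z) /= !mxE; ring.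
have th : tame y C0 [set i; j]%SET [set k; l]%SET h.
  apply: (tame_decay _ C00 (M := 0) hl) => b [[[_ b1] _] h1 _].
  rewrite /h b1 gapBE (sum_supp2 _ ij h1) -/d0 -/d1.
  have -> : b.1 0 j = 1 - b.1 0 i by have := supp2_weights ij h1 b1; lra.
  ring.
have dd : d0 - d1 != 0 by rewrite subr_eq0.
apply: (tame_comb C00 (a := (d0 - d1)^-1) (b := - (d0 - d1)^-1)
  (c := - (d0 - d1)^-1 * d1) tB th) => z [[_ z1] _].
by rewrite /h z1; field.
Qed.

Lemma tame_spiral_col y (C0 : R) i j k l : 0 <= C0 -> i != j -> k != l ->
  A i k - A j k != A i l - A j l ->
  tame y C0 [set i; j]%SET [set k; l]%SET (gapA A i j) ->
  tame y C0 [set i; j]%SET [set k; l]%SET (fun z => z.2 k 0).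
Proof.
move=> C00 ij kl dne tA.
set d0 := A i k - A j k in dne *; set d1 := A i l - A j l in dne *.
pose h z := gapA A i j z - d1 * \sum_r z.2 r 0 - (d0 - d1) * z.2 k 0.
have hl : linear_functional h.
  move=> a x z; rewrite /h (gapA_lf A i j) (col_mass_lf a x z) /= !mxE; ring.
have th : tame y C0 [set i; j]%SET [set k; l]%SET h.
  apply: (tame_decay _ C00 (M := 0) hl) => b [[_ [_ b1]] _ h1].
  rewrite /h b1 gapAE (sum_supp2 _ kl h1) -/d0 -/d1.
  have -> : b.2 l 0 = 1 - b.2 k 0 by have := supp2_weights kl h1 b1; lra.
  ring.
have dd : d0 - d1 != 0 by rewrite subr_eq0.
apply: (tame_comb C00 (a := (d0 - d1)^-1) (b := - (d0 - d1)^-1)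
  (c := - (d0 - d1)^-1 * d1) tA th) => z [_ [_ z1]].
by rewrite /h z1; field.
Qed.

Lemma spiral_close y (C0 : R) i j k l : 0 <= C0 -> i != j -> k != l ->
  spiral_signs A B i j k l -> gapA A i j y = 0 -> gapB B k l y = 0 ->
  close y C0 [set i; j]%SET [set k; l]%SET.
Proof.
move=> C00 ij kl sg gA gB; have [tA tB] := tame_spiral C00 ij kl sg gA gB.
have [s1 s2 s3 s4] := sg.
apply: tame_coords_close => // r.
  have [->|ri] := eqVneq r i.
    by apply: (tame_spiral_row C00 ij kl _ tB); rewrite lt_eqF //; lra.
  have [->|rj] := eqVneq r j.
    rewrite finset.setUC; rewrite finset.setUC in tB.
    by apply: (tame_spiral_row C00 _ kl _ tB); [rewrite eq_sym|rewrite gt_eqF //; lra].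
  apply: (tame_decay _ C00 (M := 0) (rowcoord_lf r)) => b [_ h _].
  by apply/eqP/negPn/negP => /h; rewrite !inE (negbTE ri) (negbTE rj).
have [->|ri] := eqVneq r k.
  by apply: (tame_spiral_col C00 ij kl _ tA); rewrite gt_eqF //; lra.
have [->|rj] := eqVneq r l.
  rewrite [[set k; l]%SET]finset.setUC; rewrite [[set k; l]%SET]finset.setUC in tA.
  by apply: (tame_spiral_col C00 ij _ _ tA); [rewrite eq_sym|rewrite lt_eqF //; lra].
apply: (tame_decay _ C00 (M := 0) (colcoord_lf r)) => b [_ _ h].
by apply/eqP/negPn/negP => /h; rewrite !inE (negbTE ri) (negbTE rj).
Qed.

Lemma pure_close y (C0 : R) i k : 0 <= C0 -> close y C0 [set i]%SET [set k]%SET.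
Proof.
move=> C00; apply: tame_coords_close => // r.
  apply: (tame_decay _ C00 (M := (r == i)%:R) (rowcoord_lf r)) => b [[[_ b1] _] h _].
  have [->|ri] := eqVneq r i; last first.
    by apply/eqP/negPn/negP => /h; rewrite !inE (negbTE ri).
  rewrite -b1 (bigD1 i) //= big1 ?addr0 // => r' r'i.
  by apply/eqP/negPn/negP => /h; rewrite !inE (negbTE r'i).
apply: (tame_decay _ C00 (M := (r == k)%:R) (colcoord_lf r)) => b [[_ [_ b1]] _ h].
have [->|ri] := eqVneq r k; last first.
  by apply/eqP/negPn/negP => /h; rewrite !inE (negbTE ri).
rewrite -b1 (bigD1 k) //= big1 ?addr0 // => r' r'i.
by apply/eqP/negPn/negP => /h; rewrite !inE (negbTE r'i).
Qed.

End Closeness.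

(** * From closeness near a point to continuous dependence along orbits *)

Section LocalUniqueness.
Context {R : realType} {m n : nat}.
Notation profile := ('rV[R]_m * 'cV[R]_n)%type.
Variables (A B : 'M[R]_(m, n)).
Implicit Types (y z x b P : profile) (f g : profile -> R) (p q : R -> profile).
Implicit Types (s t u v a c T S M K e d tau : R) (i j : 'I_m) (k l : 'I_n).
Implicit Types (I : {set 'I_m}) (J : {set 'I_n}) (X : set profile).

Lemma gapA_gt0_notbest i j z : 0 < gapA A i j z -> ~ bestA A z.2 j.
Proof. by move=> h /(_ i); rewrite leNgt => /negP; apply; rewrite -subr_gt0. Qed.

Lemma gapB_gt0_notbest k l z : 0 < gapB B k l z -> ~ bestB B z.1 l.
Proof. by move=> h /(_ k); rewrite leNgt => /negP; apply; rewrite -subr_gt0. Qed.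

(** For [f] the gap of a dominating over a dominated strategy, this ends the influence of the
    dominated one: [f] starts at least at a negative multiple of [d] and is driven upwards with
    strength [M]. *)
Lemma gap_positive f M y (C0 : R) I J : 0 <= C0 -> linear_functional f ->
  f y = 0 -> 0 < M -> (forall b, supported I J b -> M <= f b) ->
  exists2 C1, C0 <= C1 & forall S p d, 0 < d -> fp_solution A B S p ->
    `|p 0 - y| <= d -> (forall t, C0 * d <= t <= S -> confined A B I J (p t)) ->
    forall t, C1 * d <= t <= S -> 0 < f (p t).
Proof.
move=> C00 fl fy M0 fM; have [K K0 hK] := linear_functional_bounded fl.
have KM : 0 <= K * (1 + C0) / M by rewrite divr_ge0 ?mulr_ge0 ?addr_ge0 // ltW.
(* At the end of the layer [f] is at least [- K * (1 + C0) * d], a deficit made up at rate [M]; the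
   additional 1 makes the sign strict. *)
exists (C0 + K * (1 + C0) / M + 1); first lra.
move=> S p d d0 sp pd conf t /andP[at_ tS].
pose a := C0 * d; have a0 : 0 <= a by rewrite mulr_ge0 // ltW.
have E : (C0 + K * (1 + C0) / M + 1) * d = a + (K * (1 + C0) / M + 1) * d.
  by rewrite /a; ring.
have D0 : 0 < (K * (1 + C0) / M + 1) * d by rewrite mulr_gt0 // ltr_wpDl.
have aS : a <= S by lra.
have h : expR (a - t) * (f (p a) - M) <= f (p t) - M.
  apply: (solution_lower fl sp) => //; first lra.
  move=> u b au hb; apply: fM.
  by apply: confined_supported hb; apply: conf; rewrite /a in au; lra.
have fa : - (K * ((1 + C0) * d)) <= f (p a).
  have := hK (p a - y); rewrite (lfB fl) fy subr0 ler_norml => /andP[h1 _].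
  apply: le_trans h1; rewrite lerN2 ler_pM2l //.
  by have := solution_near sp pd (ltac:(lra) : 0 <= a <= S); rewrite /a; lra.
have e1 := expR_ge1Dx (t - a).
have e0 := expR_gt0 (t - a).
have : expR (t - a) * (expR (a - t) * (f (p a) - M)) <= expR (t - a) * (f (p t) - M).
  by rewrite ler_pM2l.
rewrite mulrA -expRD (_ : t - a + (a - t) = 0); last ring.
rewrite expR0 mul1r => h2.
suff : 0 < expR (t - a) * f (p t) by rewrite pmulr_rgt0.
have : M * (1 + (t - a)) <= M * expR (t - a) by rewrite ler_pM2l.
have : K * ((1 + C0) * d) < M * (t - a).
  have h3 : M * ((K * (1 + C0) / M + 1) * d) <= M * (t - a) by rewrite ler_pM2l //; lra.
  apply: lt_le_trans h3; have -> : M * ((K * (1 + C0) / M + 1) * d) =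
    K * ((1 + C0) * d) + M * d by field; rewrite gt_eqF.
  by rewrite ltrDl mulr_gt0.
lra.
Qed.

(** The induction needs [C0] arbitrary: each elimination lengthens the layer from [C0 * d] to
    [C1 * d], after which the same pair of solutions is confined to the smaller sets. *)
Lemma reducible_close I J : reducible A B I J -> forall y (C0 : R), 0 <= C0 ->
  (forall i j, i \in I -> j \in I -> gapA A i j y = 0) ->
  (forall k l, k \in J -> l \in J -> gapB B k l y = 0) -> close A B y C0 I J.
Proof.
elim=> {I J} [i k|i j k l ij kl sg|I J i j iI ij dom _ IH|I J k l kJ kl dom _ IH]
  y C0 C00 gA gB.
- exact: pure_close.
- by apply: spiral_close => //; [apply: gA|apply: gB]; rewrite !inE eqxx ?orbT.
(* If [j] is not in [I], the elimination changes nothing. *)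
- have [jI|jI] := boolP (j \in I); last first.
    have E : (I :\ j = I)%SET.
      by apply/finset.setP => x; rewrite !inE; case: eqVneq => // ->; rewrite (negbTE jI).
    by rewrite E in IH; apply: IH.
  have dom' k : k \in J -> 0 < A i k - A j k by rewrite subr_gt0; apply: dom.
  have [M M0 hM] := exists_min_pos dom'.
  have hb b : supported I J b -> M <= gapA A i j b.
    move=> [[_ [b0 b1]] _ h2]; rewrite gapAE; apply: weighted_sum_ge => // k /h2.
    exact: hM.
  have [C1 C01 hC1] := gap_positive C00 (gapA_lf A i j) (gA i j iI jI) M0 hb.
  have [C C_ge0 hC] := IH y C1 (le_trans C00 C01)
    (fun i1 j1 ha hb => gA i1 j1 (fintype.subsetP (finset.subD1set _ _) _ ha) (fintype.subsetP (finset.subD1set _ _) _ hb)) gB.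
  exists C => // S p q d [d0 sp sq [pd qd] conf].
  apply: hC; split => // t tS.
  have C0t : C0 * d <= t <= S.
    case/andP: tS => h ->; rewrite andbT; apply: le_trans h.
    by rewrite ler_pM2r.
  have [cp cq] := conf t C0t.
  have hp := hC1 S p d d0 sp pd (fun t ht => (conf t ht).1) t tS.
  have hq := hC1 S q d d0 sq qd (fun t ht => (conf t ht).2) t tS.
  have main r : confined A B I J r -> 0 < gapA A i j r -> confined A B (I :\ j)%SET J r.
    move=> [c1 c2] h; split => // r' hr'; rewrite !inE (c1 _ hr') andbT.
    by apply: contraPneq hr' => ->; apply: gapA_gt0_notbest h.
  by split; apply: main.
- have [lJ|lJ] := boolP (l \in J); last first.
    have E : (J :\ l = J)%SET.
      by apply/finset.setP => x; rewrite !inE; case: eqVneq => // ->; rewrite (negbTE lJ).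
    by rewrite E in IH; apply: IH.
  have dom' i : i \in I -> 0 < B i k - B i l by rewrite subr_gt0; apply: dom.
  have [M M0 hM] := exists_min_pos dom'.
  have hb b : supported I J b -> M <= gapB B k l b.
    move=> [[[b0 b1] _] h2 _]; rewrite gapBE; apply: weighted_sum_ge => // i /h2.
    exact: hM.
  have [C1 C01 hC1] := gap_positive C00 (gapB_lf B k l) (gB k l kJ lJ) M0 hb.
  have [C C_ge0 hC] := IH y C1 (le_trans C00 C01) gA
    (fun k1 l1 ha hb => gB k1 l1 (fintype.subsetP (finset.subD1set _ _) _ ha) (fintype.subsetP (finset.subD1set _ _) _ hb)).
  exists C => // S p q d [d0 sp sq [pd qd] conf].
  apply: hC; split => // t tS.
  have C0t : C0 * d <= t <= S.
    case/andP: tS => h ->; rewrite andbT; apply: le_trans h.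
    by rewrite ler_pM2r.
  have [cp cq] := conf t C0t.
  have hp := hC1 S p d d0 sp pd (fun t ht => (conf t ht).1) t tS.
  have hq := hC1 S q d d0 sq qd (fun t ht => (conf t ht).2) t tS.
  have main r : confined A B I J r -> 0 < gapB B k l r -> confined A B I (J :\ l)%SET r.
    move=> [c1 c2] h; split => // r' hr'; rewrite !inE (c2 _ hr') andbT.
    by apply: contraPneq hr' => ->; apply: gapB_gt0_notbest h.
  by split; apply: main.
Qed.

Definition best_sets z I J :=
  (forall i, bestA A z.2 i <-> i \in I) /\ (forall k, bestB B z.1 k <-> k \in J).

Lemma notbestA_gap z i : ~ bestA A z.2 i -> exists j, 0 < gapA A j i z.
Proof.
move=> h; apply: contrapT => h2; apply: h => j; rewrite leNgt; apply/negP => h3.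
by apply: h2; exists j; rewrite subr_gt0.
Qed.

Lemma notbestB_gap z k : ~ bestB B z.1 k -> exists l, 0 < gapB B l k z.
Proof.
move=> h; apply: contrapT => h2; apply: h => j; rewrite leNgt; apply/negP => h3.
by apply: h2; exists j; rewrite subr_gt0.
Qed.

Lemma lf_positive_near f y : linear_functional f -> 0 < f y ->
  exists2 r : R, 0 < r & forall z, `|z - y| <= r -> 0 < f z.
Proof.
move=> fl fy; have [K K0 hK] := linear_functional_bounded fl.
exists (f y / (2 * K)); first by rewrite divr_gt0 // mulr_gt0.
move=> z zy; have := hK (z - y); rewrite (lfB fl) ler_norml => /andP[h _].
have : K * `|z - y| <= K * (f y / (2 * K)) by rewrite ler_pM2l.
have -> : K * (f y / (2 * K)) = f y / 2 by field; rewrite gt_eqF.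
lra.
Qed.

(** A strategy that is not best at [y] is beaten there by a positive gap, hence also nearby. *)
Lemma best_sets_near y I J : best_sets y I J ->
  exists2 r : R, 0 < r & forall z, `|z - y| <= r -> confined A B I J z.
Proof.
move=> [hI hJ].
have /choice[rA hA] (i : 'I_m) : exists r : R, 0 < r /\
    forall z, `|z - y| <= r -> bestA A z.2 i -> i \in I.
  have [iI|iI] := boolP (i \in I); first by exists 1.
  have [|j hj] := @notbestA_gap y i; first by move/hI; apply/negP.
  have [r r0 hr] := lf_positive_near (gapA_lf A j i) hj.
  by exists r; split => // z /hr /gapA_gt0_notbest.
have /choice[rB hB] (k : 'I_n) : exists r : R, 0 < r /\
    forall z, `|z - y| <= r -> bestB B z.1 k -> k \in J.
  have [kJ|kJ] := boolP (k \in J); first by exists 1.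
  have [|j hj] := @notbestB_gap y k; first by move/hJ; apply/negP.
  have [r r0 hr] := lf_positive_near (gapB_lf B j k) hj.
  by exists r; split => // z /hr /gapB_gt0_notbest.
have [r1 r10 h1] := exists_min_pos (J := finset.setT) (fun i _ => (hA i).1).
have [r2 r20 h2] := exists_min_pos (J := finset.setT) (fun k _ => (hB k).1).
exists (Num.min r1 r2); first by rewrite lt_min r10.
move=> z; rewrite le_min => /andP[z1 z2]; split => r hr.
  by apply: (hA r).2 hr; apply: le_trans z1 (h1 _ _); rewrite inE.
by apply: (hB r).2 hr; apply: le_trans z2 (h2 _ _); rewrite inE.
Qed.

(** Linearity in [d] yields uniqueness at [y], by letting [d] tend to 0 when both solutions start
    there, together with continuity around [y]. *)
Definition locally_close y := exists tau C : R, [/\ 0 < tau, 0 <= C &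
  forall S p q d, 0 < d -> d <= tau -> S <= tau ->
    fp_solution A B S p -> fp_solution A B S q ->
    `|p 0 - y| <= d -> `|q 0 - y| <= d ->
    forall t, 0 <= t <= S -> `|p t - q t| <= C * d].

Lemma best_gapA y i j : bestA A y.2 i -> bestA A y.2 j -> gapA A i j y = 0.
Proof.
by move=> hi hj; apply/eqP; rewrite subr_eq0 eq_le; apply/andP; split;
  [apply: hj|apply: hi].
Qed.

Lemma best_gapB y k l : bestB B y.1 k -> bestB B y.1 l -> gapB B k l y = 0.
Proof.
by move=> hi hj; apply/eqP; rewrite subr_eq0 eq_le; apply/andP; split;
  [apply: hj|apply: hi].
Qed.

Lemma reducible_locally_close y I J : best_sets y I J -> reducible A B I J ->
  locally_close y.
Proof.
move=> bs red; have [hI hJ] := bs; have [r r0 hr] := best_sets_near bs.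
have [C C_ge0 hC] := reducible_close red (lexx 0)
  (fun i j hi hj => best_gapA ((hI i).2 hi) ((hI j).2 hj))
  (fun k l hi hj => best_gapB ((hJ k).2 hi) ((hJ l).2 hj)).
exists (r / 2), C; split => //; first by rewrite divr_gt0.
move=> S p q d d0 dr Sr sp sq pd qd; apply: hC; split => // t.
rewrite mul0r => tS; split; apply: hr.
  by apply: le_trans (solution_near sp pd tS) _; lra.
by apply: le_trans (solution_near sq qd tS) _; lra.
Qed.

Lemma fp_solution_shift T p c : fp_solution A B T p -> 0 <= c ->
  fp_solution A B (T - c) (fun t => p (c + t)).
Proof.
move=> sp c0; apply: good_time_solution.
- by move=> t tT; apply: (solution_simplex sp); lra.
- move=> s t s0 st tT; have := solution_lipschitz sp
    (ltac:(lra) : 0 <= c + s) (ltac:(lra) : c + s <= c + t) ltac:(lra).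
  by congr (_ <= _); ring.
- have [N N0 hN] := solution_good_time sp.
  exists ((fun t => c + t) @^-1` N); first exact: lebesgue_negligible_shift.
  move=> t tT Nt; have [|b hb dp] := hN (c + t) _ Nt; first lra.
  exists b => //; apply/is_derive_epsP => e e0.
  have [d d0 hd] := (is_derive_epsP _ _ _).1 dp e e0; exists d => // h /hd.
  by rewrite addrA.
Qed.

Lemma fp_solution_restrict T S p : fp_solution A B T p -> S <= T ->
  fp_solution A B S p.
Proof.
move=> [h1 h2 h3] ST; split.
- by move=> t tS; apply: h1; lra.
- move=> e /h2[d d0 hd]; exists d => // N s t st; apply: hd => i.
  by have [? [? ?]] := st i; do 2!split => //; apply: le_trans ST.
- by apply: negligibleS h3 => t; apply: contra_not => h tS; apply: h; lra.
Qed.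

(** Local estimates are chained along [p] by a supremum argument. Only [p] has to avoid [X], since
    its competitors are always compared with it near a point of [p]. *)
Lemma solution_dependence X T p :
  (forall x, simplexAB x -> ~ X x -> locally_close x) ->
  fp_solution A B T p -> (forall t, 0 <= t < T -> ~ X (p t)) ->
  forall e, 0 < e -> exists2 d : R, 0 < d & forall q, fp_solution A B T q ->
    `|q 0 - p 0| < d -> forall t, 0 <= t <= T -> `|q t - p t| < e.
Proof.
move=> lc sp nX.
have [T0|T0] := ltP T 0.
  by move=> e _; exists 1 => // q _ _ t tT; exfalso; lra.
pose P s := forall e, 0 < e -> exists2 d : R, 0 < d &
  forall q, fp_solution A B T q ->
    `|q 0 - p 0| < d -> forall t, 0 <= t <= s -> `|q t - p t| < e.
pose Q := [set s | 0 <= s <= T /\ P s].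
have Q0 : Q 0.
  split; first by rewrite lexx.
  move=> e e0; exists e => // q _ qp t t0.
  by have -> : t = 0 by apply/le_anti; rewrite andbC.
have supQ : has_sup Q by split; [exists 0|exists T => s [/andP[]]].
set c := sup Q.
have c0 : 0 <= c by apply: ub_le_sup => //; case: supQ.
have cT : c <= T by apply: ge_sup; [exists 0|move=> s [/andP[]]].
have Pc : P c.
  (* Beyond [s] each solution moves by less than e / 4, which is added to the bound e / 2 valid up
     to [s]. *)
  move=> e e0; have [s [s0T Ps] cs] := sup_gt supQ.1 (ltac:(lra) : c - e / 4 < c).
  have [d d0 hd] := Ps (e / 2) ltac:(lra); exists d => // q sq qp t tc.
  have [ts|st] := leP t s; first by have := hd q sq qp t ltac:(lra); lra.
  have h1 := hd q sq qp s ltac:(lra).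
  have h2 := solution_lipschitz sp (ltac:(lra) : 0 <= s) (ltW st) ltac:(lra).
  have h3 := solution_lipschitz sq (ltac:(lra) : 0 <= s) (ltW st) ltac:(lra).
  have -> : q t - p t = (q t - q s) + (q s - p s) - (p t - p s).
    by rewrite addrA subrK [q t - p s]addrC opprB addrC addrA subrK addrC.
  apply: le_lt_trans (ler_normB _ _) _.
  have := ler_normD (q t - q s) (q s - p s); lra.
have [cltT|] := ltP c T; last first.
  move=> Tc; have E : c = T by apply/eqP; rewrite eq_le cT Tc.
  by rewrite E in Pc.
have [tau [C [tau0 C0 hC]]] := lc (p c)
  (solution_simplex sp (ltac:(lra) : 0 <= c <= T)) (nX c ltac:(lra)).
pose s := c + Num.min tau (T - c).
have m0 : 0 < Num.min tau (T - c) by rewrite lt_min tau0; lra.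
have mtau : Num.min tau (T - c) <= tau by rewrite ge_min lexx.
have mT : Num.min tau (T - c) <= T - c by rewrite ge_min lexx orbT.
suff : Q s by move=> /(ub_le_sup supQ.2); rewrite -/c /s; lra.
split; first by rewrite /s; lra.
(* A distance below [tau] permits the local estimate, and the divisor [C + 1] keeps [C * e1]
   strictly below [e]. *)
move=> e e0; pose e1 := Num.min tau (e / (C + 1)).
have C1 : 0 < C + 1 by lra.
have e10 : 0 < e1 by rewrite lt_min tau0 divr_gt0.
have e1t : e1 <= tau by rewrite ge_min lexx.
have e1e : e1 * (C + 1) <= e by rewrite -ler_pdivlMr // ge_min lexx orbT.
have [d d0 hd] := Pc e1 e10; exists d => // q sq qp t ts.
have [tc|ct] := leP t c.
  have := hd q sq qp t ltac:(lra); have : 0 <= e1 * C by rewrite mulr_ge0 // ltW.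
  lra.
have shp := fp_solution_restrict (fp_solution_shift sp c0) mT.
have shq := fp_solution_restrict (fp_solution_shift sq c0) mT.
have h1 := hd q sq qp c ltac:(lra).
have := hC _ _ _ e1 e10 e1t mtau shq shp; rewrite !addr0 subrr normr0.
move=> /(_ (ltW h1) (ltW e10) (t - c)).
have -> : c + (t - c) = t by ring.
move=> /(_ ltac:(rewrite /s in ts; lra)); lra.
Qed.

Lemma solution_unique X T p q :
  (forall x, simplexAB x -> ~ X x -> locally_close x) ->
  fp_solution A B T p -> fp_solution A B T q ->
  (forall t, 0 <= t < T -> ~ X (p t)) -> p 0 = q 0 ->
  forall t, 0 <= t <= T -> p t = q t.
Proof.
move=> lc sp sq nX pq t tT; apply/eqP; rewrite eq_sym -subr_eq0 -normr_le0.
apply: eps_ler => e e0; have [d d0 hd] := solution_dependence lc sp nX e0.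
by rewrite add0r ltW // hd // pq subrr normr0.
Qed.

End LocalUniqueness.

(** * Construction of the flow *)

Section LipschitzExtension.
Context {R : realType} {m n : nat}.
Notation profile := ('rV[R]_m * 'cV[R]_n)%type.
Implicit Types (z x : profile) (s t c e : R).

Lemma simplexAB_closed z :
  (forall e : R, 0 < e -> exists2 x, simplexAB x & `|z - x| <= e) -> simplexAB z.
Proof.
move=> h.
have nonneg (f : profile -> R) : linear_functional f ->
    (forall x, simplexAB x -> 0 <= f x) -> 0 <= f z.
  move=> fl f0; have [K K0 hK] := linear_functional_bounded fl.
  apply: eps_ler => e e0; have [x sx zx] := h _ (divr_gt0 e0 K0).
  have := hK (z - x); rewrite (lfB fl) ler_norml => /andP[h1 _].
  have : K * `|z - x| <= e by rewrite mulrC -ler_pdivlMr.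
  have := f0 x sx; lra.
have mass (f : profile -> R) : linear_functional f ->
    (forall x, simplexAB x -> f x = 1) -> f z = 1.
  move=> fl f0; have [K K0 hK] := linear_functional_bounded fl.
  apply/eqP; rewrite -subr_eq0 -normr_le0.
  apply: eps_ler => e e0; have [x sx zx] := h _ (divr_gt0 e0 K0).
  have := hK (z - x); rewrite (lfB fl) (f0 x sx) => h1.
  have : K * `|z - x| <= e by rewrite mulrC -ler_pdivlMr.
  lra.
split; split.
- by move=> i; apply: (nonneg _ (rowcoord_lf i)) => x [[]].
- by apply: (mass _ row_mass_lf) => x [[]].
- by move=> i; apply: (nonneg _ (colcoord_lf i)) => x [_ []].
- by apply: (mass _ col_mass_lf) => x [_ []].
Qed.

(** The limit is taken as the supremum of the lower bounds [f s - (c - s)], as in a McShane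
    extension. *)
Lemma lipschitz_left_limit (f : R -> R) c : 0 < c ->
  (forall s t, 0 <= s -> s <= t -> t < c -> `|f t - f s| <= t - s) ->
  exists L, forall t, 0 <= t < c -> `|L - f t| <= c - t.
Proof.
move=> c0 lf.
have cross s t : 0 <= s < c -> 0 <= t < c -> f s - (c - s) <= f t + (c - t).
  move=> hs ht; have [st|ts] := leP s t.
    by have := lf s t ltac:(lra) st ltac:(lra); rewrite ler_norml; lra.
  by have := lf t s ltac:(lra) (ltW ts) ltac:(lra); rewrite ler_norml; lra.
pose V := [set v | exists2 s, 0 <= s < c & v = f s - (c - s)].
have V0 : V !=set0 by exists (f 0 - (c - 0)), 0 => //; rewrite lexx.
have ubV t : 0 <= t < c -> ubound V (f t + (c - t)).
  by move=> ht _ [s hs ->]; apply: cross.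
exists (sup V) => t ht; rewrite ler_norml; apply/andP; split.
  have : f t - (c - t) <= sup V; last lra.
  by apply: ub_le_sup; [exists (f t + (c - t)); apply: ubV|exists t].
have : sup V <= f t + (c - t); last lra.
by apply: ge_sup => //; apply: ubV.
Qed.

Lemma profile_left_limit (p : R -> profile) c : 0 < c ->
  (forall s t, 0 <= s -> s <= t -> t < c -> `|p t - p s| <= t - s) ->
  exists L, forall t, 0 <= t < c -> `|L - p t| <= c - t.
Proof.
move=> c0 lp.
have /choice[L1 h1] (i : 'I_m) : exists L : R, forall t, 0 <= t < c ->
    `|L - (p t).1 0 i| <= c - t.
  apply: (@lipschitz_left_limit (fun t => (p t).1 0 i)) => // s t s0 st tc.
  have := row_coord_norm (p t - p s) i; rewrite !mxE => /le_trans; apply.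
  exact: lp.
have /choice[L2 h2] (i : 'I_n) : exists L : R, forall t, 0 <= t < c ->
    `|L - (p t).2 i 0| <= c - t.
  apply: (@lipschitz_left_limit (fun t => (p t).2 i 0)) => // s t s0 st tc.
  have := col_coord_norm (p t - p s) i; rewrite !mxE => /le_trans; apply.
  exact: lp.
exists ((\row_i L1 i, \col_i L2 i) : profile) => t ht.
apply: profile_norm_le => [|i|i]; first lra.
  by rewrite !mxE; apply: h1.
by rewrite !mxE; apply: h2.
Qed.

End LipschitzExtension.

Section CanonicalFlow.
Context {R : realType} {m n : nat}.
Notation profile := ('rV[R]_m * 'cV[R]_n)%type.
Variables (A B : 'M[R]_(m, n)) (N : profile -> profile).
Implicit Types (x y z P : profile) (p q : R -> profile) (s t r c T e : R).

Hypothesis N_simplex : forall x, simplexAB x -> simplexAB (N x).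
Hypothesis N_ray : forall x, simplexAB x -> exists2 e : R, 0 < e &
  forall r, 0 <= r < e ->
    N (ray x (N x) r) = N x /\ BRAB A B (ray x (N x) r) (N x).

(** A condition just to the right of each time determines the orbit even where the inclusion
    branches, and leaves room for switches that accumulate from the left. *)
Definition canonical T p :=
  [/\ forall t, 0 <= t <= T -> simplexAB (p t),
      forall s t, 0 <= s -> s <= t -> t <= T -> `|p t - p s| <= t - s &
      forall t, 0 <= t < T -> exists2 e : R, 0 < e &
        forall r, 0 <= r < e -> t + r <= T -> p (t + r) = ray (p t) (N (p t)) r].

Lemma canonical_restrict S T p : canonical T p -> S <= T -> canonical S p.
Proof.
move=> [h1 h2 h3] ST; split.
- by move=> t tS; apply: h1; lra.
- by move=> s t s0 st tS; apply: h2 => //; lra.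
- move=> t tS; have [|e e0 he] := h3 t; first lra.
  by exists e => // r re tr; apply: he => //; lra.
Qed.

Lemma canonical_unique T p q : canonical T p -> canonical T q -> p 0 = q 0 ->
  forall t, 0 <= t <= T -> p t = q t.
Proof.
move=> [p1 p2 p3] [q1 q2 q3] pq0 t /andP[t0 tT].
apply: (@real_induction _ (fun t => p t = q t) t) => //.
- move=> c c0t pqc; have [|e e0 he] := p3 c; first lra.
  have [|e' e'0 he'] := q3 c; first lra.
  exists (Num.min e e'); first by rewrite lt_min e0.
  move=> s cs st; have -> : s = c + (s - c) by ring.
  have h1 : 0 <= s - c < e.
    by have : Num.min e e' <= e; [rewrite ge_min lexx|lra].
  have h2 : 0 <= s - c < e'.
    by have : Num.min e e' <= e'; [rewrite ge_min lexx orbT|lra].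
  by rewrite he ?he' ?pqc //; lra.
- move=> c c0t h; apply/eqP; rewrite -subr_eq0 -normr_le0.
  apply: eps_ler => e e0; pose s := Num.max 0 (c - e / 2).
  have s0 : 0 <= s by rewrite le_max lexx.
  have se : c - e / 2 <= s by rewrite le_max lexx orbT.
  have sc : s < c by rewrite gt_max; lra.
  have -> : p c - q c = (p c - p s) - (q c - q s).
    by rewrite (h s) ?s0 // opprB addrA subrK.
  apply: le_trans (ler_normB _ _) _.
  have := p2 s c s0 (ltW sc) ltac:(lra); have := q2 s c s0 (ltW sc) ltac:(lra).
  lra.
Qed.

Lemma canonical_extend c p : 0 <= c -> canonical c p ->
  exists2 e : R, 0 < e & forall T, c < T < c + e ->
    exists2 q, canonical T q & q 0 = p 0.
Proof.
move=> c0 [p1 p2 p3].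
have sc : simplexAB (p c) by apply: p1; lra.
have [e e0 he] := N_ray sc; have sN := N_simplex sc.
exists e => // T cT.
pose q t := if t <= c then p t else ray (p c) (N (p c)) (t - c).
have ql t : t <= c -> q t = p t by rewrite /q => ->.
have qr t : c <= t -> q t = ray (p c) (N (p c)) (t - c).
  rewrite le_eqVlt => /orP[/eqP<-|ct]; first by rewrite ql // subrr ray0.
  by rewrite /q leNgt ct.
exists q; last by rewrite ql.
split.
- move=> t tT; have [tc|ct] := leP t c; first by rewrite ql //; apply: p1; lra.
  by rewrite qr ?ltW //; apply: ray_simplex => //; lra.
- have right s t : c <= s -> s <= t -> `|q t - q s| <= t - s.
    move=> cs st; rewrite !qr //; last exact: le_trans st.
    have := ray_lipschitz sc sN (ltac:(lra) : 0 <= s - c)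
      (ltac:(lra) : s - c <= t - c).
    by congr (_ <= _); ring.
  move=> s t s0 st tT; have [tc|ct] := leP t c.
    by rewrite !ql //; [apply: p2|apply: le_trans tc].
  have [cs|sc'] := leP c s; first exact: right.
  have -> : q t - q s = (q t - q c) + (q c - q s) by rewrite addrA subrK.
  apply: le_trans (ler_normD _ _) _.
  have h1 := right c t (lexx c) (ltW ct).
  have h2 : `|q c - q s| <= c - s by rewrite !ql //; [apply: p2 => //; lra|lra].
  by apply: le_trans (lerD h1 h2) _; rewrite addrA subrK.
- move=> t tT; have [tc|ct] := ltP t c.
    have [|d d0 hd] := p3 t; first lra.
    exists (Num.min d (c - t)); first by rewrite lt_min d0; lra.
    move=> r; rewrite lt_min => /and3P[r0 rd rc] _.
    rewrite (ql (t + r)); last lra.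
    by rewrite (ql t (ltW tc)); apply: hd; rewrite ?r0 //; lra.
  have tce : 0 <= t - c < e by lra.
  (* The target is constant along the ray, so the ray is also the one issued from each of its
     points. *)
  exists 1 => // r r1 trT; rewrite (qr t ct) qr; last lra.
  have [-> _] := he _ tce; rewrite -rayD; congr ray; ring.
Qed.

Lemma canonical_limit c (P : R -> R -> profile) x : 0 < c ->
  (forall s, 0 <= s < c -> canonical s (P s) /\ P s 0 = x) ->
  exists2 q, canonical c q & q 0 = x.
Proof.
move=> c0 hP.
(* Any horizon strictly between [t] and [c] gives the same value, by uniqueness of canonical
   orbits. *)
pose f t := P ((t + c) / 2) t.
have fE s t : 0 <= t -> t <= s -> s < c -> f t = P s t.
  move=> t0 ts sc; have tc : 0 <= (t + c) / 2 < c by lra.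
  have [h1 h1'] := hP _ tc; have [h2 h2'] := hP s ltac:(lra).
  have h12 : P ((t + c) / 2) 0 = P s 0 by rewrite h1' h2'.
  have tt : t <= (t + c) / 2 by lra.
  exact: (canonical_unique (canonical_restrict h1 tt)
    (canonical_restrict h2 ts) h12 (introT andP (conj t0 (lexx t)))).
have fl s t : 0 <= s -> s <= t -> t < c -> `|f t - f s| <= t - s.
  move=> s0 st tc; rewrite (fE t s) // (fE t t) //; last lra.
  by have [[_ h _] _] := hP t ltac:(lra); apply: h.
have fs t : 0 <= t < c -> simplexAB (f t).
  move=> tc; rewrite (fE t t) //; [|lra..].
  by have [[h _ _] _] := hP t tc; apply: h; lra.
have [L hL] := profile_left_limit c0 fl.
pose q t := if t < c then f t else L.
have ql t : t < c -> q t = f t by rewrite /q => ->.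
have qc t : c <= t -> q t = L by rewrite /q ltNge => ->.
exists q; last first.
  rewrite ql // (fE 0 0) // ?lexx //.
  by have [_ ->] := hP 0 ltac:(lra).
split.
- move=> t tc; have [tc'|ct] := ltP t c; first by rewrite ql //; apply: fs; lra.
  rewrite qc //; apply: simplexAB_closed => e e0.
  pose s := Num.max 0 (c - e).
  have s0 : 0 <= s by rewrite le_max lexx.
  have se : c - e <= s by rewrite le_max lexx orbT.
  have sc : s < c by rewrite gt_max; lra.
  exists (f s); first by apply: fs; rewrite s0.
  by apply: le_trans (hL s _) _; rewrite ?s0 //; lra.
- move=> s t s0 st tc; have [tc'|ct] := ltP t c.
    by rewrite !ql //; [apply: fl|apply: le_lt_trans tc'].
  rewrite qc //; have [sc|cs] := ltP s c.
    by rewrite ql //; apply: le_trans (hL s _) _; [rewrite s0|lra].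
  by rewrite qc // subrr normr0; lra.
- move=> t tc; pose s := (t + c) / 2.
  have [[_ _ h] _] := hP s ltac:(rewrite /s; lra).
  have [|e e0 he] := h t; first by rewrite /s; lra.
  exists (Num.min e (s - t)); first by rewrite lt_min e0 /s; lra.
  move=> r; rewrite lt_min => /and3P[r0 re rs] _.
  have sc : s < c by rewrite /s; lra.
  rewrite (ql (t + r)) ?(ql t); [|lra..].
  rewrite (fE s (t + r)) ?(fE s t) //; [|lra..].
  by apply: he; rewrite ?r0 //; lra.
Qed.

Lemma canonical_exists x T : simplexAB x -> 0 <= T ->
  exists2 p, canonical T p & p 0 = x.
Proof.
move=> sx T0.
apply: (@real_induction _ (fun T => exists2 p, canonical T p & p 0 = x) T) => //.
- exists (fun=> x) => //; split => //.
  + by move=> s t s0 st t0; rewrite subrr normr0 subr_ge0.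
  + by move=> t; lra.
- move=> c c0T [p cp p0]; have [e e0 he] := canonical_extend (proj1 (andP c0T)) cp.
  by exists e => // s cs _; have [q cq q0] := he s cs; exists q; rewrite // q0.
- move=> c c0T h.
  have /choice[P hP] s : exists p, 0 <= s < c -> canonical s p /\ p 0 = x.
    have [sc|] := boolP (0 <= s < c); last by exists (fun=> x).
    by have [p cp p0] := h s sc; exists p.
  exact: (canonical_limit (proj1 (andP c0T)) hP).
Qed.

(** Just after any time the orbit is a ray towards a best response, so exceptional times are
    isolated from the right and form a countable set. *)
Lemma canonical_solution T p : canonical T p -> fp_solution A B T p.
Proof.
move=> [p1 p2 p3]; apply: good_time_solution => //.
exists [set t | 0 < t < T /\ ~ good_time A B p t]; last first.
  by move=> t tT; apply: contra_notP => h; split.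
apply: countable_negligible; apply: countable_right_isolated => t [tT _].
have [|e e0 he] := p3 t; first lra.
have st : simplexAB (p t) by apply: p1; lra.
have [d d0 hd] := N_ray st.
exists (Num.min e d); first by rewrite lt_min e0.
move=> s /andP[ts]; rewrite -ltrBlDl lt_min => /andP[se sd] [sT]; apply.
have ps : p s = ray (p t) (N (p t)) (s - t).
  by rewrite -he; [congr p; ring|lra|lra].
exists (N (p t)).
  by rewrite ps; apply: (hd _ _).2; lra.
apply/is_derive_epsP => eps eps0.
have [eta eta0 heta] := (is_derive_epsP _ _ _).1
  (ray_derive (p t) (N (p t)) (s - t)) eps eps0.
pose eta' := Num.min eta (Num.min (s - t) (Num.min (e - (s - t)) (T - s))).
exists eta'.
  by rewrite /eta' !lt_min eta0; apply/and3P; split; lra.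
move=> h; rewrite /eta' !lt_min => /and4P[h1 h2 h3 h4].
have -> : p (s + h) = ray (p t) (N (p t)) (s - t + h).
  move: h2 h3 h4; rewrite !ltr_norml => h2 h3 h4.
  by rewrite -he; [congr p; ring|lra|lra].
by rewrite ps; apply: heta.
Qed.

Lemma canonical_shift T p c : canonical T p -> 0 <= c ->
  canonical (T - c) (fun t => p (c + t)).
Proof.
move=> [p1 p2 p3] c0; split.
- by move=> t tT; apply: p1; lra.
- move=> s t s0 st tT; have := p2 (c + s) (c + t) ltac:(lra) ltac:(lra) ltac:(lra).
  by congr (_ <= _); ring.
- move=> t tT; have [|e e0 he] := p3 (c + t); first lra.
  by exists e => // r re trT; rewrite addrA; apply: he => //; lra.
Qed.

Lemma canonical_flow : exists phi : profile -> R -> profile, is_flow A B phi.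
Proof.
have /choice[P hP] (xT : profile * R) : exists p,
    simplexAB xT.1 -> 0 <= xT.2 -> canonical xT.2 p /\ p 0 = xT.1.
  have [sx|] := pselect (simplexAB xT.1); last by exists (fun=> xT.1).
  have [T0|] := boolP (0 <= xT.2); last by exists (fun=> xT.1).
  by have [p cp p0] := canonical_exists sx T0; exists p.
pose phi x t := P (x, t) t.
have phi0 x : simplexAB x -> phi x 0 = x by move=> sx; apply: (hP (x, 0) sx (lexx _)).2.
have phiE x T t : simplexAB x -> 0 <= t -> t <= T -> phi x t = P (x, T) t.
  move=> sx t0 tT; have [h1 h1'] := hP (x, t) sx t0.
  have [h2 h2'] := hP (x, T) sx (le_trans t0 tT).
  apply: (canonical_unique h1 (canonical_restrict h2 tT)).
    by rewrite h1' h2'.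
  by rewrite t0 lexx.
have phic x T : simplexAB x -> 0 <= T -> canonical T (phi x).
  move=> sx T0; have [[/= h1 h2 h3] _] := hP (x, T) sx T0; split.
  - by move=> t tT; rewrite (phiE x T) //; [apply: h1|lra|lra].
  - move=> s t s0 st tT; rewrite (phiE x T s) ?(phiE x T t) //; [|lra..].
    exact: h2.
  - move=> t tT; have [|e e0 he] := h3 t; first lra.
    exists e => // r re trT; rewrite !(phiE x T) //; [|lra..].
    by apply: he.
exists phi => x sx; split.
- exact: phi0.
- move=> T; have [T0|T0] := leP 0 T.
    exact/canonical_solution/phic.
  exact: fp_solution_restrict (canonical_solution (phic x 0 sx (lexx 0))) (ltW T0).
- move=> s t s0 t0; have cst := phic x (s + t) sx (addr_ge0 s0 t0).
  have ss : simplexAB (phi x s) by case: cst => h _ _; apply: h; lra.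
  have h1 := canonical_shift cst s0.
  have E : s + t - s = t by ring.
  rewrite E in h1.
  apply: (canonical_unique h1 (phic _ t ss t0)); last by rewrite t0 lexx.
  by rewrite addr0 phi0.
Qed.

End CanonicalFlow.

(** * Equilibria of restricted games as targets of the flow *)

Section Settled.
Context {R : realType} {m n : nat}.
Notation profile := ('rV[R]_m * 'cV[R]_n)%type.
Variables (A B : 'M[R]_(m, n)).
Implicit Types (x y z b P Q : profile) (p q : R -> profile).
Implicit Types (t T S e : R) (i j : 'I_m) (k l : 'I_n).
Implicit Types (I : {set 'I_m}) (J : {set 'I_n}) (X : set profile).

(** On the ray towards [P] ties within [I] are broken by the payoffs against [P]; these are the best
    responses just after departure. *)
Definition refineA I P : {set 'I_m} :=
  [set i in I | `[< forall r, r \in I -> payA A P r <= payA A P i >]]%SET.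
Definition refineB J P : {set 'I_n} :=
  [set k in J | `[< forall r, r \in J -> payB B P r <= payB B P k >]]%SET.

(* P is an equilibrium of the subgame I x J, and the only one of the subgame of
   its best responses. *)
Definition settled I J P :=
  supported (refineA I P) (refineB J P) P /\
  forall Q, supported (refineA (refineA I P) Q) (refineB (refineB J P) Q) Q -> Q = P.

Lemma refineA_id I P : refineA (refineA I P) P = refineA I P.
Proof.
apply/finset.setP => i; rewrite [in LHS]inE; apply/andP/idP => [[]//|h].
split=> //; apply/asboolP => r; rewrite inE => /andP[rI _].
by move: h; rewrite inE => /andP[_ /asboolP]; apply.
Qed.

Lemma refineB_id J P : refineB (refineB J P) P = refineB J P.
Proof.
apply/finset.setP => i; rewrite [in LHS]inE; apply/andP/idP => [[]//|h].
split=> //; apply/asboolP => r; rewrite inE => /andP[rI _].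
by move: h; rewrite inE => /andP[_ /asboolP]; apply.
Qed.

Lemma settled_refine I J P : settled I J P ->
  settled (refineA I P) (refineB J P) P.
Proof. by move=> [h1 h2]; split; rewrite refineA_id refineB_id. Qed.

Lemma pure_simplex i k : simplexAB ((pureA i, pureB k) : profile).
Proof.
split; split => /=.
- by move=> r; rewrite mxE.
- by rewrite (bigD1 i) //= mxE !eqxx big1 ?addr0 // => r ri; rewrite mxE (negbTE ri).
- by move=> r; rewrite mxE.
- rewrite (bigD1 k) //= mxE !eqxx big1 ?addr0 // => r ri.
  by rewrite mxE (negbTE ri).
Qed.

Lemma pure_supported i k : supported [set i]%SET [set k]%SET ((pureA i, pureB k) : profile).
Proof.
split; first exact: pure_simplex.
  by move=> r /=; rewrite mxE inE; case: (r == i); rewrite ?andbF //= eqxx.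
by move=> r /=; rewrite mxE inE; case: (r == k); rewrite //= eqxx.
Qed.

Lemma supported_pure i k b : supported [set i]%SET [set k]%SET b ->
  b = (pureA i, pureB k).
Proof.
case: b => b1 b2 [[[_ s1] [_ s2]] h1 h2] /=; move: s1 s2 h1 h2 => /= s1 s2 h1 h2.
have z1 r : r != i -> b1 0 r = 0.
  by move=> ri; apply/eqP/negPn/negP => /h1; rewrite inE (negbTE ri).
have z2 r : r != k -> b2 r 0 = 0.
  by move=> ri; apply/eqP/negPn/negP => /h2; rewrite inE (negbTE ri).
congr pair; apply/matrixP => a c; rewrite ?(ord1 a) ?(ord1 c) mxE eqxx ?andbT /=.
  have [->|ci] := eqVneq c i; last exact: z1.
  by rewrite -s1 (bigD1 i) //= big1 ?addr0 // => r /z1.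
have [->|ci] := eqVneq a k; last exact: z2.
by rewrite -s2 (bigD1 k) //= big1 ?addr0 // => r /z2.
Qed.

Lemma payA_pure i k r : payA A (pureA i, pureB k) r = A r k.
Proof.
rewrite payAE (bigD1 k) //= mxE !eqxx mulr1 big1 ?addr0 // => s sk.
by rewrite mxE (negbTE sk) mulr0.
Qed.

Lemma payB_pure i k r : payB B (pureA i, pureB k) r = B i r.
Proof.
rewrite payBE (bigD1 i) //= mxE !eqxx mul1r big1 ?addr0 // => s sk.
by rewrite mxE (negbTE sk) mul0r.
Qed.

Lemma settled_pure I J i k : i \in I -> k \in J ->
  (forall r, r \in I -> r != i -> A r k < A i k) ->
  (forall s, s \in J -> s != k -> B i s < B i k) ->
  settled I J (pureA i, pureB k).
Proof.
move=> iI kJ hA hB.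
have E1 : refineA I (pureA i, pureB k) = [set i]%SET.
  apply/finset.setP => r; rewrite !inE; apply/andP/eqP => [[rI /asboolP h]|->].
    apply/eqP/negPn/negP => /(hA _ rI); rewrite ltNge => /negP; apply.
    by have := h i iI; rewrite !payA_pure.
  split=> //; apply/asboolP => r' r'I; rewrite !payA_pure.
  by have [->//|/(hA _ r'I)/ltW] := eqVneq r' i.
have E2 : refineB J (pureA i, pureB k) = [set k]%SET.
  apply/finset.setP => r; rewrite !inE; apply/andP/eqP => [[rI /asboolP h]|->].
    apply/eqP/negPn/negP => /(hB _ rI); rewrite ltNge => /negP; apply.
    by have := h k kJ; rewrite !payB_pure.
  split=> //; apply/asboolP => r' r'I; rewrite !payB_pure.
  by have [->//|/(hB _ r'I)/ltW] := eqVneq r' k.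
split; first by rewrite E1 E2; apply: pure_supported.
rewrite E1 E2 => Q [sQ h1 h2]; apply: supported_pure; split => //.
  by move=> r /h1; rewrite inE => /andP[].
by move=> r /h2; rewrite inE => /andP[].
Qed.

(** Against a profile supported in [J] the dominated row earns strictly less than [i], so its
    removal leaves the set of best replies unchanged. *)
Lemma settled_row I J i j P : i \in I -> i != j ->
  (forall k, k \in J -> A j k < A i k) -> settled (I :\ j)%SET J P -> settled I J P.
Proof.
move=> iI ij dom st; suff E : refineA I P = refineA (I :\ j)%SET P.
  by case: st => h1 h2; split; rewrite E.
have [[sP h1 h2] _] := st.
have gap : 0 < gapA A i j P.
  have dom' k : k \in J -> 0 < A i k - A j k by rewrite subr_gt0; apply: dom.
  have [M M0 hM] := exists_min_pos dom'.
  have [_ [P0 P1]] := sP.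
  apply: lt_le_trans M0 _; rewrite gapAE; apply: weighted_sum_ge => // k /h2.
  by rewrite inE => /andP[+ _]; apply: hM.
have iIj : i \in (I :\ j)%SET by rewrite !inE ij.
apply/finset.setP => r; rewrite [in LHS]inE [in RHS]inE.
apply/andP/andP => -[rI /asboolP h]; split.
- rewrite !inE rI andbT; apply: contraPneq (h i iI) => ->.
  by rewrite -subr_le0 => /le_lt_trans /(_ gap); rewrite ltxx.
- by apply/asboolP => r'; rewrite !inE => /andP[_]; apply: h.
- by move: rI; rewrite !inE => /andP[].
- apply/asboolP => r' r'I; have [->|r'j] := eqVneq r' j.
    apply: le_trans (h i iIj); apply: ltW; rewrite -subr_gt0; exact: gap.
  by apply: h; rewrite !inE r'j.
Qed.

Lemma settled_col I J k l P : k \in J -> k != l ->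
  (forall i, i \in I -> B i l < B i k) -> settled I (J :\ l)%SET P -> settled I J P.
Proof.
move=> iI ij dom st; suff E : refineB J P = refineB (J :\ l)%SET P.
  by case: st => h1 h2; split; rewrite E.
have [[sP h1 h2] _] := st.
have gap : 0 < gapB B k l P.
  have dom' i : i \in I -> 0 < B i k - B i l by rewrite subr_gt0; apply: dom.
  have [M M0 hM] := exists_min_pos dom'.
  have [[P0 P1] _] := sP.
  apply: lt_le_trans M0 _; rewrite gapBE; apply: weighted_sum_ge => // i /h1.
  by rewrite inE => /andP[+ _]; apply: hM.
have iIj : k \in (J :\ l)%SET by rewrite !inE ij.
apply/finset.setP => r; rewrite [in LHS]inE [in RHS]inE.
apply/andP/andP => -[rI /asboolP h]; split.
- rewrite !inE rI andbT; apply: contraPneq (h k iI) => ->.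
  by rewrite -subr_le0 => /le_lt_trans /(_ gap); rewrite ltxx.
- by apply/asboolP => r'; rewrite !inE => /andP[_]; apply: h.
- by move: rI; rewrite !inE => /andP[].
- apply/asboolP => r' r'I; have [->|r'j] := eqVneq r' l.
    apply: le_trans (h k iIj); apply: ltW; rewrite -subr_gt0; exact: gap.
  by apply: h; rewrite !inE r'j.
Qed.

(** A nonzero gap would force pure replies around the cycle until a contradiction is reached. Hence
    both gaps vanish, and the weights solve linear equations. *)
Lemma spiral_weights (c0 c1 d0 d1 a a' b b' : R) : 0 < c0 -> c1 < 0 -> d0 < 0 -> 0 < d1 ->
  a + a' = 1 -> b + b' = 1 ->
  (b * c0 + (1 - b) * c1 < 0 -> a = 0) -> (0 < b * c0 + (1 - b) * c1 -> a' = 0) ->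
  (a * d0 + (1 - a) * d1 < 0 -> b = 0) -> (0 < a * d0 + (1 - a) * d1 -> b' = 0) ->
  a = d1 / (d1 - d0) /\ b = - c1 / (c0 - c1).
Proof.
move=> c00 c10 d00 d10 sa sb An Ap Bn Bp.
have A0 : b * c0 + (1 - b) * c1 = 0.
  have [h|h|//] := ltgtP (b * c0 + (1 - b) * c1) 0.
    have a0 := An h; rewrite a0 in Bp; have b1 := Bp ltac:(lra).
    by rewrite (_ : b = 1) in h; lra.
  have a1 := Ap h; rewrite (_ : a = 1) in Bn; last lra.
  by rewrite (Bn ltac:(lra)) in h; lra.
have B0 : a * d0 + (1 - a) * d1 = 0.
  have [h|h|//] := ltgtP (a * d0 + (1 - a) * d1) 0.
    by rewrite (Bn h) in A0; lra.
  by have b1 := Bp h; rewrite (_ : b = 1) in A0; lra.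
split; first by rewrite -[LHS](@mulfK _ (d1 - d0)) ?gt_eqF //; [congr (_ / _)|]; lra.
by rewrite -[LHS](@mulfK _ (c0 - c1)) ?gt_eqF //; [congr (_ / _)|]; lra.
Qed.

Section SpiralEquilibrium.
Variables (i j : 'I_m) (k l : 'I_n) (ij : i != j) (kl : k != l).
Hypothesis sg : spiral_signs A B i j k l.
Let c0 := A i k - A j k.
Let c1 := A i l - A j l.
Let d0 := B i k - B i l.
Let d1 := B j k - B j l.
Let lam := d1 / (d1 - d0).
Let mu := - c1 / (c0 - c1).

Definition spiral_equilibrium : profile :=
  (lam *: pureA i + (1 - lam) *: pureA j, mu *: pureB k + (1 - mu) *: pureB l).

Let c0_gt0 : 0 < c0. Proof. by case: sg => h _ _ _; rewrite subr_gt0. Qed.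
Let c1_lt0 : c1 < 0. Proof. by case: sg => _ h _ _; rewrite subr_lt0. Qed.
Let d0_lt0 : d0 < 0. Proof. by case: sg => _ _ h _; rewrite subr_lt0. Qed.
Let d1_gt0 : 0 < d1. Proof. by case: sg => _ _ _ h; rewrite subr_gt0. Qed.

Let lam01 : 0 < lam < 1.
Proof.
move: (d0_lt0) (d1_gt0) => h1 h2; have h : 0 < d1 - d0 by lra.
by rewrite /lam divr_gt0 // ltr_pdivrMr //; lra.
Qed.

Let mu01 : 0 < mu < 1.
Proof.
move: (c1_lt0) (c0_gt0) => h1 h2; have h : 0 < c0 - c1 by lra.
by rewrite /mu divr_gt0 ?ltr_pdivrMr //; lra.
Qed.

Let se1 r : spiral_equilibrium.1 0 r = lam * (r == i)%:R + (1 - lam) * (r == j)%:R.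
Proof. by rewrite !mxE !eqxx. Qed.

Let se2 r : spiral_equilibrium.2 r 0 = mu * (r == k)%:R + (1 - mu) * (r == l)%:R.
Proof. by rewrite !mxE !eqxx !andbT. Qed.

Lemma spiral_equilibrium_supported :
  supported [set i; j]%SET [set k; l]%SET spiral_equilibrium.
Proof.
move: (lam01) (mu01) => l01 m01.
have sums (N : nat) (a b : 'I_N) (u : R) :
    \sum_r (u * (r == a)%:R + (1 - u) * (r == b)%:R) = 1.
  rewrite big_split /= -!mulr_sumr.
  have one (a' : 'I_N) : \sum_r (r == a')%:R = 1 :> R.
    by rewrite (bigD1 a') //= eqxx big1 ?addr0 // => r /negbTE ->.
  by rewrite !one; ring.
split; [split; split|..].
- move=> r; rewrite se1; case: (r == i); case: (r == j) => /=; lra.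
- by under eq_bigr do rewrite se1; rewrite sums.
- move=> r; rewrite se2; case: (r == k); case: (r == l) => /=; lra.
- by under eq_bigr do rewrite se2; rewrite sums.
- move=> r; rewrite se1 !inE; case: (r == i); case: (r == j) => //=.
  by rewrite !mulr0 addr0 eqxx.
- move=> r; rewrite se2 !inE; case: (r == k); case: (r == l) => //=.
  by rewrite !mulr0 addr0 eqxx.
Qed.

Lemma spiral_equilibrium_weights : 0 < spiral_equilibrium.1 0 i < 1 /\
  0 < spiral_equilibrium.2 k 0 < 1.
Proof.
rewrite se1 se2 !eqxx (negbTE ij) (negbTE kl) !mulr0 !addr0 !mulr1.
by split; [exact: lam01|exact: mu01].
Qed.

Lemma spiral_equilibrium_gapA : gapA A i j spiral_equilibrium = 0.
Proof.
rewrite (supported_gapA A kl spiral_equilibrium_supported) se2 eqxx (negbTE kl).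
rewrite mulr1 mulr0 addr0 -/c0 -/c1 /mu.
by move: (c1_lt0) (c0_gt0) => h1 h2; field; rewrite gt_eqF //; lra.
Qed.

Lemma spiral_equilibrium_gapB : gapB B k l spiral_equilibrium = 0.
Proof.
rewrite (supported_gapB B ij spiral_equilibrium_supported) se1 eqxx (negbTE ij).
rewrite mulr1 mulr0 addr0 -/d0 -/d1 /lam.
by move: (d0_lt0) (d1_gt0) => h1 h2; field; rewrite gt_eqF //; lra.
Qed.

Lemma refineA2 P : gapA A i j P = 0 -> refineA [set i; j]%SET P = [set i; j]%SET.
Proof.
move=> /eqP; rewrite subr_eq0 => /eqP E; apply/finset.setP => r.
rewrite [in LHS]inE andb_idr // => ha; apply/asboolP => s.
by move: ha; rewrite !inE => /orP[]/eqP-> /orP[]/eqP->; rewrite ?E.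
Qed.

Lemma refineB2 P : gapB B k l P = 0 -> refineB [set k; l]%SET P = [set k; l]%SET.
Proof.
move=> /eqP; rewrite subr_eq0 => /eqP E; apply/finset.setP => r.
rewrite [in LHS]inE andb_idr // => ha; apply/asboolP => s.
by move: ha; rewrite !inE => /orP[]/eqP-> /orP[]/eqP->; rewrite ?E.
Qed.

Lemma settled_spiral : settled [set i; j]%SET [set k; l]%SET spiral_equilibrium.
Proof.
move: (c0_gt0) (c1_lt0) (d0_lt0) (d1_gt0) => C0 C1 D0 D1.
rewrite /settled (refineA2 spiral_equilibrium_gapA) (refineB2 spiral_equilibrium_gapB).
split; first exact: spiral_equilibrium_supported.
move=> Q [sQ h1 h2].
have sQ' : supported [set i; j]%SET [set k; l]%SET Q.
  split => //; first by move=> r /h1; rewrite inE => /andP[].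
  by move=> r /h2; rewrite inE => /andP[].
have [[[Q1 Q1s] [Q2 Q2s]] s1 s2] := sQ'.
have w1 := supp2_weights ij s1 Q1s; have w2 := supp2_weights kl s2 Q2s.
have gA := supported_gapA A kl sQ'; have gB := supported_gapB B ij sQ'.
rewrite -/c0 -/c1 in gA; rewrite -/d0 -/d1 in gB.
have iI : i \in [set i; j]%SET by rewrite !inE eqxx.
have jI : j \in [set i; j]%SET by rewrite !inE eqxx orbT.
have kJ : k \in [set k; l]%SET by rewrite !inE eqxx.
have lJ : l \in [set k; l]%SET by rewrite !inE eqxx orbT.
have Qi : Q.1 0 i != 0 -> 0 <= gapA A i j Q.
  by move=> /h1; rewrite inE => /andP[_ /asboolP /(_ j jI)]; rewrite subr_ge0.
have Qj : Q.1 0 j != 0 -> gapA A i j Q <= 0.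
  by move=> /h1; rewrite inE => /andP[_ /asboolP /(_ i iI)]; rewrite subr_le0.
have Qk : Q.2 k 0 != 0 -> 0 <= gapB B k l Q.
  by move=> /h2; rewrite inE => /andP[_ /asboolP /(_ l lJ)]; rewrite subr_ge0.
have Ql : Q.2 l 0 != 0 -> gapB B k l Q <= 0.
  by move=> /h2; rewrite inE => /andP[_ /asboolP /(_ k kJ)]; rewrite subr_le0.
have Aneg : gapA A i j Q < 0 -> Q.1 0 i = 0.
  by move=> h; apply/eqP/negPn/negP => /Qi; lra.
have Apos : 0 < gapA A i j Q -> Q.1 0 j = 0.
  by move=> h; apply/eqP/negPn/negP => /Qj; lra.
have Bneg : gapB B k l Q < 0 -> Q.2 k 0 = 0.
  by move=> h; apply/eqP/negPn/negP => /Qk; lra.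
have Bpos : 0 < gapB B k l Q -> Q.2 l 0 = 0.
  by move=> h; apply/eqP/negPn/negP => /Ql; lra.
rewrite gA in Aneg Apos; rewrite gB in Bneg Bpos.
have [lamE muE] := spiral_weights C0 C1 D0 D1 w1 w2 Aneg Apos Bneg Bpos.
rewrite -/lam in lamE; rewrite -/mu in muE.
have [_ e1 e2] := spiral_equilibrium_supported.
have off1 r : r != i -> r != j -> Q.1 0 r = spiral_equilibrium.1 0 r.
  move=> ri rj; rewrite se1 (negbTE ri) (negbTE rj) !mulr0 addr0.
  by apply/eqP/negPn/negP => /s1; rewrite !inE (negbTE ri) (negbTE rj).
have off2 r : r != k -> r != l -> Q.2 r 0 = spiral_equilibrium.2 r 0.
  move=> ri rj; rewrite se2 (negbTE ri) (negbTE rj) !mulr0 addr0.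
  by apply/eqP/negPn/negP => /s2; rewrite !inE (negbTE ri) (negbTE rj).
have ji := ij; rewrite eq_sym in ji; have lk := kl; rewrite eq_sym in lk.
apply: injective_projections; apply/matrixP => a b; rewrite ?(ord1 a) ?(ord1 b).
  have [->|bi] := eqVneq b i; first by rewrite se1 eqxx (negbTE ij) lamE /=; ring.
  have [->|bj] := eqVneq b j; last exact: off1.
  by rewrite se1 eqxx (negbTE ji) -lamE /=; lra.
have [->|bi] := eqVneq a k; first by rewrite se2 eqxx (negbTE kl) muE /=; ring.
have [->|bj] := eqVneq a l; last exact: off2.
by rewrite se2 eqxx (negbTE lk) -muE /=; lra.
Qed.

End SpiralEquilibrium.

Lemma reducible_settled I J : reducible A B I J -> exists P, settled I J P.
Proof.
elim=> {I J} [i k|i j k l ij kl sg|I J i j iI ij dom _ [P IH]|I J k l kJ kl dom _ [P IH]].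
- exists (pureA i, pureB k); apply: settled_pure; rewrite ?inE //.
    by move=> r; rewrite inE => /eqP-> /eqP.
  by move=> r; rewrite inE => /eqP-> /eqP.
- by exists (spiral_equilibrium i j k l); apply: settled_spiral.
- by exists P; apply: (settled_row iI ij dom IH).
- by exists P; apply: (settled_col kJ kl dom IH).
Qed.

Definition bestAset z : {set 'I_m} := [set i | `[< bestA A z.2 i >]]%SET.
Definition bestBset z : {set 'I_n} := [set k | `[< bestB B z.1 k >]]%SET.

Lemma in_bestAset z i : bestA A z.2 i <-> i \in bestAset z.
Proof. by rewrite inE; split => /asboolP. Qed.

Lemma in_bestBset z k : bestB B z.1 k <-> k \in bestBset z.
Proof. by rewrite inE; split => /asboolP. Qed.

Lemma best_sets_bestset z : best_sets A B z (bestAset z) (bestBset z).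
Proof. by split => r; [apply: in_bestAset|apply: in_bestBset]. Qed.

Lemma best_setsE z I J : best_sets A B z I J -> bestAset z = I /\ bestBset z = J.
Proof.
move=> [h1 h2]; split; apply/finset.setP => r; apply/idP/idP.
- by move/in_bestAset/h1.
- by move/h1/in_bestAset.
- by move/in_bestBset/h2.
- by move/h2/in_bestBset.
Qed.

Lemma exists_best (N : nat) (F : 'I_N -> R) (i : 'I_N) :
  exists c, forall r, F r <= F c.
Proof.
exists [arg max_(r > i) F r]%O; case: arg_maxP => // b _ h r.
exact: h.
Qed.

Lemma supported_refine_BR z I J P : best_sets A B z I J ->
  supported (refineA I P) (refineB J P) P -> BRAB A B z P.
Proof.
move=> [h1 h2] [[s1 s2] p1 p2]; split; split => // r.
  by move/p1; rewrite inE => /andP[/h1].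
by move/p2; rewrite inE => /andP[/h2].
Qed.

(** For a short time only strategies that are best at [x] compete. Their gaps vanish at [x], so on
    the ray they are positive multiples of the gaps at [P]. *)
Lemma best_sets_ray x P : simplexAB x -> simplexAB P ->
  exists2 e : R, 0 < e & forall t, 0 < t < e ->
    best_sets A B (ray x P t)
      (refineA (bestAset x) P) (refineB (bestBset x) P).
Proof.
move=> sx sP; have [e e0 he] := best_sets_near (best_sets_bestset x).
exists e => // t /andP[t0 te].
have [cA cB] : confined A B (bestAset x) (bestBset x) (ray x P t).
  apply: he; rewrite -{2}(ray0 x P); apply: le_trans (ray_lipschitz sx sP (lexx 0) (ltW t0)) _.
  by rewrite subr0 ltW.
have e1 : 0 < 1 - expR (- t) by rewrite subr_gt0 -expR0 ltr_expR; lra.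
have rayA i j : i \in bestAset x -> j \in bestAset x ->
    gapA A i j (ray x P t) = (1 - expR (- t)) * gapA A i j P.
  move=> /in_bestAset iI /in_bestAset jI; rewrite (ray_lf _ _ _ (gapA_lf A i j)).
  by rewrite (best_gapA iI jI); ring.
have rayB k l : k \in bestBset x -> l \in bestBset x ->
    gapB B k l (ray x P t) = (1 - expR (- t)) * gapB B k l P.
  move=> /in_bestBset iI /in_bestBset jI; rewrite (ray_lf _ _ _ (gapB_lf B k l)).
  by rewrite (best_gapB iI jI); ring.
split.
- move=> i; rewrite [X in _ <-> is_true X]inE; split.
    move=> bi; have iI := cA i bi; apply/andP; split => //; apply/asboolP => r rI.
    have : 0 <= gapA A i r (ray x P t) by rewrite subr_ge0; apply: bi.
    by rewrite rayA // pmulr_rge0 // subr_ge0.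
  move=> /andP[iI /asboolP h].
  have [b hb] := exists_best (payA A (ray x P t)) i.
  have bI := cA b hb; move=> r; apply: le_trans (hb r) _.
  have : 0 <= gapA A i b (ray x P t).
    by rewrite rayA // pmulr_rge0 // subr_ge0; apply: h.
  by rewrite subr_ge0.
- move=> i; rewrite [X in _ <-> is_true X]inE; split.
    move=> bi; have iI := cB i bi; apply/andP; split => //; apply/asboolP => r rI.
    have : 0 <= gapB B i r (ray x P t) by rewrite subr_ge0; apply: bi.
    by rewrite rayB // pmulr_rge0 // subr_ge0.
  move=> /andP[iI /asboolP h].
  have [b hb] := exists_best (payB B (ray x P t)) i.
  have bI := cB b hb; move=> r; apply: le_trans (hb r) _.
  have : 0 <= gapB B i b (ray x P t).
    by rewrite rayB // pmulr_rge0 // subr_ge0; apply: h.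
  by rewrite subr_ge0.
Qed.

(** [N x] is a settled profile for the current best responses, picked separately at each point; the
    uniqueness clause of [settled] is what makes these choices agree along a ray. A point without a
    settled profile is an equilibrium and stays at rest. *)
Lemma flow_exists :
  (forall x, simplexAB x ->
     (exists P, settled (bestAset x) (bestBset x) P) \/ BRAB A B x x) ->
  exists phi : profile -> R -> profile, is_flow A B phi.
Proof.
move=> hx.
have /choice[N hN] x : exists P,
    ((exists P, settled (bestAset x) (bestBset x) P) ->
      settled (bestAset x) (bestBset x) P) /\
    (~ (exists P, settled (bestAset x) (bestBset x) P) -> P = x).
  have [[P hP]|h] := pselect (exists P, settled (bestAset x) (bestBset x) P).
    by exists P; split => // h; exfalso; apply: h; exists P.
  by exists x; split.
have Ns x : simplexAB x -> simplexAB (N x).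
  move=> sx; have [ex|nex] := pselect (exists P, settled (bestAset x) (bestBset x) P).
    by case: ((hN x).1 ex) => -[].
  by rewrite (hN x).2.
apply: (canonical_flow Ns) => x sx.
have [ex|nex] := pselect (exists P, settled (bestAset x) (bestBset x) P); last first.
  have bx : BRAB A B x x by case: (hx x sx).
  by exists 1 => // t t1; rewrite (hN x).2 // ray_id (hN x).2.
have st := (hN x).1 ex; have [e e0 he] := best_sets_ray sx (Ns x sx).
exists e => // t /andP[t0 te]; move: t0; rewrite le_eqVlt => /orP[/eqP<-|t0].
  rewrite ray0; split => //.
  by apply: supported_refine_BR (best_sets_bestset x) _; case: st.
have bs := he t (introT andP (conj t0 te)).
have st' := settled_refine st.
split; last by apply: (supported_refine_BR bs); case: st'.
have [E1 E2] := best_setsE bs.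
have := (hN (ray x (N x) t)).1; rewrite E1 E2 => h.
(* The profile chosen at the later point is settled for the refined sets, where [N x] is the only
   equilibrium. *)
have [h1 _] : settled (refineA (bestAset x) (N x)) (refineB (bestBset x) (N x))
  (N (ray x (N x) t)) by apply: h; exists (N x).
by case: st => _; apply.
Qed.

(** Off [X] reducibility supplies both closeness of solutions and a target. On [X] a target or an
    equilibrium suffices, as nothing is claimed about an orbit after it has entered [X]. *)
Lemma flow_off X :
  (forall x, simplexAB x -> ~ X x -> reducible A B (bestAset x) (bestBset x)) ->
  (forall x, simplexAB x -> X x ->
     (exists P, settled (bestAset x) (bestBset x) P) \/ BRAB A B x x) ->
  defines_flow_off A B X.
Proof.
move=> nX hX.
have lc x : simplexAB x -> ~ X x -> locally_close A B x.
  by move=> sx /(nX x sx); apply: reducible_locally_close (best_sets_bestset x).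
have [phi hphi] : exists phi : profile -> R -> profile, is_flow A B phi.
  apply: flow_exists => x sx; have [xX|xX] := pselect (X x); first exact: hX.
  by left; apply: reducible_settled; apply: nX.
exists phi; split => //.
- move=> T p sp pX t tT; have sp0 : simplexAB (p 0).
    by apply: (solution_simplex sp); lra.
  have [phi0 phis _] := hphi (p 0) sp0.
  by apply: (solution_unique lc sp (phis T)) => //; rewrite phi0.
- move=> x t sx t0 xX; have [phi0 phis _] := hphi x sx.
  apply/cvgrPdist_lt => e e0.
  have [d d0 hd] := solution_dependence lc (phis t)
    (fun s hs => xX s hs) (ltac:(lra) : 0 < e / 2).
  rewrite near_withinE; apply/nbhs_ballP; exists (Num.min d (e / 2)).
    by rewrite /= lt_min d0; lra.
  move=> [y s] [] /=; rewrite -!ball_normE /= !lt_min => /andP[xyd _] /andP[_ tse] [sy s0].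
  have [psi0 psis _] := hphi y sy.
  have h1 : `|phi y t - phi x t| < e / 2.
    by apply: hd => //; rewrite ?phi0 ?psi0 1?distrC //; lra.
  have h2 : `|phi y t - phi y s| <= `|t - s|.
    have [st|ts] := leP s t.
      by rewrite (ger0_norm (_ : 0 <= t - s)) ?subr_ge0 //;
        apply: (solution_lipschitz (psis t)).
    rewrite distrC [`|t - s|]distrC (ger0_norm (_ : 0 <= s - t)); last lra.
    by apply: (solution_lipschitz (psis s)) => //; apply: ltW.
  have -> : phi x t - phi y s = (phi y t - phi y s) - (phi y t - phi x t).
    by rewrite opprB [RHS]addrC addrA subrK.
  by apply: le_lt_trans (ler_normB _ _) _; lra.
Qed.

Lemma flow_off_extends X z (r : R) : defines_flow_off A B X -> 0 < r ->
  (forall x, simplexAB x -> `|x - z| < r -> ~ X x) -> offZ_flow_extends A B z.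
Proof.
move=> [phi [hphi uni cont]] r0 hX.
(* At unit speed an orbit starting within r / 2 of [z] stays within 3 r / 4 until time r / 4, hence
   away from [X]. *)
exists (r / 4), (r / 2), (fun w : profile * R => phi w.1 w.2); split; [lra|lra|..].
- apply/subspace_continuousP => -[x t] [/= sx xz /andP[t0 tr]].
  have [phi0 phis _] := hphi x sx.
  have h := cont x t sx t0; have {}h := h _.
  apply: cvg_trans (h _).
    by apply: cvg_app; apply: within_subset => // -[y s] [/= sy _ /andP[]].
  move=> s hs; apply: hX; first by apply: (solution_simplex (phis t)); lra.
  have := solution_near (phis t) (_ : `|phi x 0 - z| <= `|x - z|) (_ : 0 <= s <= t).
  by rewrite phi0 => /(_ (lexx _) ltac:(lra)); lra.
- move=> S p Sr sp _ pz t tS; have sp0 : simplexAB (p 0).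
    by apply: (solution_simplex sp); lra.
  apply: (uni S) => // s sS; apply: hX; first by apply: (solution_simplex sp); lra.
  have := solution_near sp (lexx `|p 0 - z|) (_ : 0 <= s <= S).
  by move=> /(_ ltac:(lra)); lra.
Qed.

End Settled.

(** * Discontinuity at saddles *)

Section OffZ.
Context {R : realType} {m n : nat}.
Notation profile := ('rV[R]_m * 'cV[R]_n)%type.
Variables (A B : 'M[R]_(m, n)).
Implicit Types (x y z b P Q : profile) (p q : R -> profile).
Implicit Types (t T S e d : R) (i j : 'I_m) (k l : 'I_n).
Implicit Types (I : {set 'I_m}) (J : {set 'I_n}) (X : set profile).

Lemma simplexA_inhabited (q : 'rV[R]_m) : simplexA q -> exists i : 'I_m, True.
Proof.
move=> [_ q1]; apply: contrapT => h; have := q1; rewrite big1.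
  by move=> /eqP; rewrite eq_sym oner_eq0.
by move=> i _; exfalso; apply: h; exists i.
Qed.

Lemma simplexB_inhabited (q : 'cV[R]_n) : simplexB q -> exists k : 'I_n, True.
Proof.
move=> [_ q1]; apply: contrapT => h; have := q1; rewrite big1.
  by move=> /eqP; rewrite eq_sym oner_eq0.
by move=> i _; exfalso; apply: h; exists i.
Qed.

Lemma exists_bestA z : simplexAB z -> exists i, bestA A z.2 i.
Proof.
move=> [/simplexA_inhabited[i _] _].
by have [b hb] := exists_best (payA A z) i; exists b.
Qed.

Lemma exists_bestB z : simplexAB z -> exists k, bestB B z.1 k.
Proof.
move=> [_ /simplexB_inhabited[i _]].
by have [b hb] := exists_best (payB B z) i; exists b.
Qed.

Lemma best_sets_offZ z : simplexAB z -> ~ Z A B z ->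
  exists i k, best_sets A B z [set i]%SET [set k]%SET.
Proof.
move=> sz nZ; have [i hi] := exists_bestA sz; have [k hk] := exists_bestB sz.
have [s1 s2] := sz; exists i, k; split => r; rewrite inE.
- split => [hr|/eqP-> //]; apply/negPn/negP => ri; apply: nZ; left; split => //.
  by exists r, i; split.
- split => [hr|/eqP-> //]; apply/negPn/negP => ri; apply: nZ; right; split => //.
  by exists r, k; split.
Qed.

Lemma confined_pure_notZ i k z : confined A B [set i]%SET [set k]%SET z -> ~ Z A B z.
Proof.
move=> [cA cB] [[_ [r [s [rs [_ hr hs]]]]]|[[r [s [rs [_ hr hs]]]] _]].
  by move: rs; have := cA _ hr; have := cA _ hs; rewrite !inE => /eqP-> /eqP->; rewrite eqxx.
by move: rs; have := cB _ hr; have := cB _ hs; rewrite !inE => /eqP-> /eqP->; rewrite eqxx.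
Qed.

Lemma confined_pure_BR i k z : simplexAB z -> confined A B [set i]%SET [set k]%SET z ->
  BRAB A B z (pureA i, pureB k).
Proof.
move=> sz [cA cB]; have [r hr] := exists_bestA sz; have [s hs] := exists_bestB sz.
have := cA r hr; have := cB s hs; rewrite !inE => /eqP sk /eqP ri; subst r s.
have [[p1 p2] h1 h2] := @pure_supported R m n i k.
by split; split => // r; [move/h1|move/h2]; rewrite inE => /eqP->.
Qed.

Lemma pure_locally_close x : simplexAB x -> ~ Z A B x -> locally_close A B x.
Proof.
move=> sx nZ; have [i [k bs]] := best_sets_offZ sx nZ.
exact: reducible_locally_close bs (reducible_pure _ _ _ _).
Qed.

Lemma flow_unique_offZ : flow_unique_off_Z A B.
Proof.
move=> x sx nZ; split; last first.
  move=> T p q sp sq p0 q0 hZ; apply: (solution_unique pure_locally_close sp sq hZ).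
  by rewrite p0.
have [i [k bs]] := best_sets_offZ sx nZ; have [r r0 hr] := best_sets_near bs.
have sP := @pure_simplex R m n i k.
have conf t : 0 <= t <= r -> confined A B [set i]%SET [set k]%SET
    (ray x (pureA i, pureB k) t).
  move=> /andP[t0 tr]; apply: hr; rewrite -{2}(ray0 x (pureA i, pureB k)).
  by apply: le_trans (ray_lipschitz sx sP (lexx 0) t0) _; rewrite subr0.
exists r, (ray x (pureA i, pureB k)); split => //.
- apply: ray_solution => // t tr; apply: confined_pure_BR; last by apply: conf; lra.
  by apply: ray_simplex => //; lra.
- exact: ray0.
- by move=> t tr; apply: confined_pure_notZ (conf t tr).
Qed.

End OffZ.

Section TwoRays.
Context {R : realType} {m n : nat}.
Notation profile := ('rV[R]_m * 'cV[R]_n)%type.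
Variables (A B : 'M[R]_(m, n)).
Implicit Types (x y z b P Q G : profile) (p q : R -> profile).
Implicit Types (t T S e d : R) (i j : 'I_m) (k l : 'I_n).

(** The duration [T] is independent of [e], so that rays towards different targets separate by a
    fixed amount however close to [z] they start. *)
Definition rays_near z P T := forall e, 0 < e -> exists x,
  [/\ simplexAB x, `|x - z| < e, ~ Z A B x & fp_solution A B T (ray x P)].

Lemma ray_dist x z P t : 0 <= t -> `|ray x P t - ray z P t| <= `|x - z|.
Proof.
move=> t0; have -> : ray x P t - ray z P t = expR (- t) *: (x - z).
  by apply: injective_projections; apply/matrixP => a c; rewrite !mxE /=; ring.
rewrite normrZ ger0_norm ?expR_ge0 // ler_piMl // -expR0 ler_expR; lra.
Qed.

(** As the initial points tend to [z], the rays at time [S] tend to [ray z W S], and for positive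
    [S] this point determines [W]. *)
Lemma common_limit_target z P Q S G : 0 < S ->
  (forall W, W = P \/ W = Q -> forall e, 0 < e -> exists x,
     `|x - z| < e /\ `|ray x W S - G| < e) -> P = Q.
Proof.
move=> S0 h.
have E W : W = P \/ W = Q -> ray z W S = G.
  move=> hW; apply/eqP; rewrite -subr_eq0 -normr_le0; apply: eps_ler => e e0.
  have [x [xz xG]] := h W hW (e / 2) ltac:(lra).
  have -> : ray z W S - G = (ray x W S - G) - (ray x W S - ray z W S).
    by rewrite opprB [RHS]addrC addrA subrK.
  apply: le_trans (ler_normB _ _) _.
  by have := ray_dist x z W (ltW S0); lra.
have E1 := E P (or_introl erefl); have E2 := E Q (or_intror erefl).
have : (1 - expR (- S)) *: (P - Q) = 0.
  rewrite -(subrr G) -{1}E1 -E2.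
  by apply: injective_projections; apply/matrixP => a c; rewrite !mxE /=; ring.
move/eqP; rewrite scaler_eq0 => /orP[|]; last by rewrite subr_eq0 => /eqP.
have : expR (- S) < 1 by rewrite -expR0 ltr_expR; lra.
by move=> h1 /eqP h2; exfalso; lra.
Qed.

Lemma two_rays_not_converges z P Q T : 0 < T -> P <> Q ->
  rays_near z P T -> rays_near z Q T -> ~ offZ_flow_converges A B z.
Proof.
move=> T0 PQ hP hQ [T' [gam [T'0 h]]]; apply: PQ.
pose S := Num.min T T'.
have S0 : 0 < S by rewrite lt_min T0.
have ST : S <= T by rewrite ge_min lexx.
have ST' : S <= T' by rewrite ge_min lexx orbT.
apply: (@common_limit_target z P Q S (gam S) S0) => W hW e e0.
have [d d0 hd] := h e e0.
have hW' : rays_near z W T by case: hW => ->.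
have [x [sx xz nZ sol]] := hW' (Num.min d e) ltac:(by rewrite lt_min d0).
move: xz; rewrite lt_min => /andP[xd xe]; exists x; split => //.
apply: (hd S (ray x W) ST' (fp_solution_restrict sol ST)); rewrite ?ray0 //.
by rewrite lexx ltW.
Qed.

(** Since [Phi] would be continuous on a whole neighbourhood, it is enough that points with two
    diverging rays accumulate at [z]. This reaches points with more than two best responses. *)
Lemma two_rays_not_extends z P Q : simplexAB z -> P <> Q ->
  (forall e, 0 < e -> exists2 x, `|x - z| < e &
     simplexAB x /\ exists2 T, 0 < T & rays_near x P T /\ rays_near x Q T) ->
  ~ offZ_flow_extends A B z.
Proof.
move=> sz PQ hz [T' [d [Phi [T'0 d0 cont h]]]].
have [x xz [sx [T T0 [hP hQ]]]] := hz d d0.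
apply: PQ; pose S := Num.min T T'.
have S0 : 0 < S by rewrite lt_min T0.
have ST : S <= T by rewrite ge_min lexx.
have ST' : S <= T' by rewrite ge_min lexx orbT.
apply: (@common_limit_target x P Q S (Phi (x, S)) S0) => W hW e e0.
have Dx : [set w : profile * R | [/\ simplexAB w.1, `|w.1 - z| < d & 0 <= w.2 <= T']] (x, S).
  by split => //=; rewrite ltW.
have /subspace_continuousP/(_ _ Dx)/cvgrPdist_lt/(_ e e0) := cont.
rewrite near_withinE => /nbhs_ballP[r /= r0 hr].
have hW' : rays_near x W T by case: hW => ->.
pose e' := Num.min (Num.min r e) (d - `|x - z|).
have e'0 : 0 < e' by rewrite !lt_min r0 e0; lra.
have [y [sy yx nZ sol]] := hW' e' e'0.
move: yx; rewrite /e' !lt_min => /andP[/andP[yr ye] yd]; exists y; split => //.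
have yz : `|y - z| < d.
  have -> : y - z = (y - x) + (x - z) by rewrite addrA subrK.
  by apply: le_lt_trans (ler_normD _ _) _; lra.
rewrite (h S _ ST' (fp_solution_restrict sol ST)) ?ray0 //; last by rewrite lexx ltW.
rewrite distrC; apply: (hr (y, S)).
  split => /=; last exact: ballxx.
  by rewrite -ball_normE /= distrC.
by split => //=; rewrite ltW.
Qed.

Lemma two_rays_not_unique z P Q T : 0 < T -> P <> Q ->
  fp_solution A B T (ray z P) -> fp_solution A B T (ray z Q) -> ~ unique_at A B z.
Proof.
move=> T0 PQ sP sQ [T' T'0 h]; apply: PQ; pose S := Num.min T T'.
have S0 : 0 < S by rewrite lt_min T0.
have ST : S <= T by rewrite ge_min lexx.
have ST' : S <= T' by rewrite ge_min lexx orbT.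
apply: (@common_limit_target z P Q S (ray z P S) S0) => W hW e e0.
exists z; rewrite subrr normr0; split => //.
have -> : ray z W S = ray z P S.
  case: hW => -> //; have := h S (ray z P) (ray z Q) ST'.
  move=> /(_ (fp_solution_restrict sP ST) (fp_solution_restrict sQ ST)).
  by rewrite !ray0 => /(_ erefl erefl S) -> //; rewrite lexx ltW.
by rewrite subrr normr0.
Qed.

(* The last two hypotheses say that a gap that vanishes at x is strictly
   increasing along the ray, so that both gaps are positive after time 0. *)
Lemma toward_pure x z i j k l (r : R) : simplexAB x ->
  (forall y, `|y - z| <= r -> confined A B [set i; j]%SET [set k; l]%SET y) ->
  i != j -> k != l -> A j k <= A i k -> B i l <= B i k ->
  0 <= gapA A i j x -> 0 <= gapB B k l x ->
  0 < (A i k - A j k) + gapA A i j x -> 0 < (B i k - B i l) + gapB B k l x ->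
  forall T, `|x - z| + T <= r -> fp_solution A B T (ray x (pureA i, pureB k)).
Proof.
move=> sx hr ij kl aik bik gx hx gx' hx' T xT.
have sP := @pure_simplex R m n i k; apply: ray_solution => // t tT.
have e0 : 0 < expR (- t) by exact: expR_gt0.
have e1 : 0 < 1 - expR (- t) by rewrite subr_gt0 -expR0 ltr_expR; lra.
have [cA cB] : confined A B [set i; j]%SET [set k; l]%SET (ray x (pureA i, pureB k) t).
  apply: hr; have h := ray_lipschitz sx sP (lexx 0) (ltac:(lra) : 0 <= t).
  rewrite ray0 subr0 in h.
  set y := ray _ _ _ in h *; have -> : y - z = (y - x) + (x - z) by rewrite addrA subrK.
  by apply: le_trans (ler_normD _ _) _; lra.
have gA : 0 < gapA A i j (ray x (pureA i, pureB k) t).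
  rewrite (ray_lf _ _ _ (gapA_lf A i j)) {1 3}/gapA !payA_pure.
  have k1 : 0 <= (1 - expR (- t)) * (A i k - A j k) by apply: mulr_ge0; lra.
  have k2 : 0 <= expR (- t) * gapA A i j x by apply: mulr_ge0; lra.
  have [a0|a0] := ltP 0 (gapA A i j x).
    have : 0 < expR (- t) * gapA A i j x by rewrite mulr_gt0.
    lra.
  have : 0 < (1 - expR (- t)) * (A i k - A j k) by rewrite mulr_gt0 //; lra.
  lra.
have gB : 0 < gapB B k l (ray x (pureA i, pureB k) t).
  rewrite (ray_lf _ _ _ (gapB_lf B k l)) {1 3}/gapB !payB_pure.
  have k1 : 0 <= (1 - expR (- t)) * (B i k - B i l) by apply: mulr_ge0; lra.
  have k2 : 0 <= expR (- t) * gapB B k l x by apply: mulr_ge0; lra.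
  have [a0|a0] := ltP 0 (gapB B k l x).
    have : 0 < expR (- t) * gapB B k l x by rewrite mulr_gt0.
    lra.
  have : 0 < (1 - expR (- t)) * (B i k - B i l) by rewrite mulr_gt0 //; lra.
  lra.
apply: confined_pure_BR; first by apply: ray_simplex => //; lra.
split=> [s hs|s hs].
  have := cA s hs; rewrite !inE => /orP[//|/eqP sj]; subst s.
  by exfalso; apply: (gapA_gt0_notbest gA hs).
have := cB s hs; rewrite !inE => /orP[//|/eqP sj]; subst s.
by exfalso; apply: (gapB_gt0_notbest gB hs).
Qed.

Lemma codim2_near z i j k l : codim2_at A B i j k l z ->
  exists2 r : R, 0 < r &
    forall y, `|y - z| <= r -> confined A B [set i; j]%SET [set k; l]%SET y.
Proof.
move=> [_ _ _ hA hB]; apply: best_sets_near; split => r; rewrite !inE.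
  by rewrite hA; split => [[]->|/orP[]/eqP->]; rewrite ?eqxx ?orbT //; [left|right].
by rewrite hB; split => [[]->|/orP[]/eqP->]; rewrite ?eqxx ?orbT //; [left|right].
Qed.

Lemma codim2_gap z i j k l : codim2_at A B i j k l z ->
  gapA A i j z = 0 /\ gapB B k l z = 0.
Proof.
move=> [_ _ _ hA hB]; split.
  by apply: best_gapA; apply/hA; [left|right].
by apply: best_gapB; apply/hB; [left|right].
Qed.

Lemma codim2_rays_near z i j k l : codim2_at A B i j k l z ->
  A j k <= A i k -> B i l <= B i k ->
  (exists s, A j s < A i s) -> (exists s, B s l < B s k) ->
  exists2 T, 0 < T & rays_near z (pureA i, pureB k) T.
Proof.
move=> cz aik bik [s hs] [s' hs']; have [r r0 hr] := codim2_near cz.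
have [gA gB] := codim2_gap cz; have [sz ij kl _ _] := cz.
exists (r / 2); first lra.
move=> e e0; pose a := Num.min (Num.min (e / 2) (r / 2)) 1.
have a0 : 0 < a by rewrite !lt_min; lra.
have ae : a <= e / 2 by rewrite !ge_min lexx.
have ar : a <= r / 2 by rewrite !ge_min lexx orbT.
have a1 : a <= 1 by rewrite !ge_min lexx orbT.
have sw := @pure_simplex R m n s' s.
(* Both gaps vanish at [z] and are positive at the pure profile (s', s), hence positive at [x]; the
   weak inequalities then suffice to keep them so along the ray. *)
pose x := z + a *: ((pureA s', pureB s) - z).
have sx : simplexAB x by apply: simplexAB_convex => //; lra.
have xz : `|x - z| <= a.
  rewrite /x addrAC subrr add0r normrZ (ger0_norm (ltW a0)).
  by apply: ler_piMr; [exact: ltW|exact: simplexAB_dist].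
have gxA : 0 < gapA A i j x.
  rewrite /x (lfD (gapA_lf A i j)) (lfZ (gapA_lf A i j)) (lfB (gapA_lf A i j)) gA.
  by rewrite /gapA !payA_pure add0r subr0 mulr_gt0 // subr_gt0.
have gxB : 0 < gapB B k l x.
  rewrite /x (lfD (gapB_lf B k l)) (lfZ (gapB_lf B k l)) (lfB (gapB_lf B k l)) gB.
  by rewrite /gapB !payB_pure add0r subr0 mulr_gt0 // subr_gt0.
exists x; split => //; first lra.
  have [cA cB] := hr x ltac:(lra).
  apply: (@confined_pure_notZ _ _ _ A B i k); split=> [u hu|u hu].
    have := cA u hu; rewrite !inE => /orP[//|/eqP uj]; subst u.
    by exfalso; apply: (gapA_gt0_notbest gxA hu).
  have := cB u hu; rewrite !inE => /orP[//|/eqP uj]; subst u.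
  by exfalso; apply: (gapB_gt0_notbest gxB hu).
by apply: (toward_pure sx hr) => //; lra.
Qed.

(** A saddle whose 2 x 2 payoffs may tie, as happens for [beta = 0]. The last two clauses, in which
    [s] may lie outside the 2 x 2 game, provide points near [z] where each gap has a prescribed
    sign. *)
Definition weak_saddle_signs i j k l :=
  [/\ A j k <= A i k /\ A i l <= A j l, B i l <= B i k /\ B j k <= B j l,
      (exists s, A j s < A i s) /\ (exists s, A i s < A j s) &
      (exists s, B s l < B s k) /\ (exists s, B s k < B s l)].

Lemma codim2_swap z i j k l : codim2_at A B i j k l z -> codim2_at A B j i l k z.
Proof.
move=> [sz ij kl hA hB]; split => //; try by rewrite eq_sym.
  by move=> r; rewrite hA; split=> -[]; [right|left|right|left].
by move=> r; rewrite hB; split=> -[]; [right|left|right|left].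
Qed.

Lemma pure_neq i j k l : i != j -> (pureA i, pureB k) <> (pureA j, pureB l) :> profile.
Proof.
move=> ij [/rowP/(_ i)]; rewrite !mxE !eqxx (negbTE ij) /= => /eqP.
by rewrite oner_eq0.
Qed.

Lemma weak_saddle_rays z i j k l : codim2_at A B i j k l z ->
  weak_saddle_signs i j k l -> exists2 T, 0 < T &
    rays_near z (pureA i, pureB k) T /\ rays_near z (pureA j, pureB l) T.
Proof.
move=> cz [[a1 a2] [b1 b2] [e1 e2] [f1 f2]].
have [T1 T10 h1] := codim2_rays_near cz a1 b1 e1 f1.
have [T2 T20 h2] := codim2_rays_near (codim2_swap cz) a2 b2 e2 f2.
exists (Num.min T1 T2); first by rewrite lt_min T10.
split=> e e0.
  have [x [? ? ? sol]] := h1 e e0; exists x; split => //.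
  by apply: fp_solution_restrict sol _; rewrite ge_min lexx.
have [x [? ? ? sol]] := h2 e e0; exists x; split => //.
by apply: fp_solution_restrict sol _; rewrite ge_min lexx orbT.
Qed.

Lemma weak_saddle_not_converges z i j k l : codim2_at A B i j k l z ->
  weak_saddle_signs i j k l -> ~ offZ_flow_converges A B z.
Proof.
move=> cz ws; have [T T0 [h1 h2]] := weak_saddle_rays cz ws.
have [_ ij _ _ _] := cz.
exact: (two_rays_not_converges T0 (pure_neq ij) h1 h2).
Qed.

Definition saddle_signs i j k l :=
  [/\ A j k < A i k, A i l < A j l, B i l < B i k & B j k < B j l].

Lemma saddle_signs_weak i j k l : saddle_signs i j k l -> weak_saddle_signs i j k l.
Proof.
move=> [h1 h2 h3 h4]; split; split; try exact: ltW.
- by exists k.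
- by exists l.
- by exists i.
- by exists j.
Qed.

Lemma saddle_not_unique z i j k l : codim2_at A B i j k l z ->
  saddle_signs i j k l -> ~ unique_at A B z.
Proof.
move=> cz [h1 h2 h3 h4]; have [sz ij kl _ _] := cz.
have [r r0 hr] := codim2_near cz; have [gA gB] := codim2_gap cz.
have [r' r'0 hr'] := codim2_near (codim2_swap cz).
have [gA' gB'] := codim2_gap (codim2_swap cz).
pose T := Num.min r r'; have T0 : 0 < T by rewrite lt_min r0.
have Tr : T <= r by rewrite ge_min lexx.
have Tr' : T <= r' by rewrite ge_min lexx orbT.
apply: (two_rays_not_unique T0 (@pure_neq i j k l ij)).
  by apply: (toward_pure sz hr) => //; rewrite ?gA ?gB ?subrr ?normr0; lra.
apply: (toward_pure sz hr'); rewrite ?gA' ?gB' ?subrr ?normr0; try lra.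
  by rewrite eq_sym.
by rewrite eq_sym.
Qed.

End TwoRays.

(** * Two by two games *)

Section Winding.
Context {R : realType}.
Implicit Types (s t a b : R).

Lemma exists_angle a b : exists2 th : R,
  a = Num.sqrt (a ^+ 2 + b ^+ 2) * cos th & b = Num.sqrt (a ^+ 2 + b ^+ 2) * sin th.
Proof.
set r := Num.sqrt (a ^+ 2 + b ^+ 2).
have r2 : r ^+ 2 = a ^+ 2 + b ^+ 2 by rewrite sqr_sqrtr // addr_ge0 ?sqr_ge0.
have r0 : 0 <= r by exact: sqrtr_ge0.
have [rz|rnz] := eqVneq r 0.
  exists 0; rewrite rz mul0r; move: r2; rewrite rz; nra.
have rpos : 0 < r by rewrite lt_neqAle eq_sym rnz.
have ar : -1 <= a / r <= 1.
  by rewrite ler_pdivlMr // ler_pdivrMr // mulN1r mul1r; apply/andP; split; nra.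
have sE : sin (acos (a / r)) = `|b| / r.
  rewrite sin_acos //; have -> : 1 - (a / r) ^+ 2 = (`|b| / r) ^+ 2.
    rewrite !expr_div_n real_normK ?num_real //.
    by rewrite -[1](@divff _ (r ^+ 2)) ?expf_neq0 // -mulrBl r2 addrC addKr.
  by rewrite sqrtr_sqr ger0_norm // divr_ge0.
have cE : r * (a / r) = a by rewrite mulrC divfK.
have [b0|b0] := leP 0 b.
  exists (acos (a / r)); first by rewrite acosK // cE.
  by rewrite sE mulrC divfK // ger0_norm.
exists (- acos (a / r)); first by rewrite cosN acosK // cE.
by rewrite sinN sE mulrN mulrC divfK // ltr0_norm // opprK.
Qed.

Variables (f g : R -> R) (K r M kap h : R).
Hypotheses (K_gt0 : 0 < K) (r_gt0 : 0 < r) (kap_gt0 : 0 < kap) (h_gt0 : 0 < h).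
Hypothesis f_lip : forall s t, `|f t - f s| <= K * `|t - s|.
Hypothesis g_lip : forall s t, `|g t - g s| <= K * `|t - s|.
Hypothesis lower : forall t, r <= f t ^+ 2 + g t ^+ 2.
Hypothesis upper : forall t, f t ^+ 2 + g t ^+ 2 <= M.
Hypothesis cross_growth : forall s t, 0 <= s -> s <= t -> t <= s + h ->
  kap * (t - s) <= f s * g t - g s * f t.

Let dot s t := f s * f t + g s * g t.
Let cross s t := f s * g t - g s * f t.
(** Over a step of this length each of the two products in the change of [dot] is at most r / 4, so
    [dot] stays positive and the curve turns by less than a right angle. *)
Let eta := Num.min h (r / (4 * K * (M + 1))).

Let M_ge : r <= M. Proof. exact: le_trans (lower 0) (upper 0). Qed.

Let eta_gt0 : 0 < eta.
Proof.
move: (M_ge) (r_gt0) (K_gt0) => h1 h2 h3.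
by rewrite lt_min h_gt0 divr_gt0 // !mulr_gt0 //; lra.
Qed.

Let dot_gt0 s t : `|t - s| <= eta -> 0 < dot s t.
Proof.
move=> st; move: (M_ge) (r_gt0) (K_gt0) => h1 h2 h3.
have e2 : K * `|t - s| <= r / (4 * (M + 1)).
  have : K * `|t - s| <= K * (r / (4 * K * (M + 1))).
    by rewrite ler_pM2l //; apply: le_trans st _; rewrite ge_min lexx orbT.
  move=> h4; apply: le_trans h4 _; rewrite le_eqVlt; apply/orP; left; apply/eqP.
  by field; rewrite !gt_eqF //; lra.
have bnd x : `|f x| <= M + 1 /\ `|g x| <= M + 1.
  have := upper x; rewrite !ler_norml; have := sqr_ge0 (f x); have := sqr_ge0 (g x).
  by move=> g0 f0 u; split; apply/andP; split; nra.
have [bf bg] := bnd s.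
have E : dot s t = (f s ^+ 2 + g s ^+ 2) + f s * (f t - f s) + g s * (g t - g s).
  by rewrite /dot; ring.
have k1 : `|f s * (f t - f s)| <= (M + 1) * (r / (4 * (M + 1))).
  by rewrite normrM; apply: ler_pM => //; apply: le_trans (f_lip s t) e2.
have k2 : `|g s * (g t - g s)| <= (M + 1) * (r / (4 * (M + 1))).
  by rewrite normrM; apply: ler_pM => //; apply: le_trans (g_lip s t) e2.
have E2 : (M + 1) * (r / (4 * (M + 1))) = r / 4.
  by field; rewrite gt_eqF //; lra.
rewrite E2 in k1 k2; move: k1 k2; rewrite !ler_norml => /andP[k1 _] /andP[k2 _].
have := lower s; rewrite E; lra.
Qed.

Let ang s t := atan (cross s t / dot s t).
Let rho t := Num.sqrt (f t ^+ 2 + g t ^+ 2).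

Let rho_gt0 t : 0 < rho t.
Proof. by rewrite sqrtr_gt0; apply: lt_le_trans r_gt0 (lower t). Qed.

Let rho2 t : rho t ^+ 2 = f t ^+ 2 + g t ^+ 2.
Proof. by rewrite sqr_sqrtr // addr_ge0 ?sqr_ge0. Qed.

Let is_lift th t := f t = rho t * cos th /\ g t = rho t * sin th.

(** By the Lagrange identity, the squares of [dot] and [cross] add up to that of [rho s * rho t].
    Hence the cosine and sine of [ang s t] are [dot] and [cross] divided by this product, and
    addition formulas conclude. *)
Let lift_step th s t : `|t - s| <= eta -> is_lift th s -> is_lift (th + ang s t) t.
Proof.
move=> st [fs gs]; have d0 := dot_gt0 st.
set c := cos (ang s t); set S := sin (ang s t).
have c0 : 0 < c.
  by rewrite /c /ang cos_atan invr_gt0 sqrtr_gt0 ltr_pwDl // sqr_ge0.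
have Sc : S * dot s t = cross s t * c.
  have : tan (ang s t) = cross s t / dot s t by rewrite /ang atanK.
  have cn : c != 0 by rewrite gt_eqF.
  have dn : dot s t != 0 by rewrite gt_eqF.
  by rewrite /tan -/c -/S => /eqP; rewrite eqr_div // => /eqP.
have cS : c ^+ 2 + S ^+ 2 = 1 by rewrite cos2Dsin2.
have lag : dot s t ^+ 2 + cross s t ^+ 2 = (rho s * rho t) ^+ 2.
  by rewrite exprMn !rho2 /dot /cross; ring.
have rr : 0 < rho s * rho t by rewrite mulr_gt0.
have hc : c * (rho s * rho t) = dot s t.
  apply/eqP; rewrite -(@eqrXn2 _ 2) //; [|exact/ltW/mulr_gt0|exact: ltW].
  rewrite exprMn -lag.
  have -> : c ^+ 2 * (dot s t ^+ 2 + cross s t ^+ 2) =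
     c ^+ 2 * dot s t ^+ 2 + (cross s t * c) ^+ 2 by ring.
  by rewrite -Sc exprMn -mulrDl cS mul1r.
have hS : S * (rho s * rho t) = cross s t.
  apply: (mulIf (x := c)); first by rewrite gt_eqF.
  by rewrite -Sc mulrAC -mulrA hc.
have r2 : rho s ^+ 2 != 0 by rewrite expf_neq0 // gt_eqF.
rewrite /is_lift cosD sinD -/c -/S; split; apply: (mulfI r2).
  have -> : rho s ^+ 2 * (rho t * (cos th * c - sin th * S)) =
    (rho s * cos th) * (c * (rho s * rho t)) -
    (rho s * sin th) * (S * (rho s * rho t)) by ring.
  by rewrite -fs -gs hc hS rho2 /dot /cross; ring.
have -> : rho s ^+ 2 * (rho t * (sin th * c + cos th * S)) =
  (rho s * sin th) * (c * (rho s * rho t)) +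
  (rho s * cos th) * (S * (rho s * rho t)) by ring.
by rewrite -fs -gs hc hS rho2 /dot /cross; ring.
Qed.

(** Partition points stopped at [t]. Steps beyond [t] are trivial, so a sum of step angles is
    continuous in [t] and no longer depends on the number of steps once they cover [0, t]. *)
Let node (k : nat) t := Num.min (k%:R * eta) t.

Let node_step k t : 0 <= node k.+1 t - node k t <= eta.
Proof.
rewrite /node; have -> : k.+1%:R * eta = k%:R * eta + eta by rewrite -natr1; ring.
move: (eta_gt0) => e0; have [h1|h1] := leP (k%:R * eta + eta) t.
  by rewrite (min_l (_ : k%:R * eta <= t)); lra.
by have [h2|h2] := leP (k%:R * eta) t; lra.
Qed.

Let lift (th : R) (N : nat) t := th + \sum_(k < N) ang (node k t) (node k.+1 t).

Let angtt t : ang t t = 0.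
Proof. by rewrite /ang /cross [g t * f t]mulrC subrr mul0r atan0. Qed.

Let lift_stable th N N' t : (N <= N')%N -> t <= N%:R * eta ->
  lift th N' t = lift th N t.
Proof.
move=> /subnKC <- tN; elim: (N' - N)%N => [|d IH]; first by rewrite addn0.
rewrite addnS -[RHS]IH /lift big_ord_recr /= addrA -[RHS]addr0; congr (_ + _).
have big (k : nat) : (N <= k)%N -> node k t = t.
  move=> Nk; rewrite /node min_r //; apply: le_trans tN _.
  by rewrite ler_pM2r // ler_nat.
by rewrite !big ?angtt // ?leqW // leq_addr.
Qed.

Let lift_is_lift th N t : is_lift th 0 -> 0 <= t -> t <= N%:R * eta ->
  is_lift (lift th N t) t.
Proof.
move=> th0; elim: N t => [|N IH] t t0 tN.
  have -> : t = 0 by apply/le_anti; rewrite t0 andbT -(mul0r eta).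
  by rewrite /lift big_ord0 addr0.
have [tN'|Nt] := leP t (N%:R * eta).
  by rewrite (@lift_stable th N) //; apply: IH.
have n0 : 0 <= N%:R * eta by rewrite mulr_ge0 // ltW.
have E : lift th N.+1 t = lift th N (N%:R * eta) + ang (N%:R * eta) t.
  rewrite /lift big_ord_recr /= addrA; congr (_ + _).
    congr (_ + _); apply: eq_bigr => k _; congr ang; rewrite /node !min_l //.
    - by rewrite ler_pM2r // ler_nat ltnW.
    - by apply: le_trans (ltW Nt); rewrite ler_pM2r // ler_nat ltnW.
    - by rewrite ler_pM2r // ler_nat.
    - by apply: le_trans (ltW Nt); rewrite ler_pM2r // ler_nat.
  by rewrite /node min_l ?min_r // ltW.
rewrite E; apply: lift_step; last by apply: IH.
by move: tN; rewrite -natr1 mulrDl mul1r ger0_norm; lra.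
Qed.

Let lip_continuous (u : R -> R) : (forall s t, `|u t - u s| <= K * `|t - s|) ->
  continuous u.
Proof.
move=> lu x; apply/cvgrPdist_lt => e e0; apply/nbhs_ballP.
exists (e / K); first by rewrite /= divr_gt0.
move=> y; rewrite /ball /= => xy; apply: le_lt_trans (lu _ _) _.
by rewrite mulrC -ltr_pdivlMr.
Qed.

Let node_continuous k : continuous (node k).
Proof.
move=> x; apply/cvgrPdist_lt => e e0; apply/nbhs_ballP; exists e => // y.
rewrite /ball /= /node => xy; apply: le_lt_trans xy.
rewrite !ler_norml /Num.min; have := ler_norm (x - y); have := ler_norm (- (x - y)).
rewrite normrN; case: ltP => h1; case: ltP => h2; lra.
Qed.

Let ang_continuous k : continuous (fun t => ang (node k t) (node k.+1 t)).
Proof.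
have cf := lip_continuous f_lip; have cg := lip_continuous g_lip.
have fk j : continuous (f \o node j).
  by move=> y; apply: continuous_comp; [exact: node_continuous|exact: cf].
have gk j : continuous (g \o node j).
  by move=> y; apply: continuous_comp; [exact: node_continuous|exact: cg].
move=> x; have d0 : 0 < dot (node k x) (node k.+1 x).
  apply: dot_gt0; have /andP[h1 h2] := node_step k x.
  by rewrite ger0_norm.
have cd : dot (node k t) (node k.+1 t) @[t --> x] --> dot (node k x) (node k.+1 x).
  by apply: cvgD; apply: cvgM; [exact: fk|exact: fk|exact: gk|exact: gk].
have cc : cross (node k t) (node k.+1 t) @[t --> x] --> cross (node k x) (node k.+1 x).
  by apply: cvgB; apply: cvgM; [exact: fk|exact: gk|exact: gk|exact: fk].
apply: (@continuous_comp _ _ _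
  (fun t => cross (node k t) (node k.+1 t) / dot (node k t) (node k.+1 t)) (@atan R));
  last exact: continuous_atan.
apply: cvgM; first exact: cc.
by apply: cvgV; [rewrite gt_eqF|exact: cd].
Qed.

Let lift_continuous th N : continuous (lift th N).
Proof.
elim: N => [|N IH] x.
  rewrite (_ : lift th 0 = fun=> th); first exact: cvg_cst.
  by apply/funext => t; rewrite /lift big_ord0 addr0.
rewrite (_ : lift th N.+1 = fun t => lift th N t + ang (node N t) (node N.+1 t)).
  by apply: cvgD; [apply: IH|apply: ang_continuous].
by apply/funext => t; rewrite /lift big_ord_recr /= addrA.
Qed.

Let ang_ge0 k t : 0 <= t -> 0 <= ang (node k t) (node k.+1 t).
Proof.
move=> t0; rewrite /ang -(atan0 R); apply: le_atan.
have /andP[h1 h2] := node_step k t.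
have nk : 0 <= node k t.
  by rewrite /node le_min t0 andbT mulr_ge0 // ltW.
apply: divr_ge0; last by apply/ltW/dot_gt0; rewrite ger0_norm.
have : 0 <= kap * (node k.+1 t - node k t) by rewrite mulr_ge0 // ltW.
move=> /le_trans; apply; apply: cross_growth => //; first lra.
have : eta <= h by rewrite ge_min lexx.
lra.
Qed.

(** Least angle of a full step: there [cross] is at least [kap * eta] and [dot] at most
    [2 * (M + 1)]. *)
Let step_angle := atan (kap * eta / (2 * (M + 1))).

Let step_angle_gt0 : 0 < step_angle.
Proof.
move: (M_ge) (r_gt0) => h1 h2.
rewrite -(atan0 R); apply: lt_atan; rewrite divr_gt0 ?mulr_gt0 //; lra.
Qed.

Let ang_full k t : k.+1%:R * eta <= t -> step_angle <= ang (node k t) (node k.+1 t).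
Proof.
move=> kt; apply: le_atan; move: (M_ge) (r_gt0) (kap_gt0) (eta_gt0) => h1 h2 h3 e0.
have E : k.+1%:R * eta = k%:R * eta + eta by rewrite -natr1; ring.
have k0 : 0 <= k%:R * eta by rewrite mulr_ge0 // ltW.
have -> : node k.+1 t = k%:R * eta + eta by rewrite /node min_l E // -E.
have -> : node k t = k%:R * eta by rewrite /node min_l //; lra.
set s := k%:R * eta in k0 *.
have eh : eta <= h by rewrite ge_min lexx.
have sE : s + eta - s = eta by ring.
have d0 : 0 < dot s (s + eta) by apply: dot_gt0; rewrite sE gtr0_norm.
have cg : kap * eta <= cross s (s + eta).
  by have := @cross_growth s (s + eta) k0 ltac:(lra) ltac:(lra); rewrite sE.
have dM : dot s (s + eta) <= 2 * (M + 1).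
  have := upper s; have := upper (s + eta); rewrite /dot.
  have := sqr_ge0 (f s - f (s + eta)); have := sqr_ge0 (g s - g (s + eta)).
  nra.
rewrite ler_pdivlMr // mulrAC ler_pdivrMr; last lra.
have p0 : 0 < kap * eta by rewrite mulr_gt0.
nra.
Qed.

Let lift_diverges th N t : N%:R * eta <= t -> forall N', (N <= N')%N ->
  th + N%:R * step_angle <= lift th N' t.
Proof.
move=> Nt N' NN'; rewrite /lift lerD2l -(subnKC NN') big_split_ord /=.
have t0 : 0 <= t by apply: le_trans Nt; rewrite mulr_ge0 // ltW.
rewrite -[leLHS]addr0; apply: lerD; last by apply: sumr_ge0 => k _; apply: ang_ge0.
rewrite mulr_natl -[X in _ *+ X]card_ord -sumr_const; apply: ler_sum => k _.
apply: ang_full; apply: le_trans Nt; rewrite ler_pM2r // ler_nat; exact: ltn_ord.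
Qed.

(** The number of steps is chosen separately for each [t], which stability of the sum makes
    harmless. All step angles are nonnegative and the full ones are bounded below, so the angle
    diverges. *)
Lemma winding_lift : exists theta : R -> R, [/\
  forall t, 0 <= t -> {for t, continuous theta},
  forall t, 0 <= t -> f t = Num.sqrt (f t ^+ 2 + g t ^+ 2) * cos (theta t) /\
                      g t = Num.sqrt (f t ^+ 2 + g t ^+ 2) * sin (theta t) &
  forall C : R, exists T : R, forall t, T <= t -> C <= theta t].
Proof.
have [th f0 g0] := exists_angle (f 0) (g 0).
have th0 : is_lift th 0 by split.
have arch (u : R) : exists N : nat, u <= N%:R * eta.
  exists (Num.truncn (u / eta)).+1; rewrite -ler_pdivrMr //.
  exact/ltW/truncnS_gt.
have /choice[N hN] : forall t, exists N : nat, t <= N%:R * eta := arch.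
exists (fun t => lift th (N t) t); split.
- move=> t t0; have [N0 hN0] := arch (t + 1).
  have E s : s < t + 1 -> lift th (N s) s = lift th N0 s.
    move=> st; have [/lift_stable h1|/ltnW/lift_stable h1] := leqP (N s) N0.
      by rewrite h1.
    by rewrite h1 //; lra.
  rewrite /prop_for /continuous_at E; last lra.
  apply: cvg_trans (lift_continuous (th := th) (N := N0) (x := t)).
  apply: near_eq_cvg; near=> s; apply/esym/E; near: s.
  apply/nbhs_ballP; exists (1 : R); first exact: ltr01.
  move=> s; rewrite /ball /= ltr_norml; lra.
- by move=> t t0; apply: (lift_is_lift th0 t0).
- move=> C; pose N0 := (Num.truncn ((C - th) / step_angle)).+1.
  have hN0 : C <= th + N0%:R * step_angle.
    by rewrite -lerBlDl -ler_pdivrMr //; apply/ltW/truncnS_gt.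
  exists (N0%:R * eta) => t Nt; apply: le_trans hN0 _.
  have := @lift_diverges th N0 t Nt (maxn N0 (N t)) (leq_maxl _ _).
  by rewrite (@lift_stable th (N t)) ?leq_maxr.
Unshelve. all: by end_near.
Qed.

End Winding.

Section SmallReducible.
Context {R : realType} {m n : nat}.
Notation profile := ('rV[R]_m * 'cV[R]_n)%type.
Variables (A B : 'M[R]_(m, n)).
Implicit Types (z : profile) (p : R -> profile) (i j : 'I_m) (k l : 'I_n).

Lemma set2D1 (T : finType) (i j : T) : i != j -> ([set i; j] :\ j = [set i])%SET.
Proof.
move=> ij; apply/finset.setP => x; rewrite !inE.
by case: (eqVneq x j) => [->|_]; rewrite ?orbF // eq_sym (negbTE ij).
Qed.

Lemma set2D1' (T : finType) (i j : T) : i != j -> ([set i; j] :\ i = [set j])%SET.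
Proof. by move=> ij; rewrite finset.setUC set2D1 // eq_sym. Qed.

Lemma reducible_1x2 i k l : k != l -> B i k != B i l ->
  reducible A B [set i]%SET [set k; l]%SET.
Proof.
move=> kl; rewrite neq_lt => /orP[h|h].
  apply: (@reducible_col _ _ _ _ _ _ _ l k); rewrite ?inE ?eqxx ?orbT 1?eq_sym //.
    by move=> r; rewrite inE => /eqP->.
  by rewrite set2D1' //; apply: reducible_pure.
apply: (@reducible_col _ _ _ _ _ _ _ k l); rewrite ?inE ?eqxx ?orbT //.
  by move=> r; rewrite inE => /eqP->.
by rewrite set2D1 //; apply: reducible_pure.
Qed.

Lemma reducible_2x1 i j k : i != j -> A i k != A j k ->
  reducible A B [set i; j]%SET [set k]%SET.
Proof.
move=> ij; rewrite neq_lt => /orP[h|h].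
  apply: (@reducible_row _ _ _ _ _ _ _ j i); rewrite ?inE ?eqxx ?orbT 1?eq_sym //.
    by move=> r; rewrite inE => /eqP->.
  by rewrite set2D1' //; apply: reducible_pure.
apply: (@reducible_row _ _ _ _ _ _ _ i j); rewrite ?inE ?eqxx ?orbT //.
  by move=> r; rewrite inE => /eqP->.
by rewrite set2D1 //; apply: reducible_pure.
Qed.

Lemma reducible_2x2_row i j k l : i != j -> k != l ->
  0 < (A i k - A j k) * (A i l - A j l) ->
  B i k != B i l -> B j k != B j l -> reducible A B [set i; j]%SET [set k; l]%SET.
Proof.
move=> ij kl sgn b1 b2; have [h|h] := ltP 0 (A i k - A j k).
  have h' : 0 < A i l - A j l by rewrite pmulr_rgt0 in sgn.
  apply: (@reducible_row _ _ _ _ _ _ _ i j); rewrite ?inE ?eqxx ?orbT //.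
    by move=> r; rewrite !inE => /orP[]/eqP->; rewrite -subr_gt0.
  by rewrite set2D1 //; apply: reducible_1x2.
have h1 : A i k - A j k < 0.
  rewrite lt_neqAle h andbT; apply: contraTneq sgn => ->.
  by rewrite mul0r ltxx.
have h' : A i l - A j l < 0 by rewrite nmulr_rgt0 in sgn.
apply: (@reducible_row _ _ _ _ _ _ _ j i); rewrite ?inE ?eqxx ?orbT 1?eq_sym //.
  by move=> r; rewrite !inE => /orP[]/eqP->; rewrite -subr_lt0.
by rewrite set2D1' //; apply: reducible_1x2.
Qed.

Lemma reducible_2x2_col i j k l : i != j -> k != l ->
  0 < (B i k - B i l) * (B j k - B j l) ->
  A i k != A j k -> A i l != A j l -> reducible A B [set i; j]%SET [set k; l]%SET.
Proof.
move=> ij kl sgn b1 b2; have [h|h] := ltP 0 (B i k - B i l).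
  have h' : 0 < B j k - B j l by rewrite pmulr_rgt0 in sgn.
  apply: (@reducible_col _ _ _ _ _ _ _ k l); rewrite ?inE ?eqxx ?orbT //.
    by move=> r; rewrite !inE => /orP[]/eqP->; rewrite -subr_gt0.
  by rewrite set2D1 //; apply: reducible_2x1.
have h1 : B i k - B i l < 0.
  rewrite lt_neqAle h andbT; apply: contraTneq sgn => ->.
  by rewrite mul0r ltxx.
have h' : B j k - B j l < 0 by rewrite nmulr_rgt0 in sgn.
apply: (@reducible_col _ _ _ _ _ _ _ l k); rewrite ?inE ?eqxx ?orbT 1?eq_sym //.
  by move=> r; rewrite !inE => /orP[]/eqP->; rewrite -subr_lt0.
by rewrite set2D1' //; apply: reducible_2x1.
Qed.

Lemma bestAset_nonempty z : simplexAB z -> exists i, i \in bestAset A z.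
Proof. by move=> /(exists_bestA A)[i hi]; exists i; apply/in_bestAset. Qed.

Lemma bestBset_nonempty z : simplexAB z -> exists k, k \in bestBset B z.
Proof. by move=> /(exists_bestB B)[i hi]; exists i; apply/in_bestBset. Qed.

Lemma solution_increment_lower T p (f : profile -> R) (M a c : R) :
  linear_functional f -> fp_solution A B T p -> 0 <= a -> a <= c -> c <= T ->
  (forall t b, a < t < c -> BRAB A B (p t) b -> M <= f b) ->
  M * (expR c - expR a) <= expR c * f (p c) - expR a * f (p a).
Proof.
move=> fl sp a0 ac_ cT fM; have := solution_lower fl sp a0 ac_ cT fM.
move=> h; have : expR c * (expR (a - c) * (f (p a) - M)) <= expR c * (f (p c) - M).
  by rewrite ler_pM2l ?expR_gt0.
by rewrite mulrA -expRD (_ : c + (a - c) = a); [lra|ring].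
Qed.

End SmallReducible.

(** * Coordinates centred at an interior equilibrium *)

Section TwoByTwo.
Context {R : realType}.
Notation profile := ('rV[R]_2 * 'cV[R]_2)%type.
Implicit Types (A B : 'M[R]_2) (z b e : profile) (p : R -> profile).

Lemma ord2P (i : 'I_2) : i = 0 \/ i = 1.
Proof.
case: i => -[|[|//]] h; [left|right]; exact: val_inj.
Qed.

Lemma sum2 (F : 'I_2 -> R) : \sum_i F i = F 0 + F 1.
Proof.
rewrite !big_ord_recl big_ord0 addr0; congr (F _ + F _); exact: val_inj.
Qed.

Lemma simplexA2 (q : 'rV[R]_2) : simplexA q -> q 0 1 = 1 - q 0 0.
Proof. by move=> [_]; rewrite sum2; lra. Qed.

Lemma simplexB2 (q : 'cV[R]_2) : simplexB q -> q 1 0 = 1 - q 0 0.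
Proof. by move=> [_]; rewrite sum2; lra. Qed.

Lemma set2_cases (I : {set 'I_2}) i j : i != j -> (exists r, r \in I) ->
  (exists r, I = [set r]%SET) \/ I = [set i; j]%SET.
Proof.
move=> ij [r rI].
have dich (s : 'I_2) : s = i \/ s = j.
  by move: ij; have [->|->] := ord2P i; have [->|->] := ord2P j;
    have [->|->] := ord2P s => //; auto.
have [iI|iI] := boolP (i \in I); have [jI|jI] := boolP (j \in I).
- right; apply/finset.setP => s; rewrite !inE.
  by have [->|->] := dich s; rewrite eqxx ?orbT ?iI ?jI.
- left; exists i; apply/finset.setP => s; rewrite !inE.
  have [->|->] := dich s; rewrite ?eqxx ?iI //.
  by rewrite (negbTE jI) eq_sym (negbTE ij).
- left; exists j; apply/finset.setP => s; rewrite !inE.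
  have [->|->] := dich s; rewrite ?eqxx ?jI //.
  by rewrite (negbTE iI) (negbTE ij).
- by exfalso; move: rI; have [->|->] := dich r; rewrite ?(negbTE iI) ?(negbTE jI).
Qed.

Lemma coord_dist e z : simplexAB z -> simplexAB e ->
  [/\ `|xcoord e z| <= `|z - e|, `|ycoord e z| <= `|z - e| &
      `|z - e| <= `|xcoord e z| + `|ycoord e z|].
Proof.
move=> [z1 z2] [e1 e2].
have hx := row_coord_norm (z - e) 0; have hy := col_coord_norm (z - e) 0.
rewrite !mxE in hx hy; split => //.
apply: profile_norm_le => [|i|i]; first by rewrite addr_ge0.
  rewrite !mxE; have [->|->] := ord2P i; first by rewrite lerDl.
  rewrite (simplexA2 z1) (simplexA2 e1).
  have -> : 1 - z.1 0 0 - (1 - e.1 0 0) = - xcoord e z by rewrite /xcoord; ring.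
  by rewrite normrN lerDl.
rewrite !mxE; have [->|->] := ord2P i; first by rewrite lerDr.
rewrite (simplexB2 z2) (simplexB2 e2).
have -> : 1 - z.2 0 0 - (1 - e.2 0 0) = - ycoord e z by rewrite /ycoord; ring.
by rewrite normrN lerDr.
Qed.

(** Relative to an interior equilibrium [e], the gap between the rows is this slope times
    [ycoord e], and likewise for columns. The product of both slopes is negative in cyclic games and
    positive at saddles. *)
Definition slopeA A : R := (A 0 0 - A 1 0) - (A 0 1 - A 1 1).
Definition slopeB B : R := (B 0 0 - B 0 1) - (B 1 0 - B 1 1).

Section Coordinates.
Variables (A B : 'M[R]_2) (e : profile).
Hypothesis he : interior_equilibrium A B e.

Lemma gapA_ycoord z : simplexAB z -> gapA A 0 1 z = slopeA A * ycoord e z.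
Proof.
move=> [_ z2]; have [[_ e2] _ hA _] := he.
have E : gapA A 0 1 e = 0 by rewrite /gapA /payA (hA 0 1) subrr.
rewrite -[LHS]subr0 -E !gapAE !sum2 (simplexB2 z2) (simplexB2 e2) /slopeA /ycoord.
ring.
Qed.

Lemma gapB_xcoord z : simplexAB z -> gapB B 0 1 z = slopeB B * xcoord e z.
Proof.
move=> [z1 _]; have [[e1 _] _ _ hB] := he.
have E : gapB B 0 1 e = 0 by rewrite /gapB /payB (hB 0 1) subrr.
rewrite -[LHS]subr0 -E !gapBE !sum2 (simplexA2 z1) (simplexA2 e1) /slopeB /xcoord.
ring.
Qed.

Lemma BR_row z b : simplexAB z -> BRAB A B z b ->
  (0 < slopeA A * ycoord e z -> b.1 0 0 = 1) /\
  (slopeA A * ycoord e z < 0 -> b.1 0 0 = 0).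
Proof.
move=> sz [[b1 hb] _]; rewrite -(gapA_ycoord sz); split => h.
  have b0 : b.1 0 1 = 0.
    by apply/eqP/negPn/negP => /hb; apply: gapA_gt0_notbest h.
  by have := simplexA2 b1; lra.
apply/eqP/negPn/negP => /hb; apply: (@gapA_gt0_notbest _ _ _ A 1 0).
by move: h; rewrite /gapA; lra.
Qed.

Lemma BR_col z b : simplexAB z -> BRAB A B z b ->
  (0 < slopeB B * xcoord e z -> b.2 0 0 = 1) /\
  (slopeB B * xcoord e z < 0 -> b.2 0 0 = 0).
Proof.
move=> sz [_ [b1 hb]]; rewrite -(gapB_xcoord sz); split => h.
  have b0 : b.2 1 0 = 0.
    by apply/eqP/negPn/negP => /hb; apply: gapB_gt0_notbest h.
  by have := simplexB2 b1; lra.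
apply/eqP/negPn/negP => /hb; apply: (@gapB_gt0_notbest _ _ _ B 1 0).
by move: h; rewrite /gapB; lra.
Qed.

Lemma equilibrium_BR : BRAB A B e e.
Proof.
have [[e1 e2] _ hA hB] := he; split; split => // i _ r; first by rewrite (hA r i).
by rewrite (hB r i).
Qed.

Lemma equilibrium_margin : exists2 m0 : R, 0 < m0 &
  [/\ m0 <= e.1 0 0, m0 <= 1 - e.1 0 0, m0 <= e.2 0 0, m0 <= 1 - e.2 0 0 & m0 <= 1].
Proof.
have [[e1 e2] [p1 p2] _ _] := he.
exists (Num.min (Num.min (e.1 0 0) (e.1 0 1)) (Num.min (e.2 0 0) (e.2 1 0))).
  by rewrite !lt_min !p1 !p2.
rewrite -(simplexA2 e1) -(simplexB2 e2); split; rewrite ?ge_min ?lexx ?orbT //.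
by have := simplexA_le1 0 e1 => /andP[_ ->].
Qed.

Lemma coord_eq0 z : simplexAB z -> xcoord e z = 0 -> ycoord e z = 0 -> z = e.
Proof.
move=> sz x0 y0; have [se _ _ _] := he; have [_ _] := coord_dist sz se.
by rewrite x0 y0 normr0 addr0 normr_le0 subr_eq0 => /eqP.
Qed.

End Coordinates.

End TwoByTwo.

(** Here [x] is a coordinate at the start of a short step, [x'] its later value, and [w] a velocity
    whose sign follows that of [x']. If [x] exceeds [h] in size, its sign has not changed; otherwise
    [x * w] and [m0] times the size of [x] are both at most [h] in size, whence the loss [2 * h]. *)
Lemma large_coordinate {R : realType} (m0 h x x' w : R) : 0 <= m0 <= 1 ->
  `|x' - x| <= h -> `|w| <= 1 -> (0 < x' -> m0 <= w) -> (x' < 0 -> w <= - m0) ->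
  m0 * `|x| - 2 * h <= x * w.
Proof.
move=> /andP[m00 m01] xx w1 wpos wneg.
have h0 : 0 <= h by apply: le_trans xx.
have [xl|xs] := leP `|x| h.
  have : `|x * w| <= h * 1 by rewrite normrM; apply: ler_pM.
  have : m0 * `|x| <= 1 * h by apply: ler_pM.
  by rewrite ler_norml => k1 /andP[k2 _]; lra.
move: xx xs; rewrite ler_norml => /andP[k1 k2].
have [x0|x0] := ltP 0 x.
  rewrite (gtr0_norm x0) => xs.
  have : m0 * x <= w * x by apply: ler_wpM2r; [exact: ltW|apply: wpos; lra].
  lra.
rewrite (ler0_norm x0) => xs.
have : m0 * - x <= - w * - x.
  by apply: ler_wpM2r; [lra|rewrite lerNr; apply: wneg; lra].
lra.
Qed.

(** * Orbits of cyclic games *)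

Section Spiral.
Context {R : realType}.
Notation profile := ('rV[R]_2 * 'cV[R]_2)%type.
Variables (A B : 'M[R]_2) (k l : 'I_2) (kl : k != l).
Hypothesis sg : spiral_signs A B 0 1 k l.
Variable e : profile.
Hypothesis he : interior_equilibrium A B e.
Implicit Types (z b : profile) (p : R -> profile) (s t : R).

Let I01 : (0 : 'I_2) != 1. Proof. by []. Qed.

Lemma spiral2_reducible z : simplexAB z ->
  reducible A B (bestAset A z) (bestBset B z).
Proof.
move=> sz; have [s1 s2 s3 s4] := sg.
have bB (r : 'I_2) : B r k != B r l.
  by have [->|->] := ord2P r; [rewrite lt_eqF|rewrite gt_eqF].
have dich (s : 'I_2) : s = k \/ s = l.
  by move: kl; have [->|->] := ord2P k; have [->|->] := ord2P l;
    have [->|->] := ord2P s => //; auto.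
have bA (s : 'I_2) : A 0 s != A 1 s.
  by have [->|->] := dich s; [rewrite gt_eqF|rewrite lt_eqF].
have [[r ->]|->] := set2_cases I01 (bestAset_nonempty A sz);
  have [[s ->]|->] := set2_cases kl (bestBset_nonempty B sz).
- exact: reducible_pure.
- exact: reducible_1x2.
- exact: reducible_2x1.
- exact: reducible_spiral.
Qed.

(** All sets of best responses are reducible, including those at the equilibrium, so the exceptional
    set is empty. *)
Lemma spiral2_extends z : offZ_flow_extends A B z.
Proof.
apply: (@flow_off_extends _ _ _ A B set0 z 1 _ ltr01) => [|x _ _ []].
by apply: flow_off => [x sx _|x _ []]; apply: spiral2_reducible.
Qed.

Lemma constant_solution T : fp_solution A B T (fun=> e).
Proof.
have [se _ _ _] := he.
rewrite (_ : (fun=> e) = ray e e); last by apply/funext => t; rewrite ray_id.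
by apply: ray_solution => // t _; rewrite ray_id; apply: equilibrium_BR.
Qed.

Lemma confined2 z : confined A B [set 0; 1]%SET [set k; l]%SET z.
Proof.
split=> r _; rewrite !inE; first by have [->|->] := ord2P r; rewrite eqxx ?orbT.
by move: kl; have [->|->] := ord2P k; have [->|->] := ord2P l;
  have [->|->] := ord2P r.
Qed.

(** Closeness is applied to the orbit and to the constant solution at [e]. *)
Lemma spiral2_stable : stable A B e.
Proof.
have [se _ hA hB] := he.
have gA : gapA A 0 1 e = 0 by rewrite /gapA /payA (hA 0 1) subrr.
have gB : gapB B k l e = 0 by rewrite /gapB /payB (hB k l) subrr.
have [C C0 hC] := spiral_close (lexx 0) I01 kl sg gA gB.
move=> eps eps0; have C1 : 0 < C + 1 by lra.
exists (eps / (C + 1)); first exact: divr_gt0.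
move=> T p sp p0 t tT; pose d := eps / (C + 1).
have d0 : 0 < d by exact: divr_gt0.
have pq : paired A B e 0 [set 0; 1]%SET [set k; l]%SET T p (fun=> e) d.
  split; [exact: d0|exact: sp|exact: constant_solution|..].
    by rewrite subrr normr0; split; [exact: ltW p0|exact: ltW d0].
  by move=> ? _; split; apply: confined2.
apply: le_lt_trans (hC _ _ _ _ pq t tT) _.
have E : eps = d * (C + 1) by rewrite /d divfK // gt_eqF.
by rewrite [ltRHS]E; lra.
Qed.

Lemma slopes_opposite : slopeA A * slopeB B < 0.
Proof.
have [s1 s2 s3 s4] := sg; rewrite /slopeA /slopeB.
move: kl s1 s2 s3 s4; have [->|->] := ord2P k; have [->|->] := ord2P l => // _ s1 s2 s3 s4.
  by rewrite pmulr_rlt0; lra.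
by rewrite nmulr_rlt0; lra.
Qed.

Let S z := `|xcoord e z| + `|ycoord e z|.

Lemma spiral_level_equiv : exists m M : R, [/\ 0 < m, 0 < M &
  forall z, simplexAB z -> m * S z <= spiral_level A B 0 1 k l z <= M * S z].
Proof.
have [s1 s2 s3 s4] := sg; have so := slopes_opposite.
have nA : 0 < `|slopeA A|.
  by rewrite normr_gt0; apply: contraTneq so => ->; rewrite mul0r ltxx.
have nB : 0 < `|slopeB B|.
  by rewrite normr_gt0; apply: contraTneq so => ->; rewrite mulr0 ltxx.
have gA z : simplexAB z -> `|gapA A 0 1 z| = `|slopeA A| * `|ycoord e z|.
  by move=> sz; rewrite (gapA_ycoord he sz) normrM.
have gB z : simplexAB z -> `|gapB B k l z| = `|slopeB B| * `|xcoord e z|.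
  move=> sz; rewrite -normrM -(gapB_xcoord he sz) /gapB.
  move: kl; have [->|->] := ord2P k; have [->|->] := ord2P l => // _.
  by rewrite distrC.
have pos : 0 < - (B 0 k - B 0 l) /\ - (B 1 k - B 1 l) < 0 by split; lra.
have pos' : 0 < A 0 k - A 1 k /\ A 0 l - A 1 l < 0 by split; lra.
have b1 := @kink_norm_ge R _ _ _ pos.1 pos.2.
have b2 := @kink_norm_ge R _ _ _ pos'.1 pos'.2.
have u1 := kink_lipschitz (- (B 0 k - B 0 l)) (- (B 1 k - B 1 l)).
have u2 := kink_lipschitz (A 0 k - A 1 k) (A 0 l - A 1 l).
have kink0 (a c : R) : kink a c 0 = 0 by rewrite /kink !mulr0 maxxx.
move: b1 b2 u1 u2; set m1 := Num.min _ _; set m2 := Num.min _ _.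
set M1 := `|- (B 0 k - B 0 l)| + `|- (B 1 k - B 1 l)|.
set M2 := `|A 0 k - A 1 k| + `|A 0 l - A 1 l| => b1 b2 u1 u2.
have m10 : 0 < m1 by rewrite lt_min; apply/andP; split; lra.
have m20 : 0 < m2 by rewrite lt_min; apply/andP; split; lra.
have M10 : 0 <= M1 by rewrite addr_ge0.
have M20 : 0 <= M2 by rewrite addr_ge0.
pose a1 := m1 * `|slopeA A|; pose a2 := m2 * `|slopeB B|.
pose c1 := M1 * `|slopeA A|; pose c2 := M2 * `|slopeB B|.
have a10 : 0 < a1 by rewrite mulr_gt0.
have a20 : 0 < a2 by rewrite mulr_gt0.
have c10 : 0 <= c1 by rewrite mulr_ge0.
have c20 : 0 <= c2 by rewrite mulr_ge0.
exists (Num.min a1 a2), (c1 + c2 + 1); split; [by rewrite lt_min a10|lra|].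
move=> z sz; rewrite /spiral_level /S.
have {}b1 := b1 (gapA A 0 1 z); have {}b2 := b2 (gapB B k l z).
have {}u1 := u1 (gapA A 0 1 z) 0; have {}u2 := u2 (gapB B k l z) 0.
rewrite !kink0 !subr0 !gA // mulrA -/c1 in u1; rewrite !kink0 !subr0 !gB // mulrA -/c2 in u2.
rewrite gA // mulrA -/a1 in b1; rewrite gB // mulrA -/a2 in b2.
have {}u1 := le_trans (ler_norm _) u1; have {}u2 := le_trans (ler_norm _) u2.
have x0 := normr_ge0 (xcoord e z); have y0 := normr_ge0 (ycoord e z).
move: b1 b2 u1 u2; set K1 := kink _ _ _; set K2 := kink _ _ _ => b1 b2 u1 u2.
have h1 : Num.min a1 a2 * `|xcoord e z| <= a2 * `|xcoord e z|.
  by rewrite ler_wpM2r // ge_min lexx orbT.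
have h2 : Num.min a1 a2 * `|ycoord e z| <= a1 * `|ycoord e z|.
  by rewrite ler_wpM2r // ge_min lexx.
have h3 : 0 <= c1 * `|xcoord e z| by rewrite mulr_ge0.
have h4 : 0 <= c2 * `|ycoord e z| by rewrite mulr_ge0.
apply/andP; split; lra.
Qed.

Section Orbit.
Variable p : R -> profile.
Hypothesis sp : fp_solution_forever A B p.
Hypothesis p0 : p 0 <> e.

Let X t := expR t * xcoord e (p t).
Let Y t := expR t * ycoord e (p t).

Let simp t : 0 <= t -> simplexAB (p t).
Proof. by move=> t0; apply: (solution_simplex (sp t)); rewrite t0 lexx. Qed.

Let absXY t : `|X t| + `|Y t| = expR t * S (p t).
Proof. by rewrite !normrM ger0_norm ?expR_ge0 // -mulrDr. Qed.

(** The level is comparable with the distance to [e], and [exp t] times it is constant, so the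
    rescaled orbit stays in an annulus. *)
Lemma spiral_orbit_bounds : exists r M : R, [/\ 0 < r, 0 < M &
  forall t, 0 <= t -> r <= `|X t| + `|Y t| <= M].
Proof.
have [m [M [m0 M0 h]]] := spiral_level_equiv.
have [se _ _ _] := he.
have Spos : 0 < S (p 0).
  have [_ _ hd] := coord_dist (simp (lexx 0)) se.
  by apply: lt_le_trans hd; rewrite normr_gt0 subr_eq0; apply/eqP.
set L0 := spiral_level A B 0 1 k l (p 0).
have L00 : 0 < L0.
  have /andP[h1 _] := h _ (simp (lexx 0)); apply: lt_le_trans h1; exact: mulr_gt0.
exists (L0 / M), (L0 / m); split; try exact: divr_gt0.
move=> t t0; rewrite absXY.
have E := spiral_level_exp I01 kl sg (sp t) (lexx 0) t0 (lexx t)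
  (fun u _ => confined2 (p u)).
rewrite expR0 mul1r -/L0 in E.
have /andP[h1 h2] := h _ (simp t0).
have e0 := expR_gt0 t.
rewrite ler_pdivrMr // ler_pdivlMr // -E; apply/andP; split.
  by rewrite mulrAC -mulrA ler_pM2l // mulrC.
by rewrite mulrAC -mulrA ler_pM2l // mulrC.
Qed.

Let velocity_bound s t (f : profile -> R) (c : R) : linear_functional f ->
  (forall b, simplexAB b -> 0 <= f b <= 1) -> 0 <= c <= 1 -> 0 <= s -> s <= t ->
  `|expR t * (f (p t) - c) - expR s * (f (p s) - c)| <= expR t - expR s.
Proof.
move=> fl f01 c01 s0 st.
have h1 := solution_increment_lower fl (sp t) s0 st (lexx t) (M := 0) _.
have {}h1 := h1 (fun u b _ hb => proj1 (andP (f01 b (BRAB_simplex hb)))).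
have nl : linear_functional (fun z => - f z) by move=> x y z; rewrite fl; ring.
have h2 := solution_increment_lower nl (sp t) s0 st (lexx t) (M := -1) _.
have {}h2 := h2 (fun u b _ hb => ltac:(by rewrite lerN2; have /andP[] := f01 b (BRAB_simplex hb))).
have est : expR s <= expR t by rewrite ler_expR.
have : 0 <= c * (expR t - expR s) by apply: mulr_ge0; lra.
have : 0 <= (1 - c) * (expR t - expR s) by apply: mulr_ge0; lra.
by rewrite ler_norml => h3 h4; apply/andP; split; lra.
Qed.

Let X_lip s t : 0 <= s -> s <= t -> `|X t - X s| <= expR t - expR s.
Proof.
move=> s0 st; apply: (velocity_bound (rowcoord_lf 0) _ _ s0 st).
  by move=> b [sb _]; apply: simplexA_le1.
by have [[se _] _ _ _] := he; apply: simplexA_le1.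
Qed.

Let Y_lip s t : 0 <= s -> s <= t -> `|Y t - Y s| <= expR t - expR s.
Proof.
move=> s0 st; apply: (velocity_bound (colcoord_lf 0) _ _ s0 st).
  by move=> b [_ sb]; apply: simplexB_le1.
by have [[_ se] _ _ _] := he; apply: simplexB_le1.
Qed.

(* Slow change of (X, Y) keeps the signs of its large coordinates, and these
   signs turn the velocity in the direction given by the sign of [slopeB]. *)
Let cross_rate (r : R) : 0 < r -> (forall t, 0 <= t -> r <= `|X t| + `|Y t|) ->
  exists h kap : R, [/\ 0 < h, 0 < kap & forall s t, 0 <= s -> s <= t ->
    expR t - expR s <= h ->
    kap * (expR t - expR s) <= Num.sg (slopeB B) * (X s * Y t - Y s * X t)].
Proof.
move=> r0 hr; have [m0 m00 [m1 m2 m3 m4 m5]] := equilibrium_margin he.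
have so := slopes_opposite; set sb := Num.sg (slopeB B).
have sbn : slopeB B != 0 by apply: contraTneq so => ->; rewrite mulr0 ltxx.
have san : slopeA A != 0 by apply: contraTneq so => ->; rewrite mul0r ltxx.
(* Each coordinate loses [2 * h] below, together [m0 * r / 2], which is half of the available
   [m0 * r]. *)
pose h := m0 * r / 8; have h0 : 0 < h by rewrite divr_gt0 // mulr_gt0.
exists h, (m0 * r / 2); split => //; first by rewrite divr_gt0 // mulr_gt0.
move=> s t s0 st sth.
pose f z := sb * (X s * z.2 0 0 - Y s * z.1 0 0).
have fl : linear_functional f.
  by move=> a z z'; rewrite /f (colcoord_lf 0 a z z') (rowcoord_lf 0 a z z'); ring.
have sbE : sb = 1 /\ 0 < slopeB B /\ slopeA A < 0 \/
    sb = -1 /\ slopeB B < 0 /\ 0 < slopeA A.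
  rewrite /sb; have [b0|b0|b0] := ltgtP 0 (slopeB B); last by rewrite -b0 eqxx in sbn.
    by left; rewrite gtr0_sg // -(pmulr_llt0 _ b0).
  by right; rewrite ltr0_sg // -(nmulr_llt0 _ b0).
have sbn1 : `|sb| = 1 by case: sbE => -[-> _]; rewrite ?normrN normr1.
have key u b : s < u < t -> BRAB A B (p u) b -> f e + m0 * r / 2 <= f b.
  move=> /andP[su ut] hb.
  have u0 : 0 <= u by lra.
  have su_eu : expR u - expR s <= h.
    by apply: le_trans sth; rewrite lerD2r ler_expR ltW.
  have hX := le_trans (X_lip s0 (ltW su)) su_eu.
  have hY := le_trans (Y_lip s0 (ltW su)) su_eu.
  have [c1 c2] := BR_col he (simp u0) hb; have [r1 r2] := BR_row he (simp u0) hb.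
  have eu := expR_gt0 u.
  have b1 := simplexA_le1 0 (BRAB_simplex hb).1.
  have b2 := simplexB_le1 0 (BRAB_simplex hb).2.
  have wX : [/\ `|sb * (b.2 0 0 - e.2 0 0)| <= 1,
      0 < X u -> m0 <= sb * (b.2 0 0 - e.2 0 0) &
      X u < 0 -> sb * (b.2 0 0 - e.2 0 0) <= - m0].
    rewrite normrM sbn1 mul1r; split.
    - by rewrite ler_norml; apply/andP; split; lra.
    - rewrite /X pmulr_rgt0 // => xu; case: sbE => -[-> [d1 d2]].
        by rewrite c1 ?mulr_gt0 // mul1r.
      by rewrite c2 ?nmulr_rlt0 // sub0r mulrNN mul1r.
    - rewrite /X pmulr_rlt0 // => xu; case: sbE => -[-> [d1 d2]].
        by rewrite c2 ?pmulr_rlt0 // sub0r mul1r lerN2.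
      by rewrite c1 ?nmulr_rgt0 // mulN1r lerN2.
  have wY : [/\ `|- (sb * (b.1 0 0 - e.1 0 0))| <= 1,
      0 < Y u -> m0 <= - (sb * (b.1 0 0 - e.1 0 0)) &
      Y u < 0 -> - (sb * (b.1 0 0 - e.1 0 0)) <= - m0].
    rewrite normrN normrM sbn1 mul1r; split.
    - by rewrite ler_norml; apply/andP; split; lra.
    - rewrite /Y pmulr_rgt0 // => xu; case: sbE => -[-> [d1 d2]].
        by rewrite r2 ?nmulr_rlt0 // sub0r mul1r opprK.
      by rewrite r1 ?mulr_gt0 // mulN1r opprK.
    - rewrite /Y pmulr_rlt0 // => xu; case: sbE => -[-> [d1 d2]].
        by rewrite r1 ?nmulr_rgt0 // mul1r lerN2.
      by rewrite r2 ?pmulr_rlt0 // sub0r mulrNN mul1r lerN2.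
  have m01 : 0 <= m0 <= 1 by rewrite ltW.
  have [wX1 wX2 wX3] := wX; have partX := large_coordinate m01 hX wX1 wX2 wX3.
  have [wY1 wY2 wY3] := wY; have partY := large_coordinate m01 hY wY1 wY2 wY3.
  have : m0 * r <= m0 * (`|X s| + `|Y s|) by rewrite ler_pM2l //; apply: hr.
  have E : f b - f e = X s * (sb * (b.2 0 0 - e.2 0 0)) +
      Y s * - (sb * (b.1 0 0 - e.1 0 0)).
    by rewrite /f; ring.
  rewrite /h in partX partY; lra.
have := solution_increment_lower fl (sp t) s0 st (lexx t) key.
have -> : expR t * f (p t) - expR s * f (p s) =
   sb * (X s * Y t - Y s * X t) + f e * (expR t - expR s).
  by rewrite /f /X /Y /xcoord /ycoord; ring.
lra.
Qed.

Lemma spiral_orbit : exists rho theta : R -> R,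
  [/\ {within `[0, +oo[, continuous theta},
      forall t, 0 <= t -> [/\ 0 < rho t,
        xcoord e (p t) = rho t * cos (theta t) &
        ycoord e (p t) = rho t * sin (theta t)],
      rho t @[t --> +oo] --> (0 : R) &
      `|theta t| @[t --> +oo] --> +oo].
Proof.
have [r [M [r0 M0 hb]]] := spiral_orbit_bounds.
have [h [kap [h0 kap0 hc]]] := cross_rate r0 (fun t ht => proj1 (andP (hb t ht))).
set sb := Num.sg (slopeB B) in hc.
have sb2 : sb ^+ 2 = 1.
  rewrite sqr_sg; suff -> : slopeB B != 0 by [].
  by apply: contraTneq slopes_opposite => ->; rewrite mulr0 ltxx.
have sbn : `|sb| = 1.
  by apply/eqP; rewrite -(@eqrXn2 _ 2) // expr1n real_normK ?num_real // sb2.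
(* Inverse of the clock [u = expR t - 1], in which [X] and [Y] are 1-Lipschitz. It is frozen for
   negative [u] because the winding argument takes functions on the whole line. *)
pose tm (u : R) := ln (1 + Num.max 0 u).
have pos (u : R) : 0 < 1 + Num.max 0 u.
  by apply: ltr_pwDl; [exact: ltr01|rewrite le_max lexx].
have etm u : expR (tm u) = 1 + Num.max 0 u by rewrite lnK // posrE.
have tm0 u : 0 <= tm u by rewrite /tm; apply: ln_ge0; rewrite lerDl le_max lexx.
have tm_le u v : u <= v -> tm u <= tm v.
  move=> uv; rewrite -ler_expR !etm lerD2l ge_max le_max lexx /=.
  by rewrite le_max uv orbT.
have tmd u v : u <= v -> expR (tm v) - expR (tm u) <= v - u.
  move=> uv; rewrite !etm /Num.max; case: ltP => h1; case: ltP => h2; lra.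
(* The factor [sb] makes the rotation counterclockwise; the final angle is multiplied by it
   again. *)
pose f u := X (tm u); pose g u := sb * Y (tm u).
have f_lip s t : `|f t - f s| <= 1 * `|t - s|.
  rewrite mul1r; have [st|ts] := leP s t.
    rewrite (ger0_norm (_ : 0 <= t - s)) ?subr_ge0 //.
    exact: le_trans (X_lip (tm0 s) (tm_le _ _ st)) (tmd _ _ st).
  rewrite distrC [leRHS]distrC (ger0_norm (_ : 0 <= s - t)); last lra.
  exact: le_trans (X_lip (tm0 t) (tm_le _ _ (ltW ts))) (tmd _ _ (ltW ts)).
have g_lip s t : `|g t - g s| <= 1 * `|t - s|.
  rewrite mul1r -mulrBr normrM sbn mul1r; have [st|ts] := leP s t.
    rewrite (ger0_norm (_ : 0 <= t - s)) ?subr_ge0 //.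
    exact: le_trans (Y_lip (tm0 s) (tm_le _ _ st)) (tmd _ _ st).
  rewrite distrC [leRHS]distrC (ger0_norm (_ : 0 <= s - t)); last lra.
  exact: le_trans (Y_lip (tm0 t) (tm_le _ _ (ltW ts))) (tmd _ _ (ltW ts)).
have sq u : f u ^+ 2 + g u ^+ 2 = `|X (tm u)| ^+ 2 + `|Y (tm u)| ^+ 2.
  by rewrite /f /g [(sb * _) ^+ 2]exprMn sb2 mul1r !real_normK ?num_real.
have lower u : r ^+ 2 / 2 <= f u ^+ 2 + g u ^+ 2.
  have /andP[h1 _] := hb (tm u) (tm0 u); rewrite sq.
  have := normr_ge0 (X (tm u)); have := normr_ge0 (Y (tm u)).
  move: h1; set a := `|X _|; set b := `|Y _| => h1 b0 a0.
  have : r ^+ 2 <= (a + b) ^+ 2 by rewrite ler_sqr ?nnegrE ?addr_ge0 // ltW.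
  by have := sqr_ge0 (a - b); nra.
have upper u : f u ^+ 2 + g u ^+ 2 <= M ^+ 2.
  have /andP[_ h1] := hb (tm u) (tm0 u); rewrite sq.
  have := normr_ge0 (X (tm u)); have := normr_ge0 (Y (tm u)).
  move: h1; set a := `|X _|; set b := `|Y _| => h1 b0 a0.
  have : (a + b) ^+ 2 <= M ^+ 2 by rewrite ler_sqr ?nnegrE ?addr_ge0 // ltW.
  nra.
have tmE s : 0 <= s -> expR (tm s) = 1 + s by move=> s0; rewrite etm max_r.
have cross s t : 0 <= s -> s <= t -> t <= s + h ->
    kap * (t - s) <= f s * g t - g s * f t.
  move=> s0 st sth.
  have := hc (tm s) (tm t) (tm0 s) (tm_le _ _ st).
  rewrite !tmE //; last lra.
  have -> : 1 + t - (1 + s) = t - s by ring.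
  move=> /(_ ltac:(lra)) => h1; apply: le_trans h1 _.
  by rewrite /f /g le_eqVlt; apply/orP; left; apply/eqP; ring.
have r2 : 0 < r ^+ 2 / 2 by rewrite divr_gt0 // exprn_gt0.
have [Th [Thc Thl Thd]] := winding_lift ltr01 r2 kap0 h0 f_lip g_lip lower upper cross.
have back t : 0 <= t -> tm (expR t - 1) = t.
  move=> t0; rewrite /tm max_r; last by rewrite subr_ge0 -expR0 ler_expR.
  by rewrite addrC subrK expRK.
have et1 t : 0 <= t -> 0 <= expR t - 1 by move=> t0; rewrite subr_ge0 -expR0 ler_expR.
pose rh t := expR (- t) * Num.sqrt (f (expR t - 1) ^+ 2 + g (expR t - 1) ^+ 2).
pose th t := sb * Th (expR t - 1).
exists rh, th; split.
- apply/subspace_continuousP => t; rewrite /= in_itv /= andbT => t0.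
  apply: (@cvg_within_filter _ _ _ (nbhs t)).
  apply: cvgM; first exact: cvg_cst.
  apply: (@continuous_comp _ _ _ (fun t : R => expR t - 1) Th); last first.
    exact: Thc (et1 t t0).
  by apply: cvgB; [exact: continuous_expR|exact: cvg_cst].
- move=> t t0; have [h1 h2] := Thl _ (et1 t t0).
  have sb_cases : sb = 1 \/ sb = -1.
    have : (sb - 1) * (sb + 1) = 0 by rewrite -subr_sqr_1 sb2 subrr.
    by move/eqP; rewrite mulf_eq0 subr_eq0 addr_eq0 => /orP[]/eqP->; [left|right].
  have XE : X t = f (expR t - 1) by rewrite /f back.
  have YE : Y t = sb * g (expR t - 1).
    by rewrite /g back // mulrA -expr2 sb2 mul1r.
  have inv : expR (- t) * expR t = 1 by rewrite -expRD addNr expR0.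
  split.
  + by rewrite mulr_gt0 ?expR_gt0 // sqrtr_gt0 (lt_le_trans r2).
  + rewrite -[LHS]mul1r -inv -mulrA -/(X t) XE {1}h1 /rh -mulrA; congr (_ * (_ * _)).
    by rewrite /th; case: sb_cases => ->; rewrite ?mul1r // mulN1r cosN.
  + rewrite -[LHS]mul1r -inv -mulrA -/(Y t) YE {1}h2 /rh.
    have -> : sin (th t) = sb * sin (Th (expR t - 1)).
      by rewrite /th; case: sb_cases => ->; rewrite ?mul1r // !mulN1r sinN.
    ring.
- apply/cvgrPdist_lt => eps eps0.
  exists (Num.max 0 (M / eps)); split; first exact: num_real.
  move=> t; rewrite gt_max => /andP[t0 tM]; rewrite sub0r normrN.
  rewrite ger0_norm; last by rewrite mulr_ge0 ?expR_ge0 // sqrtr_ge0.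
  apply: (@le_lt_trans _ _ (expR (- t) * M)).
    rewrite ler_pM2l ?expR_gt0 // -[leRHS]ger0_norm; last exact: ltW.
    by rewrite -sqrtr_sqr ler_sqrt // sqr_ge0.
  rewrite expRN mulrC ltr_pdivrMr ?expR_gt0 // mulrC -ltr_pdivrMr //.
  by apply: lt_le_trans tM _; have := expR_ge1Dx t; lra.
- apply/cvgryPge => C; have [T hT] := Thd C.
  exists (Num.max 0 T); split; first exact: num_real.
  move=> t; rewrite gt_max => /andP[t0 tT].
  rewrite /th normrM sbn mul1r; apply: le_trans (ler_norm _).
  by apply: hT; have := expR_ge1Dx t; lra.
Qed.

End Orbit.

Lemma spiral2_spirals : spirals_to A B e.
Proof. by move=> p sp p0; apply: spiral_orbit. Qed.

End Spiral.

(** * Orbits near a saddle *)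

Section Saddle.
Context {R : realType}.
Notation profile := ('rV[R]_2 * 'cV[R]_2)%type.
Variables (A B : 'M[R]_2) (e : profile).
Hypothesis he : interior_equilibrium A B e.
Hypothesis slopes : 0 < slopeA A * slopeB B.
Implicit Types (z b : profile) (p : R -> profile) (s t v w tau : R).

Definition side v : 'I_2 := if 0 < v then 0 else 1.
(** For signs [v] and [w], the corner of the square of profiles lying, as seen from [e], in the
    quadrant with these signs of the two coordinates. *)
Definition vertex v w : profile := (pureA (side v), pureB (side w)).

Let sgn := Num.sg (slopeB B).

Lemma slopes_sign : sgn = 1 /\ 0 < slopeB B /\ 0 < slopeA A \/
  sgn = -1 /\ slopeB B < 0 /\ slopeA A < 0.
Proof.
rewrite /sgn; have [b0|b0|b0] := ltgtP 0 (slopeB B).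
- by left; rewrite gtr0_sg // -(pmulr_lgt0 _ b0).
- by right; rewrite ltr0_sg // -(nmulr_lgt0 _ b0).
- by move: slopes; rewrite -b0 mulr0 ltxx.
Qed.

Lemma slopes_pos : [/\ sgn * sgn = 1, 0 < sgn * slopeB B & 0 < sgn * slopeA A].
Proof.
by case: slopes_sign => -[-> [b0 a0]]; rewrite ?mul1r ?mulrNN ?mulN1r ?oppr_gt0 ?mul1r.
Qed.

Lemma sgn_unit tau : tau = 1 \/ tau = -1 -> sgn * tau = 1 \/ sgn * tau = -1.
Proof.
by case: slopes_sign => -[-> _] [] ->; [left|right|right|left]; lra.
Qed.

Lemma vertex_simplex v w : simplexAB (vertex v w).
Proof. exact: pure_simplex. Qed.

Lemma vertex_row v w : (vertex v w).1 0 0 = (0 < v)%R%:R.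
Proof. by rewrite /= mxE eqxx /side; case: (0 < v). Qed.

Lemma vertex_col v w : (vertex v w).2 0 0 = (0 < w)%R%:R.
Proof. by rewrite /= mxE /side; case: (0 < w). Qed.

Lemma vertex_BR z v w : simplexAB z -> v = 1 \/ v = -1 -> w = 1 \/ w = -1 ->
  0 < v * (slopeA A * ycoord e z) -> 0 < w * (slopeB B * xcoord e z) ->
  BRAB A B z (vertex v w).
Proof.
move=> sz hv hw; rewrite -(gapA_ycoord he sz) -(gapB_xcoord he sz) => gA gB.
apply: confined_pure_BR => //; split=> r hr; rewrite inE.
  move: gA; rewrite /side; case: hv => ->; rewrite ?ltr01 ?ltr0N1 ?mul1r ?mulN1r => gA.
    by have [->|r1] := ord2P r => //; subst r; exfalso; apply: gapA_gt0_notbest gA hr.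
  have [r1|->] := ord2P r => //; subst r; exfalso.
  by apply: (@gapA_gt0_notbest _ _ _ A 1 0) hr; move: gA; rewrite /gapA; lra.
move: gB; rewrite /side; case: hw => ->; rewrite ?ltr01 ?ltr0N1 ?mul1r ?mulN1r => gB.
  by have [->|r1] := ord2P r => //; subst r; exfalso; apply: gapB_gt0_notbest gB hr.
have [r1|->] := ord2P r => //; subst r; exfalso.
by apply: (@gapB_gt0_notbest _ _ _ B 1 0) hr; move: gB; rewrite /gapB; lra.
Qed.

Lemma coords_scale (P : profile) (a : R) : xcoord e (e + a *: (P - e)) = a * xcoord e P /\
  ycoord e (e + a *: (P - e)) = a * ycoord e P.
Proof. by rewrite /xcoord /ycoord /= !mxE; split; ring. Qed.

Lemma vertex_coords v w : v = 1 \/ v = -1 -> w = 1 \/ w = -1 ->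
  0 < v * xcoord e (vertex v w) /\ 0 < w * ycoord e (vertex v w).
Proof.
move=> hv hw; have [m0 m00 [m1 m2 m3 m4 m5]] := equilibrium_margin he.
rewrite /xcoord /ycoord vertex_row vertex_col.
by split; [case: hv => ->|case: hw => ->]; rewrite ?ltr01 ?ltr0N1 /=; lra.
Qed.

(** The orbit aims at the corner [V] of the opposite quadrant along the line through [V] and [e], so
    it reaches [e] when [expR t = 1 + m0]. The margin [m0] keeps its starting point in the
    simplex. *)
Lemma saddle_incoming tau : tau = 1 \/ tau = -1 ->
  exists T p, [/\ 0 < T, fp_solution A B T p, p T = e &
    forall t, 0 <= t < T -> 0 < tau * xcoord e (p t) /\
                            0 < - (sgn * tau) * ycoord e (p t)].
Proof.
move=> htau; have [m0 m00 [m1 m2 m3 m4 m5]] := equilibrium_margin he.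
have hsg := sgn_unit htau; have [sgn2 sgnB sgnA] := slopes_pos.
have hN : - tau = 1 \/ - tau = -1 by case: htau => ->; [right|left]; lra.
have [V EV] : exists V, V = vertex (- tau) (sgn * tau) by eexists.
have [vx vy] := vertex_coords hN hsg; rewrite -EV in vx vy.
have [se _ _ _] := he; have [[se1 se2] [se3 se4]] := se.
have sV := vertex_simplex (- tau) (sgn * tau); rewrite -EV in sV.
have [[sV1 sV2] [sV3 sV4]] := sV.
pose x0 := e + (- m0) *: (V - e).
have scal (a c : R) : m0 <= a -> 0 <= c <= 1 -> 0 <= a + - m0 * (c - a).
  move=> ha hc; have : 0 <= m0 * (1 - c) by apply: mulr_ge0; lra.
  have : 0 <= m0 * a by apply: mulr_ge0; lra.
  lra.
have sx0 : simplexAB x0.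
  split; split => /=.
  - move=> i; rewrite !mxE; apply: scal; last exact: (simplexA_le1 i sV.1).
    by have [->|->] := ord2P i => //; rewrite (simplexA2 se.1).
  - under eq_bigr do rewrite !mxE.
    by rewrite big_split /= -mulr_sumr sumrB sV2 se2 subrr mulr0 addr0.
  - move=> i; rewrite !mxE; apply: scal; last exact: (simplexB_le1 i sV.2).
    by have [->|->] := ord2P i => //; rewrite (simplexB2 se.2).
  - under eq_bigr do rewrite !mxE.
    by rewrite big_split /= -mulr_sumr sumrB sV4 se4 subrr mulr0 addr0.
pose s t := expR (- t) * (1 + m0) - 1.
have rE t : ray x0 V t = e + (- s t) *: (V - e).
  apply: injective_projections; apply/matrixP => i j; rewrite !mxE /s /=; ring.
have s0 t : t < ln (1 + m0) -> 0 < s t.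
  move=> tT; rewrite subr_gt0; have e0 : 0 < 1 + m0 by lra.
  have : expR t < 1 + m0 by rewrite -[ltRHS]lnK ?posrE // ltr_expR.
  by rewrite expRN mulrC ltr_pdivlMr ?expR_gt0 // mul1r.
have coords t : t < ln (1 + m0) -> 0 < tau * xcoord e (ray x0 V t) /\
    0 < - (sgn * tau) * ycoord e (ray x0 V t).
  move=> /s0 st; rewrite rE; have [-> ->] := coords_scale V (- s t).
  by have := mulr_gt0 st vx; have := mulr_gt0 st vy; split; lra.
exists (ln (1 + m0)), (ray x0 V); split.
- by apply: ln_gt0; lra.
- apply: ray_solution => // t tT; rewrite [X in BRAB _ _ _ X]EV; apply: vertex_BR => //.
  + by apply: ray_simplex => //; lra.
  + have [_ c2] := coords t ltac:(lra); move: c2; set y := ycoord _ _.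
    by move=> /(mulr_gt0 sgnA); congr (0 < _); rewrite -[RHS]mul1r -sgn2; ring.
  + have [c1 _] := coords t ltac:(lra); move: c1; set y := xcoord _ _.
    by move=> /(mulr_gt0 sgnB); congr (0 < _); ring.
- rewrite rE /s expRN lnK ?posrE; last lra.
  rewrite mulVf ?subrr ?oppr0 ?scale0r ?addr0 //; apply: lt0r_neq0; lra.
- by move=> t tT; apply: coords; lra.
Qed.

Lemma saddle_outgoing tau : tau = 1 \/ tau = -1 ->
  exists T p, [/\ 0 < T, fp_solution A B T p, p 0 = e &
    forall t, 0 < t <= T -> 0 < tau * xcoord e (p t) /\
                            0 < sgn * tau * ycoord e (p t)].
Proof.
move=> htau.
have hsg := sgn_unit htau; have [sgn2 sgnB sgnA] := slopes_pos.
set V := vertex tau (sgn * tau).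
have [vx vy] := vertex_coords htau hsg; rewrite -/V in vx vy.
have [se _ _ _] := he.
have sV := vertex_simplex tau (sgn * tau); rewrite -/V in sV.
have rE t : ray e V t = e + (1 - expR (- t)) *: (V - e).
  apply: injective_projections; apply/matrixP => i j; rewrite !mxE /=; ring.
have coords t : 0 < t -> 0 < tau * xcoord e (ray e V t) /\
    0 < sgn * tau * ycoord e (ray e V t).
  move=> t0; have s0 : 0 < 1 - expR (- t) by rewrite subr_gt0 -expR0 ltr_expR; lra.
  rewrite rE; have [-> ->] := coords_scale V (1 - expR (- t)).
  by split; rewrite mulrCA mulr_gt0.
exists 1, (ray e V); split; [exact: ltr01| |exact: ray0|].
- apply: ray_solution => // t tT; apply: vertex_BR => //.
  + by apply: ray_simplex => //; lra.
  + have [_ c2] := coords t ltac:(lra); move: c2; set y := ycoord _ _.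
    by move=> /(mulr_gt0 sgnA); congr (0 < _); rewrite -[RHS]mul1r -sgn2; ring.
  + have [c1 _] := coords t ltac:(lra); move: c1; set y := xcoord _ _.
    by move=> /(mulr_gt0 sgnB); congr (0 < _); ring.
- by move=> t tT; apply: coords; lra.
Qed.

Section Exit.
Variables (p : R -> profile) (sp : fp_solution_forever A B p).

Let simp t : 0 <= t -> simplexAB (p t).
Proof. by move=> t0; apply: (solution_simplex (sp t)); rewrite t0 lexx. Qed.

Let row_law v t1 t : v = 1 \/ v = -1 -> 0 <= t1 -> t1 <= t ->
  (forall s, t1 < s < t -> 0 < v * (slopeA A * ycoord e (p s))) ->
  xcoord e (p t) - ((0 < v)%R%:R - e.1 0 0) =
    expR (t1 - t) * (xcoord e (p t1) - ((0 < v)%R%:R - e.1 0 0)).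
Proof.
move=> hv t10 t1t h.
have := solution_const (rowcoord_lf 0) (sp t) t10 t1t (lexx t) (M := (0 < v)%R%:R) _.
rewrite /xcoord => E; have {}E := E _; rewrite -[LHS]addr0.
have {}E := E ltac:(move=> s b hs hb; have [h1 h2] := BR_row he (simp (ltac:(lra) : 0 <= s)) hb;
  have := h s hs; case: hv => ->; rewrite ?mul1r ?mulN1r ?ltr01 ?ltr0N1 ?oppr_gt0; [exact: h1|exact: h2]).
lra.
Qed.

Let col_law v t1 t : v = 1 \/ v = -1 -> 0 <= t1 -> t1 <= t ->
  (forall s, t1 < s < t -> 0 < v * (slopeB B * xcoord e (p s))) ->
  ycoord e (p t) - ((0 < v)%R%:R - e.2 0 0) =
    expR (t1 - t) * (ycoord e (p t1) - ((0 < v)%R%:R - e.2 0 0)).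
Proof.
move=> hv t10 t1t h.
have := solution_const (colcoord_lf 0) (sp t) t10 t1t (lexx t) (M := (0 < v)%R%:R) _.
rewrite /ycoord => E; have {}E := E _; rewrite -[LHS]addr0.
have {}E := E ltac:(move=> s b hs hb; have [h1 h2] := BR_col he (simp (ltac:(lra) : 0 <= s)) hb;
  have := h s hs; case: hv => ->; rewrite ?mul1r ?mulN1r ?ltr01 ?ltr0N1 ?oppr_gt0; [exact: h1|exact: h2]).
lra.
Qed.

Let coord_near s t : 0 <= s -> 0 <= t ->
  `|xcoord e (p t) - xcoord e (p s)| <= `|t - s| /\
  `|ycoord e (p t) - ycoord e (p s)| <= `|t - s|.
Proof.
move=> s0 t0; have : `|p t - p s| <= `|t - s|.
  have [st|ts] := leP s t.
    rewrite (ger0_norm (_ : 0 <= t - s)); last lra.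
    exact: (solution_lipschitz (sp t)).
  rewrite distrC [leRHS]distrC (ger0_norm (_ : 0 <= s - t)); last lra.
  by apply: (solution_lipschitz (sp s)) => //; exact: ltW.
move=> h; have hx := row_coord_norm (p t - p s) 0.
have hy := col_coord_norm (p t - p s) 0.
rewrite !mxE in hx hy; rewrite /xcoord /ycoord.
have -> : (p t).1 0 0 - e.1 0 0 - ((p s).1 0 0 - e.1 0 0) = (p t).1 0 0 - (p s).1 0 0 by ring.
have -> : (p t).2 0 0 - e.2 0 0 - ((p s).2 0 0 - e.2 0 0) = (p t).2 0 0 - (p s).2 0 0 by ring.
by split; apply: le_trans h.
Qed.

Let nonzero_sign (a : R) : a != 0 -> exists2 v, v = 1 \/ v = -1 & 0 < v * a.
Proof.
rewrite neq_lt => /orP[h|h]; first by exists (-1); [right|lra].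
by exists 1; [left|lra].
Qed.

Let slopeA_neq0 : slopeA A != 0.
Proof. by apply: contraTneq slopes => ->; rewrite mul0r ltxx. Qed.

Let slopeB_neq0 : slopeB B != 0.
Proof. by apply: contraTneq slopes => ->; rewrite mulr0 ltxx. Qed.

Let exit_constant_side (m0 : R) v t1 : 0 < m0 -> m0 <= e.2 0 0 -> m0 <= 1 - e.2 0 0 ->
  v = 1 \/ v = -1 -> 0 <= t1 ->
  (forall t, t1 <= t -> 0 < v * (slopeB B * xcoord e (p t))) ->
  exists2 t, 0 <= t & m0 / 2 <= `|p t - e|.
Proof.
(* The second coordinate relaxes to a corner value at distance at least [m0] from that of [e]. After
   this time [expR (2 / m0) >= 2 / m0] has brought it within m0 / 2 of the corner value. *)
move=> m00 m1 m2 hv t10 h; pose t := t1 + 2 / m0.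
have t20 : 0 < 2 / m0 by rewrite divr_gt0.
have tt1 : t1 <= t by rewrite /t; lra.
have E := col_law hv t10 tt1 (fun s hs => h s (ltW (proj1 (andP hs)))).
have e1 : expR (t1 - t) <= m0 / 2.
  have -> : t1 - t = - (2 / m0) by rewrite /t; ring.
  rewrite expRN -[leRHS]invf_div lef_pV2 ?posrE ?expR_gt0 //.
  by have := expR_ge1Dx (2 / m0); lra.
have e0 := expR_gt0 (t1 - t).
have [sy _] := he; have b1 := simplexB_le1 0 (simp t10).2.
exists t; first lra.
have [_ hy _] := coord_dist (simp (ltac:(lra) : 0 <= t)) sy.
apply: le_trans hy; move: E; rewrite {2}/ycoord.
have ub : -1 <= (p t1).2 0 0 - e.2 0 0 - ((0 < v)%R%:R - e.2 0 0) <= 1.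
  by case: (0 < v) => /=; lra.
set q := _ - _ - _ in ub *; set Ex := expR _ in e0 e1 * => E.
have : - (m0 / 2) <= Ex * q <= m0 / 2 by nra.
rewrite ler_normr; case: hv E => ->; rewrite ?ltr01 ?ltr0N1 /= => E h1; apply/orP.
  by left; lra.
by right; lra.
Qed.

(** From the line where B is indifferent, off [e], the orbit enters an outgoing quadrant; both
    coordinates then relax towards the corner of that quadrant, which preserves their signs. The
    first sign is claimed for positive times, as that coordinate vanishes at [t0]. *)
Let outgoing_quadrant tau t0 s : tau = 1 \/ tau = -1 -> 0 <= t0 ->
  xcoord e (p t0) = 0 -> 0 < tau * (slopeA A * ycoord e (p t0)) ->
  0 < tau * ((0 < tau)%R%:R - e.1 0 0) ->
  0 < tau * (slopeA A * ((0 < sgn * tau)%R%:R - e.2 0 0)) -> 0 <= s ->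
  0 < tau * (slopeA A * ycoord e (p (t0 + s))) /\
  (0 < s -> 0 < tau * xcoord e (p (t0 + s))).
Proof.
move=> htau t00 x0 tau0 tauM sgM; have hsg := sgn_unit htau.
have [sgn2 sgnB sgnA] := slopes_pos.
pose P s := 0 < tau * (slopeA A * ycoord e (p (t0 + s))) /\
  (0 < s -> 0 < tau * xcoord e (p (t0 + s))).
have exp1 (a c : R) : a < c -> 0 < expR (a - c) < 1.
  by move=> ac_; rewrite expR_gt0 -[ltRHS]expR0 ltr_expR /=; lra.
move=> s0; apply: (@real_induction _ P s) => //.
- by split; [rewrite addr0|rewrite ltxx].
- move=> c cs [Pc1 Pc2].
  pose d := tau * (slopeA A * ycoord e (p (t0 + c))) / `|slopeA A|.
  have d0 : 0 < d by rewrite divr_gt0 // normr_gt0.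
  have yP u : c <= u < c + d -> 0 < tau * (slopeA A * ycoord e (p (t0 + u))).
    move=> cu.
    have [_ hy] := coord_near (ltac:(lra) : 0 <= t0 + c) (ltac:(lra) : 0 <= t0 + u).
    have : `|tau * (slopeA A * (ycoord e (p (t0 + u)) - ycoord e (p (t0 + c))))| <
        tau * (slopeA A * ycoord e (p (t0 + c))).
      have v1 : `|tau| = 1 by case: htau => ->; rewrite ?normrN normr1.
      rewrite !normrM v1 mul1r mulrC -ltr_pdivlMr ?normr_gt0 // -/d.
      by apply: le_lt_trans hy _; rewrite ger0_norm; lra.
    by rewrite ltr_norml => /andP[h _]; lra.
  exists d => // u cu us; split; first by apply: yP; lra.
  move=> u0; have E := @row_law tau (t0 + c) (t0 + u) htau ltac:(lra) ltac:(lra).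
  have {}E := E ltac:(move=> w hw; have := yP (w - t0) ltac:(lra);
    by rewrite addrC subrK).
  have xc : 0 <= tau * xcoord e (p (t0 + c)).
    have [c0|c0] := ltP 0 c; first exact/ltW/Pc2.
    have -> : c = 0 by lra.
    by rewrite addr0 x0 mulr0.
  have /andP[e0 e1] := exp1 (t0 + c) (t0 + u) ltac:(lra).
  move: E; set Ex := expR _ in e0 e1 *; set M := _ - e.1 0 0 in tauM * => E.
  have -> : tau * xcoord e (p (t0 + u)) =
    tau * M * (1 - Ex) + Ex * (tau * xcoord e (p (t0 + c))).
    by have -> : xcoord e (p (t0 + u)) = M + Ex * (xcoord e (p (t0 + c)) - M);
      [lra|ring].
  by rewrite ltr_pwDl //; [apply: mulr_gt0; lra|apply: mulr_ge0; lra].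
- move=> c cs h.
  have Ex1 := exp1 t0 (t0 + c) ltac:(lra).
  have Er := @row_law tau t0 (t0 + c) htau t00 ltac:(lra).
  have {}Er := Er ltac:(move=> w hw; have [+ _] := h (w - t0) ltac:(lra);
    by rewrite addrC subrK).
  have Ec := @col_law (sgn * tau) t0 (t0 + c) hsg t00 ltac:(lra).
  have {}Ec : ycoord e (p (t0 + c)) - ((0 < sgn * tau)%R%:R - e.2 0 0) =
      expR (t0 - (t0 + c)) * (ycoord e (p t0) - ((0 < sgn * tau)%R%:R - e.2 0 0)).
    apply: Ec => w hw; have [_ +] := h (w - t0) ltac:(lra).
    rewrite (_ : t0 + (w - t0) = w); last ring.
    move=> /(_ ltac:(lra)) hx.
    by have := mulr_gt0 sgnB hx; congr (0 < _); ring.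
  move: Er Ec; rewrite x0; set Ex := expR _ in Ex1 *.
  set M := _ - e.1 0 0 in tauM *; set M' := _ - e.2 0 0 in sgM * => Er Ec.
  split.
    have -> : ycoord e (p (t0 + c)) = M' * (1 - Ex) + Ex * ycoord e (p t0) by lra.
    have -> : tau * (slopeA A * (M' * (1 - Ex) + Ex * ycoord e (p t0))) =
      tau * (slopeA A * M') * (1 - Ex) + Ex * (tau * (slopeA A * ycoord e (p t0))).
      by ring.
    by apply: addr_gt0; apply: mulr_gt0; lra.
  move=> _; have -> : xcoord e (p (t0 + c)) = M * (1 - Ex) by lra.
  by rewrite mulrA; apply: mulr_gt0; lra.
Qed.

(** If the first coordinate never vanishes, its sign is constant. Otherwise it vanishes away from
    [e], and the orbit then remains in an outgoing quadrant. Either way one column is strictly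
    preferred from some time on. *)
Lemma saddle_exit (m0 : R) : 0 < m0 ->
  [/\ m0 <= e.1 0 0, m0 <= 1 - e.1 0 0, m0 <= e.2 0 0, m0 <= 1 - e.2 0 0 & m0 <= 1] ->
  (forall t, 0 <= t -> p t <> e) -> exists2 t, 0 <= t & m0 / 2 <= `|p t - e|.
Proof.
move=> m00 [m1 m2 m3 m4 m5] ne.
have [nz|] := pselect (forall t, 0 <= t -> xcoord e (p t) != 0).
  have [v hv v0] := nonzero_sign (mulf_neq0 slopeB_neq0 (nz 0 (lexx 0))).
  apply: (exit_constant_side m00 m3 m4 hv (lexx 0)) => t t0.
  apply: (@real_induction _ (fun t => 0 < v * (slopeB B * xcoord e (p t))) t) => //.
  - move=> c ct Pc; pose d := v * (slopeB B * xcoord e (p c)) / `|slopeB B|.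
    have d0 : 0 < d by rewrite divr_gt0 // normr_gt0.
    exists d => // s cs st; have [hx _] := coord_near (proj1 (andP ct)) (ltac:(lra) : 0 <= s).
    have : `|v * (slopeB B * (xcoord e (p s) - xcoord e (p c)))| <
        v * (slopeB B * xcoord e (p c)).
      have v1 : `|v| = 1 by case: hv => ->; rewrite ?normrN normr1.
      rewrite !normrM v1 mul1r mulrC -ltr_pdivlMr ?normr_gt0 // -/d.
      by apply: le_lt_trans hx _; rewrite gtr0_norm; lra.
    by rewrite ltr_norml => /andP[h _]; lra.
  - move=> c ct h.
    have ge : 0 <= v * (slopeB B * xcoord e (p c)).
      apply: eps_ler => eps eps0.
      pose s := Num.max 0 (c - eps / (`|slopeB B| + 1)).
      have B1 : 0 < `|slopeB B| + 1 by rewrite ltr_wpDl.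
      have d0 : 0 < eps / (`|slopeB B| + 1) by exact: divr_gt0.
      have s0 : 0 <= s by rewrite le_max lexx.
      have sc : s < c by rewrite gt_max; apply/andP; split; lra.
      have sd : c - s <= eps / (`|slopeB B| + 1).
        by have : c - eps / (`|slopeB B| + 1) <= s; [rewrite le_max lexx orbT|lra].
      have [hx _] := coord_near s0 (ltac:(lra) : 0 <= c).
      rewrite (gtr0_norm (_ : 0 < c - s)) in hx; last lra.
      have := h s (introT andP (conj s0 sc)).
      have : `|v * (slopeB B * (xcoord e (p c) - xcoord e (p s)))| <= eps.
        have v1 : `|v| = 1 by case: hv => ->; rewrite ?normrN normr1.
        rewrite !normrM v1 mul1r.
        apply: (@le_trans _ _ ((`|slopeB B| + 1) * (eps / (`|slopeB B| + 1)))).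
          by apply: ler_pM => //; [rewrite lerDl|apply: le_trans hx sd].
        by rewrite mulrC divfK // gt_eqF.
      by rewrite ler_norml => /andP[k1 _] k2; lra.
    rewrite lt_neqAle ge andbT eq_sym !mulf_neq0 //; last by apply: nz; lra.
    by case: hv => ->; rewrite ?oppr_eq0 oner_eq0.
move=> /existsNP[t0 /not_implyP[t00 /negP/negPn/eqP x0]].
have y0 : ycoord e (p t0) != 0.
  by apply: contra_notN (ne t0 t00) => /eqP y0; apply: (coord_eq0 he (simp t00)).
have [tau htau tau0] := nonzero_sign (mulf_neq0 slopeA_neq0 y0).
have hsg := sgn_unit htau; have [sgn2 sgnB sgnA] := slopes_pos.
have tauM : 0 < tau * ((0 < tau)%R%:R - e.1 0 0).
  by case: htau => ->; rewrite ?ltr01 ?ltr0N1 /=; lra.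
have sgM : 0 < tau * (slopeA A * ((0 < sgn * tau)%R%:R - e.2 0 0)).
  have : 0 < sgn * tau * ((0 < sgn * tau)%R%:R - e.2 0 0).
    by case: hsg => ->; rewrite ?ltr01 ?ltr0N1 /=; lra.
  by move=> /(mulr_gt0 sgnA); congr (0 < _); rewrite -[RHS]mul1r -sgn2; ring.
have allP s := outgoing_quadrant (s := s) htau t00 x0 tau0 tauM sgM.
apply: (exit_constant_side m00 m3 m4 hsg (ltac:(lra) : 0 <= t0 + 1)) => t tt.
have [_ +] := allP (t - t0) ltac:(lra).
rewrite (_ : t0 + (t - t0) = t); last ring.
move=> /(_ ltac:(lra)) hx.
by have := mulr_gt0 sgnB hx; congr (0 < _); ring.
Qed.

End Exit.

Lemma saddle2_saddle : saddle A B e.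
Proof.
have [m0 m00 hm] := equilibrium_margin he.
split.
  exists sgn; first by case: slopes_sign => -[-> _]; [left|right].
  by move=> tau htau; split; [apply: saddle_incoming|apply: saddle_outgoing].
exists (m0 / 2); first lra.
by move=> p sp _ ne; apply: saddle_exit hm ne.
Qed.

End Saddle.

(** * The three cases *)

Section Interior2.
Context {R : realType}.
Variables (A B : 'M[R]_2) (k l : 'I_2) (kl : k != l).

Let dich (s : 'I_2) : s = k \/ s = l.
Proof.
by move: kl; have [->|->] := ord2P k; have [->|->] := ord2P l;
  have [->|->] := ord2P s => //; auto.
Qed.

Lemma interior_from_gaps (e : 'rV[R]_2 * 'cV[R]_2) : simplexAB e ->
  0 < e.1 0 0 < 1 -> 0 < e.2 k 0 < 1 -> gapA A 0 1 e = 0 -> gapB B k l e = 0 ->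
  interior_equilibrium A B e.
Proof.
move=> se p1 p2 /eqP; rewrite subr_eq0 => /eqP gA /eqP.
rewrite subr_eq0 => /eqP gB; have [s1 s2] := se.
split => //.
- split=> i; first by have [->|->] := ord2P i; rewrite ?(simplexA2 s1); lra.
  have [->|->] := dich i; first lra.
  have : e.2 k 0 + e.2 l 0 = 1.
    by apply: (supp2_weights kl (w := fun r => e.2 r 0)) s2.2 => r _;
      rewrite !inE; have [->|->] := dich r; rewrite eqxx ?orbT.
  lra.
- by move=> i i'; have [->|->] := ord2P i; have [->|->] := ord2P i'.
- by move=> i i'; have [->|->] := dich i; have [->|->] := dich i'.
Qed.

Lemma spiral2_interior : spiral_signs A B 0 1 k l ->
  interior_equilibrium A B (spiral_equilibrium A B 0 1 k l).
Proof.
move=> sg; have I01 : (0 : 'I_2) != 1 by [].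
have [se _ _] := spiral_equilibrium_supported sg.
have [w1 w2] := spiral_equilibrium_weights I01 kl sg.
apply: interior_from_gaps => //.
  by apply: spiral_equilibrium_gapA.
by apply: spiral_equilibrium_gapB.
Qed.

(** Changing the sign of [B] turns a saddle into a cyclic game with the same indifference lines. *)
Lemma saddle2_interior : saddle_signs A B 0 1 k l ->
  interior_equilibrium A B (spiral_equilibrium A (- B) 0 1 k l).
Proof.
move=> [h1 h2 h3 h4]; have I01 : (0 : 'I_2) != 1 by [].
have sg : spiral_signs A (- B) 0 1 k l by split; rewrite // !mxE ltrN2.
have [se _ _] := spiral_equilibrium_supported sg.
have [w1 w2] := spiral_equilibrium_weights I01 kl sg.
apply: interior_from_gaps => //.
  by apply: spiral_equilibrium_gapA.
have : gapB (- B) k l (spiral_equilibrium A (- B) 0 1 k l) = 0.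
  by apply: spiral_equilibrium_gapB.
rewrite !gapBE => E.
apply/eqP; rewrite -oppr_eq0 -sumrN; apply/eqP; rewrite -[RHS]E.
apply: eq_bigr => i _; rewrite ![(- B) _ _]mxE; ring.
Qed.

Lemma saddle2_slopes : saddle_signs A B 0 1 k l -> 0 < slopeA A * slopeB B.
Proof.
move=> [s1 s2 s3 s4]; rewrite /slopeA /slopeB.
move: kl s1 s2 s3 s4; have [->|->] := ord2P k; have [->|->] := ord2P l => // _ s1 s2 s3 s4.
  by rewrite pmulr_rgt0; lra.
by rewrite nmulr_rgt0; lra.
Qed.

(** Every strategy is a best reply to an interior equilibrium, so the results on codimension two
    points apply inside the 2 x 2 subgame. *)
Lemma interior2_codim2 e : interior_equilibrium A B e -> codim2_at A B 0 1 k l e.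
Proof.
move=> [se _ hA hB]; split => // r; split => _.
- exact: ord2P.
- by move=> s; rewrite (hA s r).
- exact: dich.
- by move=> s; rewrite (hB s r).
Qed.

End Interior2.

Section Cases.
Context {R : realType} {m n : nat}.
Notation profile := ('rV[R]_m * 'cV[R]_n)%type.
Variables (A B : 'M[R]_(m, n)).
Implicit Types (z w : profile) (i j : 'I_m) (k l : 'I_n).

Lemma subgameE (C : 'M[R]_(m, n)) i j k l :
  [/\ subgame C i j k l 0 0 = C i k, subgame C i j k l 0 1 = C i l,
      subgame C i j k l 1 0 = C j k & subgame C i j k l 1 1 = C j l].
Proof. by split; rewrite mxE. Qed.

Lemma case2_of_spiral i j k l : spiral_signs A B i j k l \/ spiral_signs A B i j l k ->
  case2 A B i j k l.
Proof.
have [a1 a2 a3 a4] := subgameE A i j k l; have [b1 b2 b3 b4] := subgameE B i j k l.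
set A2 := subgame A i j k l in a1 a2 a3 a4; set B2 := subgame B i j k l in b1 b2 b3 b4.
move=> h.
have [k' [l' [kl sg]]] : exists k' l' : 'I_2, k' != l' /\ spiral_signs A2 B2 0 1 k' l'.
  case: h => -[h1 h2 h3 h4]; [exists 0, 1|exists 1, 0]; split => //; split;
    by rewrite ?a1 ?a2 ?a3 ?a4 ?b1 ?b2 ?b3 ?b4.
have he := spiral2_interior kl sg.
exists (spiral_equilibrium A2 B2 0 1 k' l'); split => //.
- exact: (spiral2_stable kl sg he).
- exact: (spiral2_spirals kl sg he).
- exact: (spiral2_extends kl sg).
Qed.

Lemma saddle_subgame i j k l : saddle_signs A B i j k l \/ saddle_signs A B i j l k ->
  exists k' l' : 'I_2, k' != l' /\
    saddle_signs (subgame A i j k l) (subgame B i j k l) 0 1 k' l'.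
Proof.
have [a1 a2 a3 a4] := subgameE A i j k l; have [b1 b2 b3 b4] := subgameE B i j k l.
by case=> -[h1 h2 h3 h4]; [exists 0, 1|exists 1, 0]; split => //; split;
  rewrite ?a1 ?a2 ?a3 ?a4 ?b1 ?b2 ?b3 ?b4.
Qed.

Lemma case3_of_saddle i j k l : saddle_signs A B i j k l \/ saddle_signs A B i j l k ->
  case3 A B i j k l.
Proof.
move=> /saddle_subgame[k' [l' [kl sg]]].
have he := saddle2_interior kl sg; have c2 := interior2_codim2 kl he.
exists (spiral_equilibrium (subgame A i j k l) (- subgame B i j k l) 0 1 k' l').
split => //.
- exact: saddle2_saddle he (saddle2_slopes kl sg).
- exact: weak_saddle_not_converges c2 (saddle_signs_weak sg).
- exact: saddle_not_unique c2 sg.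
Qed.

Lemma saddle_not_case1 i j k l z :
  saddle_signs A B i j k l \/ saddle_signs A B i j l k -> ~ case1 A B i j k l z.
Proof.
move=> /saddle_subgame[k' [l' [kl sg]]] [h _]; apply: h.
by eexists; apply: (saddle2_interior kl sg).
Qed.

Lemma same_sign_comb (a b x y : R) : 0 < a * b -> 0 <= x -> 0 <= y -> 0 < x + y ->
  x * a + y * b != 0.
Proof.
move=> ab x0 y0 xy; have [a0|a0] := ltP 0 a.
  have b0 : 0 < b by rewrite pmulr_rgt0 in ab.
  rewrite gt_eqF //; have [x1|x1] := ltP 0 x.
    by rewrite ltr_pwDl ?mulr_gt0 // mulr_ge0 // ltW.
  have y1 : 0 < y by lra.
  by rewrite ltr_wpDl ?mulr_gt0 // mulr_ge0 // ltW.
have an : a < 0.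
  by rewrite lt_neqAle a0 andbT; apply: contraTneq ab => ->; rewrite mul0r ltxx.
have b0 : b < 0 by rewrite nmulr_rgt0 in ab.
rewrite lt_eqF // -oppr_gt0 opprD -!mulrN; have [x1|x1] := ltP 0 x.
  by rewrite ltr_pwDl ?mulr_gt0 ?oppr_gt0 // mulr_ge0 // oppr_ge0 ltW.
have y1 : 0 < y by lra.
by rewrite ltr_wpDl ?mulr_gt0 ?oppr_gt0 // mulr_ge0 // oppr_ge0 ltW.
Qed.

Lemma codim2_supported i j k l z b : codim2_at A B i j k l z -> BRAB A B z b ->
  supported [set i; j]%SET [set k; l]%SET b.
Proof.
move=> [_ _ _ hA hB]; apply: confined_supported; split=> r.
  by rewrite hA !inE => -[]->; rewrite eqxx ?orbT.
by rewrite hB !inE => -[]->; rewrite eqxx ?orbT.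
Qed.

(** The gap between the rows vanishes at [z], so its velocity is a convex combination of two payoff
    differences of the same sign. This excludes tangency and, in the subgame, indifference at an
    interior profile. *)
Lemma case1_row i j k l z : codim2_at A B i j k l z ->
  0 < (A i k - A j k) * (A i l - A j l) -> case1 A B i j k l z.
Proof.
move=> cz sgn; have [sz ij kl hA hB] := cz; split.
  move=> [e [[_ e2] [_ p2] /(_ 0 1) + _]].
  have [a1 a2 a3 a4] := subgameE A i j k l.
  rewrite !mxE !sum2 a1 a2 a3 a4 => E.
  have /eqP := @same_sign_comb _ _ (e.2 0 0) (e.2 1 0) sgn (ltW (p2 0)) (ltW (p2 1))
    (addr_gt0 (p2 0) (p2 1)); apply.
  lra.
right=> w [b hb <-]; have sb := codim2_supported cz hb.
have [gA _] := codim2_gap cz.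
have -> : (b - z).2 = b.2 - z.2 by [].
rewrite mulmxBr !mxE -subr_eq0.
have [[_ [b0 b1]] _ h2] := sb.
have := supported_gapA A kl sb; have w1 := supp2_weights kl h2 b1.
move: gA; rewrite /gapA /payA !mxE => gA gAb.
have -> : \sum_j0 A i j0 * b.2 j0 0 - \sum_j0 A i j0 * z.2 j0 0 -
  (\sum_j0 A j j0 * b.2 j0 0 - \sum_j0 A j j0 * z.2 j0 0) =
  b.2 k 0 * (A i k - A j k) + b.2 l 0 * (A i l - A j l).
  have e2 : b.2 l 0 = 1 - b.2 k 0 by lra.
  by rewrite e2; lra.
by apply: same_sign_comb => //; lra.
Qed.

Lemma case1_col i j k l z : codim2_at A B i j k l z ->
  0 < (B i k - B i l) * (B j k - B j l) -> case1 A B i j k l z.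
Proof.
move=> cz sgn; have [sz ij kl hA hB] := cz; split.
  move=> [e [[e1 _] [p1 _] _ /(_ 0 1)]].
  have [a1 a2 a3 a4] := subgameE B i j k l.
  rewrite !mxE !sum2 a1 a2 a3 a4 => E.
  have /eqP := @same_sign_comb _ _ (e.1 0 0) (e.1 0 1) sgn (ltW (p1 0)) (ltW (p1 1))
    (addr_gt0 (p1 0) (p1 1)); apply.
  lra.
left=> w [b hb <-]; have sb := codim2_supported cz hb.
have [_ gB] := codim2_gap cz.
have -> : (b - z).1 = b.1 - z.1 by [].
rewrite mulmxBl !mxE -subr_eq0.
have [[[b0 b1] _] h1 _] := sb.
have := supported_gapB B ij sb; have w1 := supp2_weights ij h1 b1.
move: gB; rewrite /gapB /payB !mxE => gB gBb.
have -> : \sum_j0 b.1 0 j0 * B j0 k - \sum_j0 z.1 0 j0 * B j0 k -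
  (\sum_j0 b.1 0 j0 * B j0 l - \sum_j0 z.1 0 j0 * B j0 l) =
  b.1 0 i * (B i k - B i l) + b.1 0 j * (B j k - B j l).
  have e2 : b.1 0 j = 1 - b.1 0 i by lra.
  by rewrite e2; lra.
by apply: same_sign_comb => //; lra.
Qed.

Lemma codim2_best_sets i j k l z : codim2_at A B i j k l z ->
  bestAset A z = [set i; j]%SET /\ bestBset B z = [set k; l]%SET.
Proof.
move=> [_ _ _ hA hB]; apply: best_setsE; split=> r; rewrite !inE.
  by rewrite hA; split => [[]->|/orP[]/eqP->]; rewrite ?eqxx ?orbT //; [left|right].
by rewrite hB; split => [[]->|/orP[]/eqP->]; rewrite ?eqxx ?orbT //; [left|right].
Qed.

End Cases.

(** * The family of 3 x 3 games *)

Section ReducibleLine.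
Context {R : realType} {m n : nat}.
Variables (A B : 'M[R]_(m, n)).
Implicit Types (I : {set 'I_m}) (J : {set 'I_n}).

Lemma reducible_1xn i J : (forall k l, k != l -> B i k != B i l) ->
  (exists k, k \in J) -> reducible A B [set i]%SET J.
Proof.
move=> inj; have [N] := ubnP #|J|; elim: N J => // N IH J JN [k kJ].
have [[l lJ lk]|h] := pselect (exists2 l, l \in J & l != k); last first.
  suff -> : J = [set k]%SET by apply: reducible_pure.
  apply/finset.setP => r; rewrite inE; apply/idP/eqP => [rJ|-> //].
  by apply/eqP/negPn/negP => rk; apply: h; exists r.
have small s : s \in J -> (#|(J :\ s)%SET| < N)%N.
  by move=> sJ; move: JN; rewrite (cardsD1 s J) sJ ltnS.
have := inj _ _ lk; rewrite neq_lt => /orP[h|h].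
  apply: (@reducible_col _ _ _ _ _ _ _ k l) => //; rewrite 1?eq_sym //.
    by move=> r; rewrite inE => /eqP->.
  by apply: IH; [apply: small|exists k; rewrite !inE eq_sym lk].
apply: (@reducible_col _ _ _ _ _ _ _ l k) => //.
  by move=> r; rewrite inE => /eqP->.
by apply: IH; [apply: small|exists l; rewrite !inE lk].
Qed.

Lemma reducible_nx1 I k : (forall i j, i != j -> A i k != A j k) ->
  (exists i, i \in I) -> reducible A B I [set k]%SET.
Proof.
move=> inj; have [N] := ubnP #|I|; elim: N I => // N IH I JN [i iI].
have [[l lJ lk]|h] := pselect (exists2 l, l \in I & l != i); last first.
  suff -> : I = [set i]%SET by apply: reducible_pure.
  apply/finset.setP => r; rewrite inE; apply/idP/eqP => [rJ|-> //].
  by apply/eqP/negPn/negP => rk; apply: h; exists r.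
have small s : s \in I -> (#|(I :\ s)%SET| < N)%N.
  by move=> sJ; move: JN; rewrite (cardsD1 s I) sJ ltnS.
have := inj _ _ lk; rewrite neq_lt => /orP[h|h].
  apply: (@reducible_row _ _ _ _ _ _ _ i l) => //; rewrite 1?eq_sym //.
    by move=> r; rewrite inE => /eqP->.
  by apply: IH; [apply: small|exists i; rewrite !inE eq_sym lk].
apply: (@reducible_row _ _ _ _ _ _ _ l i) => //.
  by move=> r; rewrite inE => /eqP->.
by apply: IH; [apply: small|exists l; rewrite !inE lk].
Qed.

End ReducibleLine.

Lemma same_sign_mul_gt0 (R : realType) (x y : R) :
  (0 < x /\ 0 < y) \/ (x < 0 /\ y < 0) -> 0 < x * y.
Proof.
by case=> -[x0 y0]; [apply: mulr_gt0|rewrite nmulr_rgt0].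
Qed.

Ltac case3 i := case: i => -[|[|[|//]]] ?.

Lemma cyclic_pair (i j : 'I_3) : i != j -> j = i + 1 \/ i = j + 1.
Proof.
by case3 i; case3 j => // _; first [left; exact: val_inj|right; exact: val_inj].
Qed.

Lemma cyclic_third (i : 'I_3) : forall r, r != i -> r != i + 1 -> r = i + 2%:R.
Proof. by move=> r; case3 i; case3 r => // _ _; exact: val_inj. Qed.

Section Family.
Context {R : realType}.
Variable beta : R.
Hypothesis hbeta : -1 < beta < 1.
Notation A := (Abeta beta).
Notation B := (Bbeta beta).
Notation profile := ('rV[R]_3 * 'cV[R]_3)%type.
Implicit Types (z x : profile) (i j k l : 'I_3).

(** A column of A consists of 1, [beta] and 0, so [beta = 0] gives the only coincidence. This is
    transversality for the family, and it breaks ties against a pure column. *)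
Lemma A_col_inj k i j : beta != 0 -> i != j -> A i k != A j k.
Proof.
move: (hbeta) => hb b0; case3 i; case3 j; case3 k; move=> // _;
  rewrite !mxE /=; first [by [] | by rewrite eq_sym | rewrite neq_lt; lra
   | by rewrite lt_eqF //; lra | by rewrite gt_eqF //; lra].
Qed.

Lemma B_row_inj i k l : beta != 0 -> k != l -> B i k != B i l.
Proof.
move: (hbeta) => hb b0; case3 i; case3 k; case3 l; move=> // _;
  rewrite !mxE /=; first [by [] | by rewrite oppr_eq0 | by rewrite eq_sym oppr_eq0
   | by rewrite lt_eqF //; lra | by rewrite gt_eqF //; lra].
Qed.

Lemma signs_pos i j k l : 0 < beta -> i != j -> k != l ->
  [\/ 0 < (A i k - A j k) * (A i l - A j l),
      0 < (B i k - B i l) * (B j k - B j l),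
      spiral_signs A B i j k l | spiral_signs A B i j l k].
Proof.
move: (hbeta) => hb b0 ij kl.
(* Exchanging [i] with [j], or [k] with [l], permutes the four alternatives, so cyclically
   consecutive pairs suffice. *)
wlog -> : i j ij / j = i + 1.
  move=> h; have [E|E] := cyclic_pair ij; first exact: h.
  have [|h1|h2|[h1 h2 h3 h4]|[h1 h2 h3 h4]] := h j i _ E; first by rewrite eq_sym.
  - by apply: Or41; rewrite -mulrNN !opprB.
  - by apply: Or42; rewrite mulrC.
  - by apply: Or44.
  - by apply: Or43.
wlog -> : k l kl / l = k + 1.
  move=> h; have [E|E] := cyclic_pair kl; first exact: h.
  have [|h1|h2|h3|h3] := h l k _ E; first by rewrite eq_sym.
  - by apply: Or41; rewrite mulrC.
  - by apply: Or42; rewrite -mulrNN !opprB.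
  - by apply: Or44.
  - by apply: Or43.
clear ij kl; case3 i; case3 k; rewrite /spiral_signs !mxE /=;
  first [ by apply: Or41; apply: same_sign_mul_gt0; first [left; lra|right; lra]
        | by apply: Or42; apply: same_sign_mul_gt0; first [left; lra|right; lra]
        | by apply: Or43; split; lra | by apply: Or44; split; lra].
Qed.

Lemma signs_neg i j k l : beta < 0 -> i != j -> k != l ->
  [\/ 0 < (A i k - A j k) * (A i l - A j l),
      0 < (B i k - B i l) * (B j k - B j l),
      saddle_signs A B i j k l | saddle_signs A B i j l k].
Proof.
move: (hbeta) => hb b0 ij kl.
wlog -> : i j ij / j = i + 1.
  move=> h; have [E|E] := cyclic_pair ij; first exact: h.
  have [|h1|h2|[h1 h2 h3 h4]|[h1 h2 h3 h4]] := h j i _ E; first by rewrite eq_sym.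
  - by apply: Or41; rewrite -mulrNN !opprB.
  - by apply: Or42; rewrite mulrC.
  - by apply: Or44.
  - by apply: Or43.
wlog -> : k l kl / l = k + 1.
  move=> h; have [E|E] := cyclic_pair kl; first exact: h.
  have [|h1|h2|h3|h3] := h l k _ E; first by rewrite eq_sym.
  - by apply: Or41; rewrite mulrC.
  - by apply: Or42; rewrite -mulrNN !opprB.
  - by apply: Or44.
  - by apply: Or43.
clear ij kl; case3 i; case3 k; rewrite /saddle_signs !mxE /=;
  first [ by apply: Or41; apply: same_sign_mul_gt0; first [left; lra|right; lra]
        | by apply: Or42; apply: same_sign_mul_gt0; first [left; lra|right; lra]
        | by apply: Or43; split; lra | by apply: Or44; split; lra].
Qed.

Let o0 : 'I_3 := @Ordinal 3 0 isT.
Let o1 : 'I_3 := @Ordinal 3 1 isT.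
Let o2 : 'I_3 := @Ordinal 3 2 isT.

Lemma ord3P i : [\/ i = o0, i = o1 | i = o2].
Proof.
by case3 i; [apply: Or31|apply: Or32|apply: Or33]; apply: val_inj.
Qed.

Lemma sum3 (F : 'I_3 -> R) : \sum_i F i = F o0 + F o1 + F o2.
Proof.
rewrite !big_ord_recl big_ord0 addr0 addrA; congr (F _ + F _ + F _); exact: val_inj.
Qed.

Lemma payA3 z i : payA A z i = A i o0 * z.2 o0 0 + A i o1 * z.2 o1 0 + A i o2 * z.2 o2 0.
Proof. by rewrite payAE sum3. Qed.

Lemma payB3 z k : payB B z k = z.1 0 o0 * B o0 k + z.1 0 o1 * B o1 k + z.1 0 o2 * B o2 k.
Proof. by rewrite payBE sum3. Qed.

End Family.

Lemma set3_cases (S : {set 'I_3}) : (exists a, a \in S) ->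
  [\/ exists a, S = [set a]%SET,
      exists a b, a != b /\ S = [set a; b]%SET | S = [set: 'I_3]%SET].
Proof.
move=> [a aS]; have S3 : (#|S| <= 3)%N by have := max_card (mem S); rewrite card_ord.
have S0 : (0 < #|S|)%N by rewrite card_gt0; apply/finset.set0Pn; exists a.
have [/cards1P[b ->]|n1] := boolP (#|S| == 1)%N; first by apply: Or31; exists b.
have [/cards2P[b [c [bc ->]]]|n2] := boolP (#|S| == 2)%N.
  by apply: Or32; exists b, c.
apply: Or33; apply/eqP; rewrite eqEcard finset.subsetT cardsT card_ord /=.
by case: #|S| S0 n1 n2 => [|[|[|]]].
Qed.

Lemma setT3D1 (l : 'I_3) : exists c d : 'I_3, c != d /\ ([set: 'I_3] :\ l = [set c; d])%SET.
Proof.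
apply/cards2P; have := cardsD1 l [set: 'I_3]%SET.
by rewrite inE cardsT card_ord => -[] E; apply/eqP.
Qed.

Section Family.
Context {R : realType}.
Variable beta : R.
Hypothesis hbeta : -1 < beta < 1.
Notation A := (Abeta beta).
Notation B := (Bbeta beta).
Notation profile := ('rV[R]_3 * 'cV[R]_3)%type.
Implicit Types (z x : profile) (i j k l : 'I_3).

Let o0 : 'I_3 := @Ordinal 3 0 isT.
Let o1 : 'I_3 := @Ordinal 3 1 isT.
Let o2 : 'I_3 := @Ordinal 3 2 isT.

(** Eliminating column [l] reduces a 2 x 3 game of best responses to a 2 x 2 one. *)
Lemma B_dominated i j : 0 < beta -> i != j ->
  exists k l, [/\ k != l, B i l < B i k & B j l < B j k].
Proof.
move: (hbeta) => hb b0; case3 i; case3 j; move=> // _;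
first [ by exists o0, o1; split; rewrite // !mxE /=; lra
      | by exists o1, o0; split; rewrite // !mxE /=; lra
      | by exists o0, o2; split; rewrite // !mxE /=; lra
      | by exists o2, o0; split; rewrite // !mxE /=; lra
      | by exists o1, o2; split; rewrite // !mxE /=; lra
      | by exists o2, o1; split; rewrite // !mxE /=; lra].
Qed.

Lemma A_dominated k l : 0 < beta -> k != l ->
  exists i j, [/\ i != j, A j k < A i k & A j l < A i l].
Proof.
move: (hbeta) => hb b0; case3 k; case3 l; move=> // _;
first [ by exists o0, o1; split; rewrite // !mxE /=; lra
      | by exists o1, o0; split; rewrite // !mxE /=; lra
      | by exists o0, o2; split; rewrite // !mxE /=; lra
      | by exists o2, o0; split; rewrite // !mxE /=; lra
      | by exists o1, o2; split; rewrite // !mxE /=; lra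
      | by exists o2, o1; split; rewrite // !mxE /=; lra].
Qed.

(** At a point with two best rows and three best columns, which is singular for negative [beta],
    this strict equilibrium serves as target of the flow. It comes from the fact that column [u + 1]
    is the strict best reply to row [u]. *)
Lemma strict_2x3 i j : beta < 0 -> i != j ->
  exists a k, [/\ a \in [set i; j]%SET,
    forall r, r \in [set i; j]%SET -> r != a -> A r k < A a k &
    forall s, s != k -> B a s < B a k].
Proof.
move: (hbeta) => hb b0 ij.
suff [a [b [k [E ab h]]]] : exists a b k, [/\ [set i; j]%SET = [set a; b]%SET,
    A b k < A a k & forall s, s != k -> B a s < B a k].
  exists a, k; rewrite E; split => //; first by rewrite !inE eqxx.
  by move=> r; rewrite !inE => /orP[]/eqP-> //; rewrite eqxx.
have C := finset.setUC [set i]%SET [set j]%SET.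
have key u : forall s, s != u + 1 -> B u s < B u (u + 1).
  by move=> s; case3 u; case3 s => //= _; rewrite !mxE /=; lra.
have [h|h] : A j (i + 1) < A i (i + 1) \/ A i (j + 1) < A j (j + 1).
  by move: ij; clear C; case3 i; case3 j => // _; rewrite !mxE /=; first [left; lra|right; lra].
- by exists i, j, (i + 1); split => //; apply: key.
- by exists j, i, (j + 1); split => //; apply: key.
Qed.

Lemma strict_3x2 k l : beta < 0 -> k != l ->
  exists i a, [/\ a \in [set k; l]%SET,
    forall r, r != i -> A r a < A i a &
    forall s, s \in [set k; l]%SET -> s != a -> B i s < B i a].
Proof.
move: (hbeta) => hb b0 ij.
suff [i [a [b [E ab h]]]] : exists i a b, [/\ [set k; l]%SET = [set a; b]%SET,
    B i b < B i a & forall r, r != i -> A r a < A i a].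
  exists i, a; rewrite E; split => //; first by rewrite !inE eqxx.
  by move=> r; rewrite !inE => /orP[]/eqP-> //; rewrite eqxx.
have key u : forall s, s != u -> A s u < A u u.
  by move=> s; case3 u; case3 s => //= _; rewrite !mxE /=; lra.
have [h|h] : B k l < B k k \/ B l k < B l l.
  by move: ij; case3 k; case3 l => // _; rewrite !mxE /=; first [left; lra|right; lra].
- by exists k, k, l; split => //; apply: key.
- by exists l, l, k; split => //; [rewrite finset.setUC|apply: key].
Qed.

End Family.

(** * Full indifference, and positive [beta] *)

Section Family.
Context {R : realType}.
Variable beta : R.
Hypothesis hbeta : -1 < beta < 1.
Notation A := (Abeta beta).
Notation B := (Bbeta beta).
Notation profile := ('rV[R]_3 * 'cV[R]_3)%type.
Implicit Types (z x : profile) (i j k l : 'I_3).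

Lemma simplex_E : simplexAB (E : profile).
Proof.
by split; split => [i|] /=; rewrite ?sum3 !mxE ?invr_ge0 ?ler0n //; lra.
Qed.

Lemma BRAB_E : BRAB A B E E.
Proof.
have [s1 s2] := simplex_E; split; split => // i _ r.
  by rewrite -/(payA A E r) -/(payA A E i) !payA3; case3 r; case3 i; rewrite !mxE /=; lra.
by rewrite -/(payB B E r) -/(payB B E i) !payB3; case3 r; case3 i; rewrite !mxE /=; lra.
Qed.

Lemma cube_bound : -1 < beta ^+ 3 < 1.
Proof.
move: (hbeta) => /andP[h1 h2]; have h : 0 < (1 - beta) * (1 + beta) by apply: mulr_gt0; lra.
rewrite exprS expr2; set u := beta * beta.
have u0 : 0 <= u by rewrite /u -expr2 sqr_ge0.
have u1 : u <= 1 by rewrite /u; lra.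
have [b0|b0] := leP 0 beta.
  have h3 : 0 <= beta * u by apply: mulr_ge0.
  have h4 : 0 <= beta * (1 - u) by apply: mulr_ge0; lra.
  lra.
have h3 : 0 <= - beta * u by apply: mulr_ge0; lra.
have h4 : 0 <= - beta * (1 - u) by apply: mulr_ge0; lra.
lra.
Qed.

(** Deviations from 1/3 satisfy cyclic relations with factor [beta] for the row strategy and
    [- beta] for the column strategy. Going around once multiplies a deviation by the cube of the
    factor, which differs from 1. *)
Lemma all_best_E x : simplexAB x -> (forall i, bestA A x.2 i) ->
  (forall k, bestB B x.1 k) -> x = E.
Proof.
move: (hbeta) => /andP[h1 h2] [[_ s1] [_ s2]] hA hB.
have eA i j : payA A x i = payA A x j.
  by apply/eqP; rewrite eq_le; apply/andP; split; [apply: hA|apply: hA].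
have eB i j : payB B x i = payB B x j.
  by apply/eqP; rewrite eq_le; apply/andP; split; [apply: hB|apply: hB].
have a1 := eA 0 1; have a2 := eA 1 2; have b1 := eB 0 1; have b2 := eB 1 2.
rewrite !payA3 !mxE /= in a1 a2; rewrite !payB3 !mxE /= in b1 b2.
rewrite sum3 in s1; rewrite sum3 in s2.
set p0 := x.1 0 (Ordinal _) in s1 b1 b2; set p1 := x.1 0 (Ordinal _) in s1 b1 b2.
set p2 := x.1 0 (Ordinal _) in s1 b1 b2.
set q0 := x.2 (Ordinal _) 0 in s2 a1 a2; set q1 := x.2 (Ordinal _) 0 in s2 a1 a2.
set q2 := x.2 (Ordinal _) 0 in s2 a1 a2.
have /andP[cube1 cube2] := cube_bound.
have sp : beta * (p0 + p1 + p2) = beta by rewrite s1 mulr1.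
have sq : beta * (q0 + q1 + q2) = beta by rewrite s2 mulr1.
have Ep : [/\ p0 = 3^-1, p1 = 3^-1 & p2 = 3^-1].
  have e2 : p2 - 3^-1 = beta * (p0 - 3^-1) by lra.
  have e0 : p0 - 3^-1 = beta * (p1 - 3^-1) by lra.
  have e1 : p1 - 3^-1 = beta * (p2 - 3^-1) by lra.
  have z0 : p0 - 3^-1 = 0.
    have : (1 - beta ^+ 3) * (p0 - 3^-1) = 0.
      rewrite mulrBl mul1r [X in X - _]e0 e1 e2; ring.
    by move=> /eqP; rewrite mulf_eq0 => /orP[]/eqP; lra.
  by move: e1 e2; rewrite z0 mulr0 => e1 e2; rewrite e2 mulr0 in e1; split; lra.
have Eq : [/\ q0 = 3^-1, q1 = 3^-1 & q2 = 3^-1].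
  have e2 : q2 - 3^-1 = - beta * (q1 - 3^-1) by lra.
  have e0 : q0 - 3^-1 = - beta * (q2 - 3^-1) by lra.
  have e1 : q1 - 3^-1 = - beta * (q0 - 3^-1) by lra.
  have z0 : q0 - 3^-1 = 0.
    have : (1 + beta ^+ 3) * (q0 - 3^-1) = 0.
      rewrite mulrDl mul1r [X in X + _]e0 e2 e1; ring.
    by move=> /eqP; rewrite mulf_eq0 => /orP[]/eqP; lra.
  by move: e1 e2; rewrite z0 mulr0 => e1 e2; rewrite e1 mulr0 in e2; split; lra.
have [P0 P1 P2] := Ep; have [Q0 Q1 Q2] := Eq.
rewrite [x]surjective_pairing; congr (_, _).
  by apply/rowP => i; have [->|->|->] := ord3P i; rewrite mxE.
by apply/colP => i; have [->|->|->] := ord3P i; rewrite mxE.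
Qed.

Lemma reducible_22_pos i j k l : 0 < beta -> i != j -> k != l ->
  reducible A B [set i; j]%SET [set k; l]%SET.
Proof.
move=> b0 ij kl; have bn : beta != 0 by rewrite gt_eqF.
have [h|h|h|h] := signs_pos hbeta b0 ij kl.
- by apply: reducible_2x2_row => //; apply: B_row_inj.
- by apply: reducible_2x2_col => //; apply: A_col_inj.
- exact: reducible_spiral.
- by rewrite (finset.setUC [set k]%SET); apply: reducible_spiral; rewrite // eq_sym.
Qed.

(** Against a single strategy payoffs are distinct, 2 x 3 and 3 x 2 games lose a dominated strategy,
    and indifference among all strategies occurs only at [E]. *)
Lemma reducible_pos x : 0 < beta -> simplexAB x -> x <> E ->
  reducible A B (bestAset A x) (bestBset B x).
Proof.
move=> b0 sx xE; have bn : beta != 0 by rewrite gt_eqF.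
have neA := bestAset_nonempty A sx; have neB := bestBset_nonempty B sx.
have [[a EA]|[a [b [ab EA]]]|EA] := set3_cases neA.
- by rewrite EA; apply: reducible_1xn => // k l; apply: B_row_inj.
- rewrite EA; have [[k EB]|[k [l [kl EB]]]|EB] := set3_cases neB.
  + rewrite EB; apply: reducible_nx1 => [i j|]; first exact: A_col_inj.
    by rewrite -EA.
  + by rewrite EB; apply: reducible_22_pos.
  + rewrite EB; have [k [l [kl h1 h2]]] := B_dominated hbeta b0 ab.
    apply: (@reducible_col _ _ _ _ _ _ _ k l) => //.
      by move=> r; rewrite !inE => /orP[]/eqP->.
    by have [c [d [cd ->]]] := setT3D1 l; apply: reducible_22_pos.
- have [[k EB]|[k [l [kl EB]]]|EB] := set3_cases neB.
  + rewrite EB; apply: reducible_nx1 => // i j; exact: A_col_inj.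
  + rewrite EA EB; have [i [j [ij h1 h2]]] := A_dominated hbeta b0 kl.
    apply: (@reducible_row _ _ _ _ _ _ _ i j) => //.
      by move=> r; rewrite !inE => /orP[]/eqP->.
    by have [c [d [cd ->]]] := setT3D1 j; apply: reducible_22_pos.
  + case: xE; apply: all_best_E => // r.
      by apply/in_bestAset; rewrite EA inE.
    by apply/in_bestBset; rewrite EB inE.
Qed.

Lemma flow_off_E : 0 < beta -> defines_flow_off A B [set E].
Proof.
move=> b0; apply: flow_off => x sx; first exact: reducible_pos.
by move=> ->; right; apply: BRAB_E.
Qed.

Lemma extends_pos z : 0 < beta -> simplexAB z -> z <> E -> offZ_flow_extends A B z.
Proof.
move=> b0 sz zE; apply: (flow_off_extends (r := `|E - z|) (flow_off_E b0)).
  by rewrite normr_gt0 subr_eq0; apply/eqP => /esym.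
by move=> x sx xz xE; move: xz; rewrite xE ltxx.
Qed.

Lemma case12_pos z i j k l : 0 < beta -> codim2_at A B i j k l z ->
  case1 A B i j k l z \/ case2 A B i j k l.
Proof.
move=> b0 cz; have [_ ij kl _ _] := cz.
have [h|h|h|h] := signs_pos hbeta b0 ij kl.
- by left; apply: case1_row.
- by left; apply: case1_col.
- by right; apply: case2_of_spiral; left.
- by right; apply: case2_of_spiral; right.
Qed.

Lemma transversal_family z : beta != 0 -> transversal_at A B z.
Proof.
move=> b0; split.
  move=> k l l' ll' _ _.
  by have := B_row_inj hbeta k b0 ll'; rewrite -!(payB_pure _ k l).
move=> l i i' ii' _ _.
by have := A_col_inj hbeta l b0 ii'; rewrite -!(payA_pure _ i l).
Qed.

End Family.

(** * Perturbation of points with many best responses *)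

Section General.
Context {R : realType} {m n : nat}.
Notation profile := ('rV[R]_m * 'cV[R]_n)%type.
Variables (A B : 'M[R]_(m, n)).
Implicit Types (z w x : profile) (i j : 'I_m) (k l : 'I_n).

Lemma best_sets_codim2 x i j k l : simplexAB x -> i != j -> k != l ->
  bestAset A x = [set i; j]%SET -> bestBset B x = [set k; l]%SET ->
  codim2_at A B i j k l x.
Proof.
move=> sx ij kl EA EB; split => // r.
  rewrite in_bestAset EA !inE; split => [/orP[]/eqP->|[]->]; rewrite ?eqxx ?orbT //.
    by left.
  by right.
rewrite in_bestBset EB !inE; split => [/orP[]/eqP->|[]->]; rewrite ?eqxx ?orbT //.
  by left.
by right.
Qed.

(** Ties common to [z] and [w] persist under mixing, and the strict inequalities at [w] survive with
    the weight [a]. *)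
Lemma codim2_mix z w i j k l (a : R) : simplexAB z -> codim2_at A B i j k l w ->
  bestA A z.2 i -> bestA A z.2 j -> bestB B z.1 k -> bestB B z.1 l ->
  0 < a <= 1 -> codim2_at A B i j k l (z + a *: (w - z)).
Proof.
move=> sz [sw ij kl hA hB] zi zj zk zl /andP[a0 a1].
have EA r : payA A (z + a *: (w - z)) r = (1 - a) * payA A z r + a * payA A w r.
  by have L := payA_lf A r; rewrite (lfD L) (lfZ L) (lfB L); ring.
have EB r : payB B (z + a *: (w - z)) r = (1 - a) * payB B z r + a * payB B w r.
  by have L := payB_lf B r; rewrite (lfD L) (lfZ L) (lfB L); ring.
have a1' : 0 <= 1 - a by lra.
have iA r : r = i \/ r = j -> bestA A z.2 r by case=> ->.
have kB r : r = k \/ r = l -> bestB B z.1 r by case=> ->.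
split => //; first by apply: simplexAB_convex => //; rewrite a1 ltW.
  move=> r; split => [hr|hr].
    apply/hA => s; have /hA wi : i = i \/ i = j by left.
    have h1 := wi s; have h2 := zi r; have h3 := hr i; have h4 := wi r.
    rewrite -!/(payA A _ _) in h1 h2 h3 h4 *; rewrite !EA in h3.
    have h5 : (1 - a) * payA A z r <= (1 - a) * payA A z i by rewrite ler_wpM2l.
    have h6 : a * payA A w i <= a * payA A w r by lra.
    by rewrite ler_pM2l // in h6; lra.
  move=> s; rewrite -!/(payA A _ _) !EA; apply: lerD.
    by apply: ler_wpM2l => //; apply: iA.
  by apply: ler_wpM2l; [exact: ltW|move/hA: hr; apply].
move=> r; split => [hr|hr].
  apply/hB => s; have /hB wi : k = k \/ k = l by left.
  have h1 := wi s; have h2 := zk r; have h3 := hr k; have h4 := wi r.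
  rewrite -!/(payB B _ _) in h1 h2 h3 h4 *; rewrite !EB in h3.
  have h5 : (1 - a) * payB B z r <= (1 - a) * payB B z k by rewrite ler_wpM2l.
  have h6 : a * payB B w k <= a * payB B w r by lra.
  by rewrite ler_pM2l // in h6; lra.
move=> s; rewrite -!/(payB B _ _) !EB; apply: lerD.
  by apply: ler_wpM2l => //; apply: kB.
by apply: ler_wpM2l; [exact: ltW|move/hB: hr; apply].
Qed.

(** The point [z] may have further best responses. Mixing it with [w] produces codimension two
    saddles accumulating at [z], each with two diverging rays. *)
Lemma saddle_not_extends z w i j k l : simplexAB z -> codim2_at A B i j k l w ->
  bestA A z.2 i -> bestA A z.2 j -> bestB B z.1 k -> bestB B z.1 l ->
  saddle_signs A B i j k l -> ~ offZ_flow_extends A B z.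
Proof.
move=> sz cw zi zj zk zl sg; have [sw ij _ _ _] := cw.
apply: (two_rays_not_extends sz (pure_neq (k := k) (l := l) ij)) => e e0.
pose a := Num.min 1 (e / (1 + `|w - z|) / 2).
have n0 : 0 < 1 + `|w - z| by have := normr_ge0 (w - z); lra.
have a0 : 0 < a by rewrite lt_min ltr01 !divr_gt0.
have a1 : a <= 1 by rewrite ge_min lexx.
have ae : a <= e / (1 + `|w - z|) / 2 by rewrite ge_min lexx orbT.
have cx := codim2_mix sz cw zi zj zk zl (_ : 0 < a <= 1).
have {}cx := cx ltac:(by rewrite a0).
exists (z + a *: (w - z)); last first.
  by split; [case: cx|apply: (weak_saddle_rays cx (saddle_signs_weak sg))].
rewrite addrAC subrr add0r normrZ ger0_norm ?(ltW a0) //.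
have : a * (1 + `|w - z|) <= e / 2.
  apply: le_trans (_ : e / (1 + `|w - z|) / 2 * (1 + `|w - z|) <= _).
    by rewrite ler_pM2r.
  by rewrite mulrAC divfK // gt_eqF.
rewrite mulrDr mulr1; lra.
Qed.

Lemma BRA_pure (q : 'cV[R]_n) i : BRA A q = [set pureA i] <-> strictA A q i.
Proof.
have pureBR r : bestA A q r -> BRA A q (pureA r).
  move=> hr; split; last first.
    move=> s; rewrite mxE /=; have [-> //|_] := eqVneq s r.
    by rewrite /= eqxx.
  split => [s|]; first by rewrite mxE.
  by rewrite (bigD1 r) //= mxE !eqxx big1 ?addr0 // => s sr; rewrite mxE (negbTE sr).
have pureI r s : pureA r = pureA s :> 'rV[R]_m -> r = s.
  move=> /rowP/(_ r); rewrite !mxE !eqxx /= => /eqP.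
  by case: (eqVneq r s) => //= _; rewrite oner_eq0.
split => [E|st].
  have only r : bestA A q r -> r = i.
    by move=> /pureBR; rewrite E => /pureI.
  have [c hc] := exists_best (fun r => (A *m q) r 0) i.
  have ci := only c hc; subst c.
  move=> r ri; rewrite lt_neqAle hc andbT; apply/negP => /eqP Er.
  have /only ri' : bestA A q r by move=> s; rewrite Er.
  by rewrite ri' eqxx in ri.
have bi : bestA A q i.
  by move=> r; have [->//|ri] := eqVneq r i; apply/ltW/st.
apply/seteqP; split => x /=; last by move=> ->; apply: pureBR.
move=> [[x0 x1] hx]; have z r : r != i -> x 0 r = 0.
  move=> ri; apply/eqP/negPn/negP => /hx/(_ i) h.
  by have := st r ri; rewrite ltNge h.
rewrite (bigD1 i) //= big1 ?addr0 in x1 => [|r ri]; last exact: z.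
apply/rowP => r; rewrite mxE eqxx /=; have [->|ri] := eqVneq r i; first by [].
by rewrite z.
Qed.

Lemma BRB_pure (q : 'rV[R]_m) k : BRB B q = [set pureB k] <-> strictB B q k.
Proof.
have pureBR r : bestB B q r -> BRB B q (pureB r).
  move=> hr; split; last first.
    move=> s; rewrite mxE /= andbT; have [-> //|_] := eqVneq s r.
    by rewrite /= eqxx.
  split => [s|]; first by rewrite mxE.
  by rewrite (bigD1 r) //= mxE !eqxx big1 ?addr0 // => s sr; rewrite mxE (negbTE sr).
have pureI r s : pureB r = pureB s :> 'cV[R]_n -> r = s.
  move=> /colP/(_ r); rewrite !mxE !eqxx /= andbT => /eqP.
  by case: (eqVneq r s) => //= _; rewrite oner_eq0.
split => [E|st].
  have only r : bestB B q r -> r = k.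
    by move=> /pureBR; rewrite E => /pureI.
  have [c hc] := exists_best (fun r => (q *m B) 0 r) k.
  have ci := only c hc; subst c.
  move=> r ri; rewrite lt_neqAle hc andbT; apply/negP => /eqP Er.
  have /only ri' : bestB B q r by move=> s; rewrite Er.
  by rewrite ri' eqxx in ri.
have bi : bestB B q k.
  by move=> r; have [->//|ri] := eqVneq r k; apply/ltW/st.
apply/seteqP; split => x /=; last by move=> ->; apply: pureBR.
move=> [[x0 x1] hx]; have z r : r != k -> x r 0 = 0.
  move=> ri; apply/eqP/negPn/negP => /hx/(_ k) h.
  by have := st r ri; rewrite ltNge h.
rewrite (bigD1 k) //= big1 ?addr0 in x1 => [|r ri]; last exact: z.
apply/colP => r; rewrite mxE eqxx andbT /=; have [->|ri] := eqVneq r k; first by [].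
by rewrite z.
Qed.

End General.

(** * Existence of codimension two points and of saddles *)

Section Family.
Context {R : realType}.
Variable beta : R.
Hypothesis hbeta : -1 < beta < 1.
Notation A := (Abeta beta).
Notation B := (Bbeta beta).
Notation profile := ('rV[R]_3 * 'cV[R]_3)%type.
Implicit Types (z x : profile) (i j k l : 'I_3).

Let o0 : 'I_3 := @Ordinal 3 0 isT.
Let o1 : 'I_3 := @Ordinal 3 1 isT.
Let o2 : 'I_3 := @Ordinal 3 2 isT.

Lemma exists_codim1A i j : i != j ->
  exists q : 'cV[R]_3, simplexB q /\ forall r, bestA A q r <-> (r = i \/ r = j).
Proof.
move: (hbeta) => hb ij.
wlog -> : i j ij / j = i + 1.
  move=> h; have [E|E] := cyclic_pair ij; first exact: (h i j).
  have [|q [sq hq]] := h j i _ E; first by rewrite eq_sym.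
  by exists q; split => // r; rewrite hq; tauto.
(* On columns [i] and [i + 1] the two rows pay (1, 0) and (beta, 1), so weights proportional to 1
   and [1 - beta] equalize them; [c2] is the margin over the third row. *)
pose c := (2 - beta)^-1.
have c0 : 0 < c by rewrite invr_gt0; lra.
have c1 : c * (2 - beta) = 1 by rewrite mulVf // gt_eqF //; lra.
have c2 : 0 < c * (1 - beta + beta ^+ 2).
  by apply: mulr_gt0 => //; have := sqr_ge0 beta; lra.
have c3 : 0 < c * (1 - beta) by apply: mulr_gt0 => //; lra.
pose q : 'cV[R]_3 := \col_r (if r == i then c else if r == i + 1 then c * (1 - beta) else 0).
have sq : simplexB q.
  split; first by move=> r; rewrite mxE; case: ifP => _; [lra|case: ifP => _; lra].
  by rewrite sum3 /q !mxE; have [->|->|->] := ord3P i; rewrite /=; lra.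
have v1 : payA A (0, q) (i + 1) = payA A (0, q) i.
  by rewrite !payA3 /q !mxE; have [->|->|->] := ord3P i; rewrite /=; lra.
have v2 : payA A (0, q) (i + 2%:R) < payA A (0, q) i.
  by rewrite !payA3 /q !mxE; have [->|->|->] := ord3P i; rewrite /=; lra.
have v0 r : payA A (0, q) r <= payA A (0, q) i.
  have [->//|ri] := eqVneq r i; have [->|rj] := eqVneq r (i + 1); first by rewrite v1.
  by rewrite (cyclic_third ri rj) ltW.
exists q; split => // r; split => [hr|[->|->] s]; first 1 last.
- exact: v0.
- by rewrite -!/(payA A (0, q) _) v1 v0.
have [->|ri] := eqVneq r i; first by left.
have [->|rj] := eqVneq r (i + 1); first by right.
by move: (hr i); rewrite -!/(payA A (0, q) _) (cyclic_third ri rj) leNgt v2.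
Qed.

Lemma exists_codim1B k l : k != l ->
  exists p : 'rV[R]_3, simplexA p /\ forall s, bestB B p s <-> (s = k \/ s = l).
Proof.
move: (hbeta) => hb kl.
wlog -> : k l kl / l = k + 1.
  move=> h; have [E|E] := cyclic_pair kl; first exact: (h k l).
  have [|q [sq hq]] := h l k _ E; first by rewrite eq_sym.
  by exists q; split => // r; rewrite hq; tauto.
(* On rows [k] and [k + 2] the two columns pay (- beta, 1) and (1, 0), so weights proportional to 1
   and [1 + beta] equalize them; [c2] is the margin over the third column. *)
pose c := (2 + beta)^-1.
have c0 : 0 < c by rewrite invr_gt0; lra.
have c1 : c * (2 + beta) = 1 by rewrite mulVf // gt_eqF //; lra.
have c2 : 0 < c * (1 + beta + beta ^+ 2).
  by apply: mulr_gt0 => //; have := sqr_ge0 beta; lra.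
have c3 : 0 < c * (1 + beta) by apply: mulr_gt0 => //; lra.
pose p : 'rV[R]_3 := \row_r (if r == k then c else if r == k + 1 then 0 else c * (1 + beta)).
have sp : simplexA p.
  split; first by move=> r; rewrite mxE; case: ifP => _; [lra|case: ifP => _; lra].
  by rewrite sum3 /p !mxE; have [->|->|->] := ord3P k; rewrite /=; lra.
have v1 : payB B (p, 0) (k + 1) = payB B (p, 0) k.
  by rewrite !payB3 /p !mxE; have [->|->|->] := ord3P k; rewrite /=; lra.
have v2 : payB B (p, 0) (k + 2%:R) < payB B (p, 0) k.
  by rewrite !payB3 /p !mxE; have [->|->|->] := ord3P k; rewrite /=; lra.
have v0 r : payB B (p, 0) r <= payB B (p, 0) k.
  have [->//|ri] := eqVneq r k; have [->|rj] := eqVneq r (k + 1); first by rewrite v1.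
  by rewrite (cyclic_third ri rj) ltW.
exists p; split => // r; split => [hr|[->|->] s]; first 1 last.
- exact: v0.
- by rewrite -!/(payB B (p, 0) _) v1 v0.
have [->|ri] := eqVneq r k; first by left.
have [->|rj] := eqVneq r (k + 1); first by right.
by move: (hr k); rewrite -!/(payB B (p, 0) _) (cyclic_third ri rj) leNgt v2.
Qed.

Lemma exists_codim2 i j k l : i != j -> k != l -> exists z, codim2_at A B i j k l z.
Proof.
move=> ij kl; have [q [sq hq]] := exists_codim1A ij.
by have [p [sp hp]] := exists_codim1B kl; exists (p, q); split.
Qed.

(** At [beta = 0] two of the weak inequalities become equalities, and the strict differences that
    they no longer provide are taken from the third row and the third column. *)
Lemma weak_saddle_exists i j : beta <= 0 -> i != j ->
  exists k l, k != l /\ weak_saddle_signs A B i j k l.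
Proof.
move: (hbeta) => hb b0 ij.
have [->|->] := cyclic_pair ij; clear ij; [exists i, (i + 2%:R)|exists (j + 2%:R), j].
  split; first by case3 i.
  by split; split; [| | | |exists i|exists (i + 1)|exists (i + 2%:R)|exists (i + 1)];
    case3 i; rewrite !mxE /=; lra.
split; first by case3 j.
by split; split; [| | | |exists (j + 1)|exists j|exists (j + 1)|exists (j + 2%:R)];
  case3 j; rewrite !mxE /=; lra.
Qed.

(** Meant for points where all columns are best responses, so that the columns of the saddle can be
    chosen freely. *)
Lemma saddle_row_exists i j : beta < 0 -> i != j ->
  exists k l, k != l /\ saddle_signs A B i j k l.
Proof.
move: (hbeta) => hb b0 ij.
have [->|->] := cyclic_pair ij; clear ij; [exists i, (i + 2%:R)|exists (j + 2%:R), j].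
  by split; [|split]; case3 i; rewrite // !mxE /=; lra.
by split; [|split]; case3 j; rewrite // !mxE /=; lra.
Qed.

Lemma saddle_col_exists k l : beta < 0 -> k != l ->
  exists i j, i != j /\ saddle_signs A B i j k l.
Proof.
move: (hbeta) => hb b0 kl.
have [->|->] := cyclic_pair kl; clear kl; [exists (k + 2%:R), (k + 1)|exists (l + 1), (l + 2%:R)].
  by split; [|split]; case3 k; rewrite // !mxE /=; lra.
by split; [|split]; case3 l; rewrite // !mxE /=; lra.
Qed.

End Family.

(** * Negative [beta], and failure of transversality at [beta = 0] *)

Section Family.
Context {R : realType}.
Variable beta : R.
Hypothesis hbeta : -1 < beta < 1.
Notation A := (Abeta beta).
Notation B := (Bbeta beta).
Notation profile := ('rV[R]_3 * 'cV[R]_3)%type.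
Notation X := (Zstar A B `\` in_case1 A B).
Implicit Types (z x : profile) (i j k l : 'I_3).

Lemma Zstar_best_sets z : simplexAB z -> Zstar A B z ->
  (exists i j, i != j /\ bestAset A z = [set i; j]%SET) \/
    bestAset A z = [set: 'I_3]%SET.
Proof.
move=> sz [_ [i [j [ij [_ hi hj]]]]].
have [[a EA]|EA|] := set3_cases (bestAset_nonempty A sz); [|by left|by right].
have /in_bestAset := hi; have /in_bestAset := hj.
by rewrite EA !inE => /eqP ja /eqP ia; rewrite ia ja eqxx in ij.
Qed.

Lemma Zstar_best_setsB z : simplexAB z -> Zstar A B z ->
  (exists k l, k != l /\ bestBset B z = [set k; l]%SET) \/
    bestBset B z = [set: 'I_3]%SET.
Proof.
move=> sz [[i [j [ij [_ hi hj]]]] _].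
have [[a EA]|EA|] := set3_cases (bestBset_nonempty B sz); [|by left|by right].
have /in_bestBset := hi; have /in_bestBset := hj.
by rewrite EA !inE => /eqP ja /eqP ia; rewrite ia ja eqxx in ij.
Qed.

Lemma codim2_saddle z i j k l : beta < 0 -> codim2_at A B i j k l z ->
  ~ in_case1 A B z ->
  saddle_signs A B i j k l \/ saddle_signs A B i j l k.
Proof.
move=> b0 cz nc; have [_ ij kl _ _] := cz.
have [h|h|h|h] := signs_neg hbeta b0 ij kl; [| |by left|by right].
  by case: nc; exists i, j, k, l; split => //; apply: case1_row.
by case: nc; exists i, j, k, l; split => //; apply: case1_col.
Qed.

Lemma codim2_sym z i j k l : codim2_at A B i j k l z -> codim2_at A B i j l k z.
Proof.
by move=> [sz ij kl hA hB]; split => //; [rewrite eq_sym|move=> r; rewrite hB; tauto].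
Qed.

Lemma case1_signs z i j k l : beta < 0 -> codim2_at A B i j k l z ->
  case1 A B i j k l z ->
  0 < (A i k - A j k) * (A i l - A j l) \/ 0 < (B i k - B i l) * (B j k - B j l).
Proof.
move=> b0 cz c1; have [_ ij kl _ _] := cz.
have [h|h|h|h] := signs_neg hbeta b0 ij kl; [by left|by right|..]; exfalso.
  by apply: saddle_not_case1 c1; left.
by apply: saddle_not_case1 c1; right.
Qed.

Lemma Zstar_intro z : simplexAB z ->
  ((exists i j, i != j /\ bestAset A z = [set i; j]%SET) \/
    bestAset A z = [set: 'I_3]%SET) ->
  ((exists k l, k != l /\ bestBset B z = [set k; l]%SET) \/
    bestBset B z = [set: 'I_3]%SET) -> Zstar A B z.
Proof.
move=> [s1 s2] hA hB; split.
  have [k [l [kl hk hl]]] : exists k l, [/\ k != l, k \in bestBset B z & l \in bestBset B z].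
    case: hB => [[k [l [kl ->]]]|->]; first by exists k, l; rewrite !inE !eqxx orbT.
    by exists 0, 1; rewrite !inE.
  by exists k, l; split => //; split => //; apply/in_bestBset.
have [k [l [kl hk hl]]] : exists k l, [/\ k != l, k \in bestAset A z & l \in bestAset A z].
  case: hA => [[k [l [kl ->]]]|->]; first by exists k, l; rewrite !inE !eqxx orbT.
  by exists 0, 1; rewrite !inE.
by exists k, l; split => //; split => //; apply/in_bestAset.
Qed.

(** Outside the exceptional set, a point of [Zstar] is in case 1, whose sign condition gives a
    dominated strategy. Off [Zstar] one player has a single best response, and the other has
    distinct payoffs against it. *)
Lemma reducible_neg x : beta < 0 -> simplexAB x -> ~ X x ->
  reducible A B (bestAset A x) (bestBset B x).
Proof.
move=> b0 sx nX; have bn : beta != 0 by rewrite lt_eqF.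
have neA := bestAset_nonempty A sx; have neB := bestBset_nonempty B sx.
have red2 : Zstar A B x -> reducible A B (bestAset A x) (bestBset B x).
  move=> Zx; have [i [j [k [l [cx c1]]]]] : in_case1 A B x.
    by apply: contrapT => n1; apply: nX.
  have [_ ij kl _ _] := cx; have [-> ->] := codim2_best_sets cx.
  have [h|h] := case1_signs b0 cx c1.
    by apply: reducible_2x2_row => //; apply: B_row_inj.
  by apply: reducible_2x2_col => //; apply: A_col_inj.
have [[a EA]|hA|hA] := set3_cases neA.
- by rewrite EA; apply: reducible_1xn => // k l; apply: B_row_inj.
- have [[k EB]|hB|hB] := set3_cases neB.
  + by rewrite EB; apply: reducible_nx1 => // i j; apply: A_col_inj.
  + by apply/red2/Zstar_intro => //; left.
  + by apply/red2/Zstar_intro => //; [left|right].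
- have [[k EB]|hB|hB] := set3_cases neB.
  + by rewrite EB; apply: reducible_nx1 => // i j; apply: A_col_inj.
  + by apply/red2/Zstar_intro => //; [right|left].
  + by apply/red2/Zstar_intro => //; right.
Qed.

Lemma saddle_settled i j k l : saddle_signs A B i j k l ->
  settled A B [set i; j]%SET [set k; l]%SET (pureA i, pureB k).
Proof.
move=> [h1 h2 h3 h4]; apply: settled_pure; rewrite ?inE ?eqxx //.
  by move=> r; rewrite !inE => /orP[]/eqP->; rewrite ?eqxx.
by move=> r; rewrite !inE => /orP[]/eqP->; rewrite ?eqxx.
Qed.

Lemma settled_neg x : beta < 0 -> simplexAB x -> X x ->
  (exists P, settled A B (bestAset A x) (bestBset B x) P) \/ BRAB A B x x.
Proof.
move=> b0 sx [Zx nc].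
have [[i [j [ij EA]]]|EA] := Zstar_best_sets sx Zx;
  have [[k [l [kl EB]]]|EB] := Zstar_best_setsB sx Zx.
- left; have cx := best_sets_codim2 sx ij kl EA EB; rewrite EA EB.
  case: (codim2_saddle b0 cx nc) => sg.
    by exists (pureA i, pureB k); apply: saddle_settled.
  by exists (pureA i, pureB l); rewrite (finset.setUC [set k]%SET); apply: saddle_settled.
- left; rewrite EA EB; have [a [k [aI h1 h2]]] := strict_2x3 hbeta b0 ij.
  exists (pureA a, pureB k); apply: settled_pure; rewrite // ?inE //.
  by move=> s _; apply: h2.
- left; rewrite EA EB; have [i [a [aI h1 h2]]] := strict_3x2 hbeta b0 kl.
  exists (pureA i, pureB a); apply: settled_pure; rewrite // ?inE //.
  by move=> s _; apply: h1.
- right; rewrite (_ : x = E); first exact: BRAB_E.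
  apply: (all_best_E hbeta) => // r.
    by apply/in_bestAset; rewrite EA inE.
  by apply/in_bestBset; rewrite EB inE.
Qed.

Lemma flow_off_neg : beta < 0 -> defines_flow_off A B X.
Proof.
by move=> b0; apply: flow_off => x sx; [apply: reducible_neg|apply: settled_neg].
Qed.

(** Near [z] best responses can only disappear, so a nearby point of [Zstar] has codimension two
    with the same indices. Case 1 amounts to signs of payoff differences and hence holds there
    too. *)
Lemma case1_extends z : beta < 0 -> in_case1 A B z -> offZ_flow_extends A B z.
Proof.
move=> b0 [i [j [k [l [cz c1]]]]]; have [r r0 hr] := codim2_near cz.
apply: (flow_off_extends (flow_off_neg b0) r0) => x sx xz [Zx nc]; apply: nc.
have [cA cB] := hr x (ltW xz); have [_ ij kl _ _] := cz.
have subA : (bestAset A x \subset [set i; j])%SET.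
  by apply/fintype.subsetP => s /in_bestAset; apply: cA.
have subB : (bestBset B x \subset [set k; l])%SET.
  by apply/fintype.subsetP => s /in_bestBset; apply: cB.
have card2 (S T : {set 'I_3}) : (#|T| = 2)%N -> S \subset T ->
    (exists a b, a != b /\ S = [set a; b]%SET) \/ S = [set: 'I_3]%SET -> S = T.
  move=> T2 ST hS; apply/eqP; rewrite eqEcard ST T2.
  by case: hS => [[a [b [ab ->]]]|->]; rewrite ?cards2 ?ab // cardsT card_ord.
have EA := card2 _ _ _ subA (Zstar_best_sets sx Zx).
have EB := card2 _ _ _ subB (Zstar_best_setsB sx Zx).
have cx : codim2_at A B i j k l x.
  by apply: best_sets_codim2 => //; [apply: EA|apply: EB]; rewrite cards2 ?ij ?kl.
exists i, j, k, l; split => //.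
by have [h|h] := case1_signs b0 cz c1; [apply: case1_row|apply: case1_col].
Qed.

(** The best responses at such a point always contain a saddle: at codimension two points because
    case 1 is excluded, elsewhere because every pair of rows, and every pair of columns, belongs to
    one. *)
Lemma not_case1_not_extends z : beta < 0 -> X z -> ~ offZ_flow_extends A B z.
Proof.
move=> b0 [Zz nc].
have sz : simplexAB z by case: Zz => [[k [l [_ [s1 _ _]]]] [i [j [_ [s2 _ _]]]]].
have [i [j [k [l [ij kl [hi hj hk hl] sg]]]]] : exists i j k l, [/\ i != j, k != l,
    [/\ i \in bestAset A z, j \in bestAset A z, k \in bestBset B z &
        l \in bestBset B z] & saddle_signs A B i j k l].
  have [[i [j [ij EA]]]|EA] := Zstar_best_sets sz Zz;
    have [[k [l [kl EB]]]|EB] := Zstar_best_setsB sz Zz; rewrite EA EB.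
  - have cz := best_sets_codim2 sz ij kl EA EB.
    case: (codim2_saddle b0 cz nc) => sg; [exists i, j, k, l|exists i, j, l, k].
      by split; rewrite // !inE !eqxx ?orbT.
    by split; rewrite // 1?eq_sym // !inE !eqxx ?orbT.
  - have [k [l [kl sg]]] := saddle_row_exists hbeta b0 ij.
    by exists i, j, k, l; split; rewrite // !inE !eqxx ?orbT.
  - have [i [j [ij sg]]] := saddle_col_exists hbeta b0 kl.
    by exists i, j, k, l; split; rewrite // !inE !eqxx ?orbT.
  - have [k [l [kl sg]]] := saddle_row_exists hbeta b0 (isT : (0 : 'I_3) != 1).
    by exists 0, 1, k, l; split; rewrite // !inE.
have [w cw] := exists_codim2 hbeta ij kl.
by apply: (saddle_not_extends sz cw _ _ _ _ sg); rewrite ?in_bestAset ?in_bestBset.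
Qed.

Lemma not_case1_singular z i j k l : beta < 0 -> codim2_at A B i j k l z ->
  ~ in_case1 A B z -> ~ offZ_flow_converges A B z /\ ~ unique_at A B z.
Proof.
move=> b0 cz nc; case: (codim2_saddle b0 cz nc) => sg.
  by split; [apply: weak_saddle_not_converges cz (saddle_signs_weak sg)
            |apply: saddle_not_unique cz sg].
by split; [apply: weak_saddle_not_converges (codim2_sym cz) (saddle_signs_weak sg)
          |apply: saddle_not_unique (codim2_sym cz) sg].
Qed.

Lemma case13_neg z i j k l : beta < 0 -> codim2_at A B i j k l z ->
  case1 A B i j k l z \/ case3 A B i j k l.
Proof.
move=> b0 cz; have [_ ij kl _ _] := cz.
have [h|h|h|h] := signs_neg hbeta b0 ij kl.
- by left; apply: case1_row.
- by left; apply: case1_col.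
- by right; apply: case3_of_saddle; left.
- by right; apply: case3_of_saddle; right.
Qed.

Lemma not_transversal_row k : beta = 0 ->
  let S := [set z | ZBkl B (k - 1) k z.1 /\ simplexB z.2 /\ BRA A z.2 = [set pureA k]] in
  (exists z, S z) /\ (forall z, S z -> ~ transversal_at A B z).
Proof.
move=> b0 S; have [eA eB] := @simplex_E R; split.
  (* [E.1] makes B indifferent between all columns, and row [k] is the strict reply to column
     [k]. *)
  exists (E.1, pureB k); split; last split.
  - by split => // r; case: (BRAB_E beta) => _ [_]; apply; rewrite mxE gt_eqF // invr_gt0.
  - by case: (@pure_simplex R 3 3 0 k).
  - apply/BRA_pure => r rk; rewrite -!/(payA A (pureA 0, pureB k) _) !payA_pure.
    by rewrite b0; move: rk; clear; case3 k; case3 r => // _; rewrite !mxE /=; lra.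
(* In row [k] of B the entries [k - 1] and [k] are 0 and [- beta], which coincide here. *)
move=> z [hz [_ /BRA_pure st]] [/(_ k (k - 1) k) h _].
have : (pureA k *m B) 0 (k - 1) != (pureA k *m B) 0 k.
  by apply: h => //; clear; case3 k.
rewrite -!/(payB B (pureA k, pureB k) _) !payB_pure b0.
by clear; case3 k; rewrite !mxE /= ?oppr0 eqxx.
Qed.

Lemma not_transversal_col l : beta = 0 ->
  let S := [set z | simplexA z.1 /\ BRB B z.1 = [set pureB l] /\
                    ZAij A (l + 1) (l + 2) z.2] in
  (exists z, S z) /\ (forall z, S z -> ~ transversal_at A B z).
Proof.
move=> b0 S; have [eA eB] := @simplex_E R; split.
  (* Column [l] is the strict reply to row [l - 1], and [E.2] makes A indifferent between all
     rows. *)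
  exists (pureA (l - 1), E.2); split; last split.
  - by case: (@pure_simplex R 3 3 (l - 1) 0).
  - apply/BRB_pure => r rk; rewrite -!/(payB B (pureA (l - 1), pureB 0) _) !payB_pure.
    by rewrite b0; move: rk; clear; case3 l; case3 r => // _; rewrite !mxE /=; lra.
  - by split => // r; case: (BRAB_E beta) => [[_ +] _]; apply; rewrite mxE gt_eqF // invr_gt0.
move=> z [_ [/BRB_pure st hz]] [_ /(_ l (l + 1) (l + 2)) h].
have : (A *m pureB l) (l + 1) 0 != (A *m pureB l) (l + 2) 0.
  by apply: h => //; clear; case3 l.
rewrite -!/(payA A (pureA l, pureB l) _) !payA_pure b0.
by clear; case3 l; rewrite !mxE /= ?oppr0 eqxx.
Qed.

End Family.

Theorem proposition3p1 (R : realType) (beta : R) (hbeta : -1 < beta < 1) :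
  let A := Abeta beta in
  let B := Bbeta beta in
  flow_unique_off_Z A B /\
  (0 < beta -> defines_flow_off A B [set E]) /\
  (beta <= 0 ->
     forall i j : 'I_3, i != j -> exists k l : 'I_3, k != l /\
       (exists z, codim2_at A B i j k l z) /\
       (forall z, codim2_at A B i j k l z -> ~ offZ_flow_converges A B z)) /\
  (* (i) *)
  (beta < 0 ->
     (forall z, Z A B z -> ~ Zstar A B z -> transversal_at A B z) /\
     (forall i j k l z, codim2_at A B i j k l z ->
        case1 A B i j k l z \/ case3 A B i j k l) /\
     (forall z, in_case1 A B z -> offZ_flow_extends A B z) /\
     defines_flow_off A B (Zstar A B `\` in_case1 A B) /\
     (forall z, (Zstar A B `\` in_case1 A B) z -> ~ offZ_flow_extends A B z) /\
     (forall i j k l z, codim2_at A B i j k l z -> ~ in_case1 A B z ->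
        ~ offZ_flow_converges A B z /\ ~ unique_at A B z)) /\
  (* (ii) *)
  (beta = 0 ->
     (forall k : 'I_3,
        let S := [set z | ZBkl B (k - 1) k z.1 /\
                          simplexB z.2 /\ BRA A z.2 = [set pureA k]] in
        (exists z, S z) /\ (forall z, S z -> ~ transversal_at A B z)) /\
     (forall l : 'I_3,
        let S := [set z | simplexA z.1 /\ BRB B z.1 = [set pureB l] /\
                          ZAij A (l + 1) (l + 2) z.2] in
        (exists z, S z) /\ (forall z, S z -> ~ transversal_at A B z))) /\
  (* (iii) *)
  (0 < beta ->
     (forall z, Z A B z -> ~ Zstar A B z -> transversal_at A B z) /\
     (forall i j k l z, codim2_at A B i j k l z ->
        case1 A B i j k l z \/ case2 A B i j k l) /\
     (forall z, simplexAB z -> z <> E -> offZ_flow_extends A B z) /\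
     defines_flow_off A B [set E]).
Proof.
move=> A B.
split; first exact: flow_unique_offZ.
split; first by move=> b0; apply: flow_off_E.
split.
  move=> b0 i j ij; have [k [l [kl ws]]] := weak_saddle_exists hbeta b0 ij.
  exists k, l; split => //; split; first exact: exists_codim2.
  by move=> z cz; apply: weak_saddle_not_converges cz ws.
split.
  move=> b0; have bn : beta != 0 by rewrite lt_eqF.
  split; first by move=> z _ _; apply: transversal_family.
  split; first by move=> i j k l z; apply: case13_neg.
  split; first by move=> z; apply: case1_extends.
  split; first exact: flow_off_neg.
  split; first by move=> z; apply: not_case1_not_extends.
  by move=> i j k l z; apply: not_case1_singular.
split.
  by move=> b0; split; [move=> k; apply: not_transversal_row|
                        move=> l; apply: not_transversal_col].
move=> b0; have bn : beta != 0 by rewrite gt_eqF.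
split; first by move=> z _ _; apply: transversal_family.
split; first by move=> i j k l z; apply: case12_pos.
split; first by move=> z; apply: extends_pos.
exact: flow_off_E.
Qed.
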